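(* Let $p$ be a prime with $p \equiv 1$ or $49 \pmod{60}$, let $b,c$ be positive integers with $p=b^{2}+bc+c^{2}$, let $m\geq 2$ be an integer, and let $\mathcal Q$ be a finite directly regular $4$-polytope of type $\{\{6,3\}_{(m,0)},\{3,5\}\}$ such that $p(p^{2}-1)$ does not divide $|\Gamma(\mathcal{Q})|$. Then there exists a chiral $4$-polytope, whose automorphism group is isomorphic to $L_{2}(p)\times \Gamma^{+}(\mathcal{Q})$, of type $\{\{6,3\}_{(m,0)},\{3,5\}\}$ if $p\mid m$, and of type $\{\{6,3\}_{(mb,mc)},\{3,5\}\}$ if $p\nmid m$. Its facets are regular in the first case and chiral in the second case.
   Context: An abstract $n$-polytope is a ranked poset (ranks $-1,\dots,n$) with a least and a greatest face, all flags of size $n+2$, strongly flag-connected, and satisfying the diamond condition; $\Gamma(\mathcal P)$ is its automorphism group. $\mathcal P$ is regular if $\Gamma(\mathcal P)$ is flag-transitive, and chiral if $\Gamma(\mathcal P)$ has exactly two flag orbits with adjacent flags always in distinct orbits. For regular $\mathcal P$, $\Gamma(\mathcal P)$ is generated by involutions $\rho_0,\dots,\rho_{n-1}$; the rotation subgroup $\Gamma^+(\mathcal P)$ is generated by $\sigma_i=\rho_{i-1}\rho_i$, has index at most $2$, and $\mathcal P$ is directly regular if the index is $2$. A polytope is of type $\{\mathcal P_1,\mathcal P_2\}$ if its facets are isomorphic to $\mathcal P_1$ and its vertex-figures to $\mathcal P_2$. $\{3,5\}$ is the icosahedron; $\{6,3\}_{(b,c)}$ denotes the toroidal map obtained from the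 hexagonal tessellation of the plane by factoring out the translation lattice generated by the vector $(b,c)$ (in hexagonal-lattice coordinates) and its image under rotation by $60^\circ$; it is regular if $bc=0$ or $b=c$ and chiral otherwise. $L_2(p)=PSL_2(p)$. *)

(* Defs.v *)
From HB Require Import structures.
From mathcomp Require Import all_boot all_order all_algebra all_fingroup.
From mathcomp Require Import all_solvable.
From mathcomp Require Import boolp generic_quotient zify.

Set Implicit Arguments.
Unset Strict Implicit.
Unset Printing Implicit Defensive.

Import Order.TTheory GRing.Theory.

Definition poset_iso (d1 d2 : Order.disp_t) (P : porderType d1)
    (Q : porderType d2) : Prop :=
  exists f : P -> Q, bijective f /\ {mono f : x y / (x <= y)%O}.

Definition section_of (d : Order.disp_t) (P : finPOrderType d) (F G : P) :=
  {H : P | (F <= H <= G)%O}.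

HB.instance Definition _ d (P : finPOrderType d) (F G : P) :=
  SubFinite.on (section_of F G).
HB.instance Definition _ d (P : finPOrderType d) (F G : P) :=
  [SubChoice_isSubPOrder of section_of F G by <: with d].

Section Flags.
Variables (d : Order.disp_t) (P : finPOrderType d).
Implicit Types (F G H : P) (A Phi Psi : {set P}).

Definition is_chain A : bool :=
  [forall F in A, forall G in A, (F >=< G)%O].

Definition flags : {set {set P}} := [set Phi | maxset is_chain Phi].

(* When all flags have the same size this is the usual rank: the least face
   has rank -1, and a flag meets every rank exactly once. *)
Definition face_rank F : int :=
  ((\max_(A : {set P} | is_chain A && [forall G in A, (G <= F)%O]) #|A|)%:Z
    - 2)%R.

Definition adjacent Phi Psi : bool :=
  [&& Phi \in flags, Psi \in flags, #|Phi :\: Psi| == 1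
    & #|Psi :\: Phi| == 1].

Definition adjacent_at (i : nat) Phi Psi : bool :=
  adjacent Phi Psi && [forall F in Phi :\: Psi, (face_rank F == i%:Z)%R].

Definition strongly_flag_connected : Prop :=
  forall Phi Psi, Phi \in flags -> Psi \in flags ->
    connect [rel A B : {set P} | [&& adjacent A B,
                                     Phi :&: Psi \subset A
                                   & Phi :&: Psi \subset B]] Phi Psi.

Definition diamond_condition : Prop :=
  forall F G, (F < G)%O -> face_rank G = (face_rank F + 2)%R ->
    #|[set H | (F < H < G)%O]| = 2.

Definition automorphisms : {set {perm P}} :=
  [set s : {perm P} | [forall F, forall G, (s F <= s G)%O == (F <= G)%O]].

Fact automorphisms_group_set : group_set automorphisms.
Proof.
apply/group_setP; split=> [|s t].
  by rewrite inE; apply/forallP=> F; apply/forallP=> G; rewrite !perm1.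
rewrite !inE => /'forall_'forall_eqP hs /'forall_'forall_eqP ht.
by apply/'forall_'forall_eqP=> F G; rewrite !permM ht hs.
Qed.

Canonical automorphisms_group := Group automorphisms_group_set.

(* ['P^*] is the action of permutations of the faces on sets of faces. *)
Definition regular : bool := [transitive automorphisms, on flags | 'P^*].

Definition chiral : Prop :=
  #|orbit 'P^* automorphisms @: flags| = 2 /\
  forall Phi Psi, adjacent Phi Psi ->
    orbit 'P^* automorphisms Phi <> orbit 'P^* automorphisms Psi.

(* rho_i relative to the base flag Phi: an automorphism of a polytope is
   determined by the image of Phi, so there is at most one choice. *)
Definition rho Phi (i : nat) : {perm P} :=
  odflt 1%g [pick s in automorphisms | adjacent_at i Phi [set s F | F in Phi]].

Definition sigma Phi (i : nat) : {perm P} := (rho Phi i.-1 * rho Phi i)%g.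

(* Generated by sigma_1, ..., sigma_(n-1), where n is the rank of P. *)
Definition rotation_group (n : nat) Phi : {group {perm P}} :=
  <<[set sigma Phi i | i : 'I_n & 0 < i]>>%G.

End Flags.

Arguments flags {d} P.
Arguments strongly_flag_connected {d} P.
Arguments diamond_condition {d} P.
Arguments automorphisms {d} P.
Arguments regular {d} P.
Arguments chiral {d} P.

Definition directly_regular (n : nat) (d : Order.disp_t)
    (P : finPOrderType d) : Prop :=
  regular P /\
  forall Phi, Phi \in flags P ->
    #|automorphisms P : rotation_group n Phi|%g = 2.

(* The least and greatest faces come with [finTBPOrderType], and flags of equal
   size make [face_rank] a rank function with values -1, ..., n. *)
Definition polytope (n : nat) (d : Order.disp_t) (P : finTBPOrderType d) :
    Prop :=
  [/\ forall Phi, Phi \in flags P -> #|Phi| = n.+2,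
      strongly_flag_connected P
    & diamond_condition P].

Notation facet F := (section_of \bot%O F).
Notation vertex_figure F := (section_of F \top%O).

Definition has_type (n : nat) (d d1 d2 : Order.disp_t) (P : finTBPOrderType d)
    (P1 : porderType d1) (P2 : porderType d2) : Prop :=
  (forall F : P, face_rank F = (n%:Z - 1)%R -> poset_iso (facet F) P1) /\
  (forall F : P, face_rank F = 0%R -> poset_iso (vertex_figure F) P2).

(* The vertex (i, s, t) is the point of R^3 whose coordinates of indices
   i, i + 1, i + 2 mod 3 are 0, (-1)^s, (-1)^t phi, with phi the golden ratio;
   two of these points span an edge iff their inner product is phi. *)
Definition icosa_vertex : finType := ('Z_3 * bool * bool)%type.

Definition icosa_adj (v w : icosa_vertex) : bool :=
  let: (i, s, t) := v in
  let: (j, s', t') := w in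
  [|| [&& j == i, s != s' & t == t'],
      (j == i + 1)%R && (t == s')
    | (i == j + 1)%R && (t' == s)].

(* The faces of {3,5}, as vertex sets: the cliques (empty set, vertices, edges
   and triangles; there are no larger ones), and the improper greatest face. *)
Definition icosa_face (A : {set icosa_vertex}) : bool :=
  (A == setT) || [forall v in A, forall w in A, (v != w) ==> icosa_adj v w].

Definition icosahedron := {A : {set icosa_vertex} | icosa_face A}.

HB.instance Definition _ := SubFinite.on icosahedron.

Definition icosa_le (A B : icosahedron) : bool := val A \subset val B.

Fact icosa_le_refl : reflexive icosa_le.
Proof. by move=> A; apply: subxx. Qed.

Fact icosa_le_anti : antisymmetric icosa_le.
Proof. by move=> A B h; apply/val_inj/eqP; rewrite eqEsubset. Qed.

Fact icosa_le_trans : transitive icosa_le.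
Proof. by move=> B A C; apply: subset_trans. Qed.

HB.instance Definition _ := Order.Le_isPOrder.Build (Order.Disp tt tt)
  icosahedron icosa_le_refl icosa_le_anti icosa_le_trans.

(* Coordinates (x, y) of the lattice of tile centres of the hexagonal
   tessellation are relative to two adjacent centres e1, e2 at an angle of 60
   degrees, so that the squared length of (x, y) is x^2 + x y + y^2.  Tiles are
   indexed by their centres, and vertices and edges by the tiles meeting there,
   see [hex_tiles]. *)
Notation hex_point := (int * int)%type.

Definition rot60 (v : hex_point) : hex_point := (- v.2, v.1 + v.2)%R.

Variant hexagonal_tessellation :=
  | HexLeast
  | HexVertex of bool & hex_point
  | HexEdge of 'I_3 & hex_point
  | HexTile of hex_point
  | HexGreatest.

Definition hex_encode (F : hexagonal_tessellation) :=
  match F with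
  | HexLeast => inl true
  | HexGreatest => inl false
  | HexVertex s v => inr (inl (s, v))
  | HexEdge k v => inr (inr (inl (k, v)))
  | HexTile v => inr (inr (inr v))
  end.

Definition hex_decode
    (c : bool + (bool * hex_point + ('I_3 * hex_point + hex_point))) :=
  match c with
  | inl true => HexLeast
  | inl false => HexGreatest
  | inr (inl (s, v)) => HexVertex s v
  | inr (inr (inl (k, v))) => HexEdge k v
  | inr (inr (inr v)) => HexTile v
  end.

Fact hex_encodeK : cancel hex_encode hex_decode.
Proof. by case. Qed.

HB.instance Definition _ := Choice.copy hexagonal_tessellation
  (can_type hex_encodeK).

(* The centres of the tiles containing a proper face: three pairwise adjacent
   centres for a vertex, two adjacent ones for an edge. *)
Definition hex_tiles (F : hexagonal_tessellation) : seq hex_point :=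
  match F with
  | HexLeast | HexGreatest => [::]
  | HexVertex false (x, y) => [:: (x, y); (x + 1, y); (x, y + 1)]%R
  | HexVertex true (x, y) => [:: (x + 1, y); (x, y + 1); (x + 1, y + 1)]%R
  | HexEdge k (x, y) =>
      nth [::] [:: [:: (x, y); (x + 1, y)];
                   [:: (x, y); (x, y + 1)];
                   [:: (x + 1, y); (x, y + 1)]]%R k
  | HexTile (x, y) => [:: (x, y)]
  end.

Definition hex_le (F G : hexagonal_tessellation) : bool :=
  match F, G with
  | HexLeast, _ => true
  | _, HexLeast => false
  | _, _ => all [in hex_tiles F] (hex_tiles G)
  end.

Fact hex_le_refl : reflexive hex_le.
Proof.
have rf (s : seq hex_point) : all [in s] s by apply/allP.
by case=> *; rewrite // /hex_le rf.
Qed.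

Fact hex_le_trans : transitive hex_le.
Proof.
have tr (s t u : seq hex_point) : all [in s] t -> all [in t] u -> all [in s] u.
  by move=> /allP st /allP tu; apply/allP=> x /tu /st.
by case=> [|s1 v1|k1 v1|v1|] [|s2 v2|k2 v2|v2|] [|s3 v3|k3 v3|v3|] //;
  apply: tr.
Qed.

Definition hex_level (F : hexagonal_tessellation) : nat :=
  match F with
  | HexLeast => 0
  | HexVertex _ _ => 1
  | HexEdge _ _ => 2
  | HexTile _ => 3
  | HexGreatest => 4
  end.

Fact hex_le_level F G : hex_le F G -> F = G \/ hex_level F < hex_level G.
Proof.
have I3 (k : 'I_3) : [\/ k = inord 0, k = inord 1 | k = inord 2].
  by case: k => [[|[|[|//]]] lt_k3];
    [apply: Or31 | apply: Or32 | apply: Or33]; apply/val_inj; rewrite /= inordK.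
have E (a b x y : int) : ((a, b) == (x, y)) = (a == x) && (b == y) by [].
case: F => [|[] [a b]|k1 [a b]|[a b]|];
  case: G => [|[] [x y]|k2 [x y]|[x y]|] //; rewrite /hex_le;
  try (by right); try (by left).
all: try case: (I3 k1) => ->.
all: try case: (I3 k2) => ->.
all: rewrite /= ?inordK //= ?inE /= ?E => h.
all: solve [ left; suff [-> ->] : a = x /\ b = y by []; lia | exfalso; lia ].
Qed.

Fact hex_le_anti : antisymmetric hex_le.
Proof.
move=> F G /andP[/hex_le_level[//|lt_FG] /hex_le_level[//|lt_GF]].
by have := ltn_trans lt_FG lt_GF; rewrite ltnn.
Qed.

HB.instance Definition _ := Order.Le_isPOrder.Build (Order.Disp tt tt)
  hexagonal_tessellation hex_le_refl hex_le_anti hex_le_trans.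

Definition hex_translate (t : hex_point) (F : hexagonal_tessellation) :=
  match F with
  | HexLeast => HexLeast
  | HexVertex s v => HexVertex s (v + t)%R
  | HexEdge k v => HexEdge k (v + t)%R
  | HexTile v => HexTile (v + t)%R
  | HexGreatest => HexGreatest
  end.

Fact hex_translate_le t : {homo hex_translate t : F G / (F <= G)%O}.
Proof.
have tilesE F : hex_tiles (hex_translate t F) =
    [seq (v + t)%R | v <- hex_tiles F].
  have E (a b : int) : ((a, b) + t)%R = (a + t.1, b + t.2)%R by case: t.
  case: F => [|[] [a b]|[[|[|[|//]]] ?] [a b]|[a b]|] //;
    by rewrite /hex_translate E /hex_tiles /nth /nat_of_ord /map
               ?E ?[(_ + 1 + t.1)%R]addrAC ?[(_ + 1 + t.2)%R]addrAC.
have all_t (r s : seq hex_point) : all [in r] s ->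
    all [in [seq (v + t)%R | v <- r]] [seq (v + t)%R | v <- s].
  by move=> /allP sub_sr; apply/allP=> _ /mapP[v /sub_sr sv ->]; apply: map_f.
move=> F G; rewrite /Order.le /= => le_FG.
have: all [in hex_tiles F] (hex_tiles G) ->
    all [in hex_tiles (hex_translate t F)] (hex_tiles (hex_translate t G)).
  by rewrite !tilesE; apply: all_t.
by case: F G le_FG => [|s1 v1|k1 v1|v1|] [|s2 v2|k2 v2|v2|] // le_FG; apply.
Qed.

Section Torus.
Local Open Scope quotient_scope.
Variables b c : nat.

Definition torus_lattice (t : hex_point) : Prop :=
  let v : hex_point := (b%:Z, c%:Z)%R in
  exists k l : int, t = (v *~ k + rot60 v *~ l)%R.

Definition torus_equiv (F G : hexagonal_tessellation) : bool :=
  `[< exists2 t, torus_lattice t & G = hex_translate t F >].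

Fact torus_equiv_is_equiv : equiv_class_of torus_equiv.
Proof.
have t0 F : hex_translate 0%R F = F by case: F => *; rewrite /= ?addr0.
have tD t u F : hex_translate t (hex_translate u F) = hex_translate (u + t)%R F.
  by case: F => *; rewrite /= ?addrA.
have sy F G : torus_equiv F G -> torus_equiv G F.
  move=> /asboolP[t [k [l ->]] ->]; apply/asboolP.
  exists (- ((b%:Z, c%:Z) *~ k + rot60 (b%:Z, c%:Z) *~ l))%R.
    by exists (- k)%R, (- l)%R; rewrite !mulrNz opprD.
  by rewrite tD subrr t0.
split=> [F|F G|G F H].
- apply/asboolP; exists 0%R; last by rewrite t0.
  by exists 0%R, 0%R; rewrite !mulr0z addr0.
- by apply/idP/idP; apply: sy.
move=> /asboolP[t [k [l ->]] ->] /asboolP[u [k' [l' ->]] ->].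
apply/asboolP; eexists; last exact: tD.
by exists (k + k')%R, (l + l')%R; rewrite !mulrzDr addrACA.
Qed.

Canonical torus_equiv_equiv := EquivRelPack torus_equiv_is_equiv.

(* The toroidal map {6,3}_(b,c): its faces are the orbits of the translation
   lattice on the faces of the tessellation. *)
Definition hexagonal_torus := {eq_quot torus_equiv}.

HB.instance Definition _ := Choice.on hexagonal_torus.
HB.instance Definition _ := EqQuotient.on hexagonal_torus.

Definition torus_le (x y : hexagonal_torus) : bool :=
  `[< exists F G, [/\ x = \pi_hexagonal_torus F, y = \pi_hexagonal_torus G
                    & (F <= G)%O] >].

Fact torus_le_refl : reflexive torus_le.
Proof. by move=> x; apply/asboolP; exists (repr x), (repr x); rewrite reprK. Qed.

Fact torus_le_level x y :
  torus_le x y -> x = y \/ hex_level (repr x) < hex_level (repr y).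
Proof.
have lev F : hex_level (repr (\pi_hexagonal_torus F)) = hex_level F.
  have /eqmodP/asboolP[t _ {2}->] :
    repr (\pi_hexagonal_torus F) = F %[mod hexagonal_torus] by rewrite reprK.
  by case: (repr _).
move=> /asboolP[F [G [-> -> /hex_le_level]]].
by rewrite !lev => -[->|]; [left | right].
Qed.

Fact torus_le_anti : antisymmetric torus_le.
Proof.
move=> x y /andP[/torus_le_level[//|lt_xy] /torus_le_level[//|lt_yx]].
by have := ltn_trans lt_xy lt_yx; rewrite ltnn.
Qed.

Fact torus_le_trans : transitive torus_le.
Proof.
move=> y x z /asboolP[F [G [-> -> le_FG]]] /asboolP[G' [H [e -> le_GH]]].
have /asboolP[t lat_t defG'] : torus_equiv G G' by apply/eqmodP.
apply/asboolP; exists (hex_translate t F), H; split=> //.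
  by apply/eqmodP/asboolP; exists t.
apply: le_trans le_GH; rewrite defG'; exact: hex_translate_le.
Qed.

HB.instance Definition _ := Order.Le_isPOrder.Build (Order.Disp tt tt)
  hexagonal_torus torus_le_refl torus_le_anti torus_le_trans.

End Torus.

Definition SL2 (p : nat) : {set {'GL_2(p)}} :=
  [set g : {'GL_2(p)} | (\det (GLval g) == 1)%R].

Fact SL2_group_set p : group_set (SL2 p).
Proof.
apply/group_setP; split=> [|g h]; first by rewrite inE det1.
by rewrite !inE GL_MxE det_mulmx => /eqP-> /eqP->; rewrite mulr1.
Qed.

Canonical SL2_group p := Group (SL2_group_set p).

Definition L2 (p : nat) := (SL2 p / 'Z(SL2 p))%G.

(* Main.v *)
(** The four involutions exchanging the face of rank [i] in a flag act on the flags
    of a 4-polytope, and the polytope is recovered from this action; a section is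
    determined up to isomorphism by the words that fix one of its flags.

    Since [p = b^2 + b c + c^2] is 1 or 49 mod 60, the field [F_p] contains a
    primitive 12th root of unity [a] and a root [l] of [l^2 + l = 1], and explicit
    matrices over [F_p] give [t_1, t_2, t_3] in [L_2(p)] that satisfy the relations
    of the rotation group of [{6,3,5}] and are inverted by no automorphism.  Words
    in [t_1, t_2] act as affine maps of [F_p], viewed as the quotient of the
    Eisenstein integers by the lattice of [(b, c)], so this lattice consists of the
    translations that become trivial.

    The pairs of [t_i] with the corresponding element of [Gamma^+(Q)] generate the
    whole product, by Goursat's lemma and the simplicity of [L_2(p)], because
    [p (p^2 - 1)] does not divide [|Gamma(Q)|].  The flags of the new polytope are
    the pairs of an element of the product and a parity.  They map to the flags of
    [Q], injectively on vertex-figures since the icosahedral group is presented by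
    its braid relations, and the intersection property is lifted from [Q].  A facet
    is the hexagonal tessellation modulo the intersection of the lattices of
    [(b, c)] and [(m, 0)].  A reflection would induce an automorphism of the
    centreless factor [L_2(p)] inverting [t_1] and [t_2]. *)

Require Import Defs.
From HB Require Import structures.
From mathcomp Require Import all_boot all_order all_algebra all_fingroup.
From mathcomp Require Import all_solvable.
From mathcomp Require Import boolp generic_quotient zify ring finfield.

Set Implicit Arguments.
Unset Strict Implicit.
Unset Printing Implicit Defensive.

Import Order.TTheory GRing.Theory.

(** * Words acting on flags *)

(** Chiral polytopes have no reflections, so all groups are generated by tau_i = rho_0 rho_i, with
    tau_0 = 1: letter i multiplies a group element on the left by tau_i or its inverse and switches
    the parity, which leaves right multiplications to act as automorphisms. The constants come from
    z = (b + c)/c, a root of z^2 - z + 1 in F_p, and a square root i of -1: the element a = i z^2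
    has square z. Then eta = 1 - z = -b/c satisfies b + c eta = 0 while its conjugate 1 - eta does
    not, and this asymmetry produces chirality. The class of p modulo 60 supplies i (p is 1 modulo
    4) and l (p is 1 or 4 modulo 5). The obstacle is polytopality, since a subgroup generated by
    pairs need not inherit the intersection property. Intersections involving the stabilizer of a
    vertex can be computed in Q; the others reduce to these, or become trivial, because distant
    letters commute. The order of L_2(p) is p(p^2 - 1)/2 and Gamma^+(Q) has index 2, which turns the
    divisibility hypothesis into the one that Goursat's lemma needs. *)

Section Words.
Variables (X : Type) (r : nat -> X -> X).

Definition walk (x : X) (w : seq nat) : X := foldl (fun y i => r i y) x w.

Definition conn (I : pred nat) (x y : X) : Prop :=
  exists2 w, all I w & y = walk x w.

Lemma walk_cat x w1 w2 : walk x (w1 ++ w2) = walk (walk x w1) w2.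
Proof. exact: foldl_cat. Qed.

Lemma walk_rcons x w i : walk x (rcons w i) = r i (walk x w).
Proof. by rewrite -cats1 walk_cat. Qed.

Variable I : pred nat.
Hypothesis rK : forall i, I i -> involutive (r i).

Lemma walkK x w : all I w -> walk (walk x w) (rev w) = x.
Proof.
elim: w x => [|i w IHw] x //= /andP[Ii Iw].
by rewrite rev_cons -cats1 walk_cat IHw //= rK.
Qed.

Lemma walk_inj x y w : all I w -> walk x w = walk y w -> x = y.
Proof. by move=> Iw eq_xy; rewrite -(walkK x Iw) eq_xy walkK. Qed.

Lemma conn_sym x y : conn I x y -> conn I y x.
Proof. by case=> w Iw ->; exists (rev w); rewrite ?all_rev ?walkK. Qed.

Lemma conn_refl x : conn I x x.
Proof. by exists [::]. Qed.

Lemma conn_trans x y z : conn I x y -> conn I y z -> conn I x z.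
Proof.
move=> [w1 Iw1 ->] [w2 Iw2 ->]; exists (w1 ++ w2); last by rewrite walk_cat.
by rewrite all_cat Iw1.
Qed.

End Words.

Lemma sub_conn (X : Type) (r : nat -> X -> X) (I J : pred nat) x y :
  (forall i, I i -> J i) -> conn r I x y -> conn r J x y.
Proof. by move=> IJ [w Iw ->]; exists w => //; apply: sub_all Iw. Qed.

Lemma walk_morph (X Y : Type) (r : nat -> X -> X) (s : nat -> Y -> Y)
    (I : pred nat) (E : X -> Y -> Prop) :
  (forall i x y, I i -> E x y -> E (r i x) (s i y)) ->
  forall w x y, all I w -> E x y -> E (walk r x w) (walk s y w).
Proof.
move=> Er; elim=> [|i w IHw] x y //= /andP[Ii Iw] Exy.
by apply: IHw => //; apply: Er.
Qed.

(** Strict growth forces [f k] to be at least [k] by counting up from [lo] and at most [k] by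
    counting down from [hi]. This pins the faces of a full chain to their own indices. *)
Lemma increasing_endo_id lo hi (f : nat -> nat) :
  (forall k, lo <= k <= hi -> lo <= f k <= hi) ->
  (forall k, lo <= k < hi -> f k < f k.+1) ->
  forall k, lo <= k <= hi -> f k = k.
Proof.
move=> f_rng f_incr k k_rng.
have low j : lo + j <= hi -> lo + j <= f (lo + j).
  elim: j => [|j IHj] le_j; first by have := f_rng lo; rewrite addn0; lia.
  have := f_incr (lo + j); rewrite addnS in le_j *; lia.
have high j : j <= hi - lo -> f (hi - j) + j <= hi.
  elim: j => [|j IHj] le_j; first by have := f_rng hi; rewrite subn0; lia.
  have := f_incr (hi - j.+1); rewrite (_ : (hi - j.+1).+1 = hi - j); lia.
have := low (k - lo); have := high (hi - k).
have -> : lo + (k - lo) = k by lia.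
have -> : hi - (hi - k) = k by lia.
lia.
Qed.

(** Letter [i] acts at index [i.+1], so the end faces of a section, of indices [lo] and [hi.+1], are
    moved by no letter of its range. *)
Definition rank_range lo hi k := lo <= k <= hi.+1.
Definition letter_range lo hi i := lo <= i < hi.
Arguments rank_range : simpl never.
Arguments letter_range : simpl never.

(* [X] is the set of flags, [r i] exchanges the face of index [i.+1] in a flag,
   and [fc k x] is the face of index [k] of [x]; the index is the rank plus 1.
   Sections are covered by letting indices range over [lo..hi.+1]. *)
Record flagged (lo hi : nat) (d : Order.disp_t) (P : finPOrderType d)
    (X : finType) (r : nat -> X -> X) (fc : nat -> X -> P) : Prop := Flagged {
  fl_inv : forall i, letter_range lo hi i -> involutive (r i);
  fl_fix : forall i k x, letter_range lo hi i -> rank_range lo hi k ->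
    k != i.+1 -> fc k (r i x) = fc k x;
  fl_move : forall i x, letter_range lo hi i -> fc i.+1 (r i x) <> fc i.+1 x;
  fl_mono : forall k l x, rank_range lo hi k -> rank_range lo hi l -> k <= l ->
    (fc k x <= fc l x)%O;
  fl_le : forall k l x y, rank_range lo hi k -> rank_range lo hi l ->
    (fc k x <= fc l y)%O -> k <= l;
  fl_chain : forall A : {set P}, is_chain A -> exists x : X,
    forall F, F \in A -> exists2 k, rank_range lo hi k & F = fc k x;
  fl_conn : forall (S : pred nat) x y,
    (forall k, rank_range lo hi k -> S k -> fc k x = fc k y) ->
    conn r [pred i | letter_range lo hi i & ~~ S i.+1] x y }.

Section FlaggedTheory.
Variables (lo hi : nat) (d : Order.disp_t) (P : finPOrderType d).
Variables (X : finType) (r : nat -> X -> X) (fc : nat -> X -> P).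
Hypothesis fl : flagged lo hi r fc.

Let rK := fl_inv fl.

Lemma face_index k l x y : rank_range lo hi k -> rank_range lo hi l ->
  fc k x = fc l y -> k = l.
Proof.
move=> Rk Rl e; apply/eqP; rewrite eqn_leq.
by rewrite (fl_le fl Rk Rl (x := x) (y := y)) ?e // (fl_le fl Rl Rk (x := y) (y := x)) ?e.
Qed.

Lemma face_walk k w x : rank_range lo hi k ->
  all [pred i | letter_range lo hi i & i.+1 != k] w ->
  fc k (walk r x w) = fc k x.
Proof.
move=> Rk; elim: w x => [|i w IHw] x //= /andP[/andP[Li ik] Iw].
by rewrite IHw // (fl_fix fl) // eq_sym.
Qed.

Lemma face_conn k x y : rank_range lo hi k -> fc k x = fc k y ->
  conn r [pred i | letter_range lo hi i & i.+1 != k] x y.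
Proof.
move=> Rk e; apply: sub_conn (fl_conn fl (S := pred1 k) _) => //.
by move=> l _ /eqP->.
Qed.

Lemma face_inj x y : (forall k, rank_range lo hi k -> fc k x = fc k y) -> x = y.
Proof.
move=> e; have [|w Iw ->] := @fl_conn _ _ _ _ _ _ _ fl predT x y.
  by move=> k Rk _; apply: e.
by case: w Iw => //= i w /andP[/andP[_]].
Qed.

Lemma walk_letter i x w : all (pred1 i) w -> letter_range lo hi i ->
  walk r x w = x \/ walk r x w = r i x.
Proof.
move=> Iw Li; elim: w x Iw => [|j w IHw] x /=; first by left.
move=> /andP[/eqP-> Iw]; have [->|->] := IHw (r i x) Iw; first by right.
by left; rewrite rK.
Qed.

(** Only the letter [i] is left in a connecting word, and as an involution it counts modulo 2. This
    is the form in which the diamond condition is used. *)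
Lemma face_inj_but i x y :
  (forall k, rank_range lo hi k -> k != i.+1 -> fc k x = fc k y) ->
  y = x \/ letter_range lo hi i /\ y = r i x.
Proof.
move=> e; have [w Iw ->] := @fl_conn _ _ _ _ _ _ _ fl (predC1 i.+1) x y e.
case Li: (letter_range lo hi i); last first.
  case: w Iw => [|j w] /=; first by left.
  by rewrite negbK eqSS => /andP[/andP[Lj /eqP ji]]; rewrite -ji Lj in Li.
have [|//|->|->] := @walk_letter i x w; last 1 first.
- by right.
- by apply: sub_all Iw => j /= /andP[_]; rewrite negbK eqSS.
- by left.
Qed.

(** Some flag through the chain holds each [g k] at an index [f k]; strictness of the chain makes
    [f] strictly increasing on the whole index range, hence the identity. *)
Lemma chain_align (g : nat -> P) :
  (forall k, lo <= k <= hi -> (g k < g k.+1)%O) ->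
  exists x, forall k, rank_range lo hi k -> fc k x = g k.
Proof.
move=> g_lt.
have g_le k l : lo <= k -> k <= l -> l <= hi.+1 -> (g k <= g l)%O.
  move=> lk; elim: l => [|l IHl]; first by rewrite leqn0 => /eqP->.
  rewrite leq_eqVlt => /predU1P[->//|le_kl lt_l].
  by apply: le_trans (IHl _ _) (ltW (g_lt _ _)); lia.
pose A := [set g (val k) | k in [set k : 'I_hi.+2 | lo <= k]].
have chA : is_chain A.
  apply/forall_inP=> _ /imsetP[k lk ->]; apply/forall_inP=> _ /imsetP[l ll ->].
  rewrite !inE in lk ll.
  have [le_kl | /ltnW le_lk] := leqP k l; rewrite /Order.comparable.
    by rewrite g_le // -ltnS (ltn_ord l).
  by rewrite orbC g_le // -ltnS (ltn_ord k).
have [x Ax] := fl_chain fl chA.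
have Ax' k : exists l, rank_range lo hi k ->
    rank_range lo hi l /\ g k = fc l x.
  case Rk: (rank_range lo hi k); last by exists 0.
  have [|l Rl ->] := Ax (g k); last by exists l.
  have lt_k : k < hi.+2 by case/andP: Rk; lia.
  by apply/imsetP; exists (Ordinal lt_k); rewrite ?inE; case/andP: Rk.
have [f fP] := choice Ax'.
have f_id k : rank_range lo hi k -> f k = k.
  apply: increasing_endo_id => j Rj; first by case: (fP j Rj).
  have Rj1 : rank_range lo hi j by rewrite /rank_range; lia.
  have Rj2 : rank_range lo hi j.+1 by rewrite /rank_range; lia.
  have [[R1 e1] [R2 e2]] := (fP j Rj1, fP j.+1 Rj2).
  have := g_lt j Rj; rewrite e1 e2 => lt_fc; rewrite ltnNge; apply/negP=> le_f.
  by have := fl_mono fl x R2 R1 le_f; rewrite (lt_geF lt_fc).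
by exists x => k Rk; have [_ ->] := fP k Rk; rewrite f_id.
Qed.

Lemma face_lt k x : lo <= k <= hi -> (fc k x < fc k.+1 x)%O.
Proof.
move=> Rk; have R1 : rank_range lo hi k by rewrite /rank_range; lia.
have R2 : rank_range lo hi k.+1 by rewrite /rank_range; lia.
rewrite lt_neqAle (fl_mono fl) // andbT; apply/eqP=> e.
by have := face_index R1 R2 e; lia.
Qed.

(* [B] is a concrete model of the flags, with faces [g]. *)
Section Model.
Variables (B : Type) (rB : nat -> B -> B) (g : nat -> B -> P) (V : B -> Prop).
Hypothesis rB_valid : forall i b, letter_range lo hi i -> V b -> V (rB i b).
Hypothesis g_lt : forall k b, V b -> lo <= k <= hi -> (g k b < g k.+1 b)%O.
Hypothesis g_fix : forall i k b, V b -> letter_range lo hi i ->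
  rank_range lo hi k -> k != i.+1 -> g k (rB i b) = g k b.
Hypothesis g_move : forall i b, V b -> letter_range lo hi i ->
  g i.+1 (rB i b) <> g i.+1 b.

Lemma model_flag b : V b ->
  exists x, forall k, rank_range lo hi k -> fc k x = g k b.
Proof. by move=> Vb; apply: chain_align => k Rk; apply: g_lt. Qed.

(** The chain of [rB i b] belongs to a flag that differs from [x] exactly at index [i.+1], and
    [r i x] is the only such flag. *)
Lemma model_act b x w : V b -> all (letter_range lo hi) w ->
  (forall k, rank_range lo hi k -> fc k x = g k b) ->
  V (walk rB b w) /\
  (forall k, rank_range lo hi k -> fc k (walk r x w) = g k (walk rB b w)).
Proof.
move=> Vb Lw ebx.
pose E b x := V b /\ forall k, rank_range lo hi k -> fc k x = g k b.
apply: (@walk_morph _ _ rB r (letter_range lo hi) E) => // {b x w Vb Lw ebx}.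
move=> i b x Li [Vb ebx]; split; first exact: rB_valid.
have [y ey] := model_flag (rB_valid Li Vb).
have [|yx|[_ yx]] := @face_inj_but i x y.
- by move=> k Rk ki; rewrite ebx // ey // g_fix.
- have Ri : rank_range lo hi i.+1.
    by rewrite /rank_range; case/andP: Li; lia.
  by case: (g_move Vb Li); rewrite -ey // yx ebx.
- by rewrite -yx.
Qed.

End Model.

End FlaggedTheory.

(* The poset is determined by the words fixing a base flag: [F k w] is the face
   of index [k] of the flag reached from it by [w]. *)
Definition presented (lo hi : nat) (d : Order.disp_t) (P : porderType d)
    (F : nat -> seq nat -> P) (St : seq nat -> Prop) : Prop :=
  (forall p, exists k w,
     [/\ rank_range lo hi k, all (letter_range lo hi) w & p = F k w]) /\
  (forall k l w w', rank_range lo hi k -> rank_range lo hi l ->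
     all (letter_range lo hi) w -> all (letter_range lo hi) w' ->
     (F k w <= F l w')%O <->
     k <= l /\ exists u u',
       [/\ all [pred i | letter_range lo hi i & i.+1 != k] u,
           all [pred i | letter_range lo hi i & i.+1 != l] u'
         & St (w ++ u ++ rev u' ++ rev w')]).

(** Incidence depends only on the indices and on the words in [St], and equality of faces is
    incidence both ways. Sending [F1 k w] to [F2 k w] is thus well defined, so no isomorphism has to
    be built face by face. *)
Lemma presented_iso lo hi (d1 d2 : Order.disp_t) (P1 : porderType d1)
    (P2 : porderType d2) F1 F2 (St1 St2 : seq nat -> Prop) :
  @presented lo hi d1 P1 F1 St1 -> @presented lo hi d2 P2 F2 St2 ->
  (forall w, all (letter_range lo hi) w -> St1 w <-> St2 w) ->
  exists2 f : P1 -> P2, bijective f /\ {mono f : x y / (x <= y)%O}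
  & forall k w, rank_range lo hi k -> all (letter_range lo hi) w ->
      f (F1 k w) = F2 k w.
Proof.
move=> [sur1 ord1] [sur2 ord2] St12.
have le12 k l w w' : rank_range lo hi k -> rank_range lo hi l ->
     all (letter_range lo hi) w -> all (letter_range lo hi) w' ->
     (F1 k w <= F1 l w')%O = (F2 k w <= F2 l w')%O.
  move=> Rk Rl Lw Lw'.
  have Lsub m u : all [pred i | letter_range lo hi i & i.+1 != m] u ->
      all (letter_range lo hi) u by apply: sub_all => i /andP[].
  apply/idP/idP => [/ord1|/ord2] h; apply/ord2 || apply/ord1 => //;
    case: h => // le_kl [u [u' [Lu Lu' St]]]; split=> //; exists u, u';
    (split=> //; apply/St12 => //;
     rewrite !all_cat !all_rev Lw Lw' (Lsub _ _ Lu) (Lsub _ _ Lu') //).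
have eq12 k l w w' : rank_range lo hi k -> rank_range lo hi l ->
     all (letter_range lo hi) w -> all (letter_range lo hi) w' ->
     (F1 k w = F1 l w') <-> (F2 k w = F2 l w').
  move=> Rk Rl Lw Lw'; split=> e; apply/le_anti.
    by rewrite -!le12 // e lexx.
  by rewrite !le12 // e lexx.
have [f1 f1P] : exists f : P1 -> nat * seq nat, forall p,
    [/\ rank_range lo hi (f p).1, all (letter_range lo hi) (f p).2
      & p = F1 (f p).1 (f p).2].
  have h p : exists q, [/\ rank_range lo hi q.1,
      all (letter_range lo hi) q.2 & p = F1 q.1 q.2].
    by have [k [w h]] := sur1 p; exists (k, w).
  by have [f fP] := choice h; exists f.
have [f2 f2P] : exists f : P2 -> nat * seq nat, forall p,
    [/\ rank_range lo hi (f p).1, all (letter_range lo hi) (f p).2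
      & p = F2 (f p).1 (f p).2].
  have h p : exists q, [/\ rank_range lo hi q.1,
      all (letter_range lo hi) q.2 & p = F2 q.1 q.2].
    by have [k [w h]] := sur2 p; exists (k, w).
  by have [f fP] := choice h; exists f.
have fF k w : rank_range lo hi k -> all (letter_range lo hi) w ->
    F2 (f1 (F1 k w)).1 (f1 (F1 k w)).2 = F2 k w.
  by move=> Rk Lw; have [R L e] := f1P (F1 k w); apply/eq12.
exists (fun p => F2 (f1 p).1 (f1 p).2); last exact: fF.
split; last first.
  move=> p q; have [R L e] := f1P p; have [R' L' e'] := f1P q.
  by rewrite -le12 // -e -e'.
exists (fun q => F1 (f2 q).1 (f2 q).2) => [p|q].
  have [R L e] := f1P p; have [R' L' e'] := f2P (F2 (f1 p).1 (f1 p).2).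
  by rewrite [RHS]e; apply/eq12.
by have [R L e] := f2P q; rewrite [RHS]e; apply: fF.
Qed.

(** Incident faces lie in a common flag, reached from the two given flags by words [u] and [u'] that
    keep the respective face; the loop through it is the word of the condition. *)
Lemma flagged_presented lo hi (d : Order.disp_t) (P : finPOrderType d)
    (X : finType) (r : nat -> X -> X) (fc : nat -> X -> P) (x : X) :
  flagged lo hi r fc ->
  presented lo hi (fun k w => fc k (walk r x w)) (fun w => walk r x w = x).
Proof.
move=> fl; have rK := fl_inv fl.
have Lsub m u : all [pred i | letter_range lo hi i & i.+1 != m] u ->
      all (letter_range lo hi) u by apply: sub_all => i /andP[].
split=> [p|k l w w' Rk Rl Lw Lw'].
  have [|y Ay] := @fl_chain _ _ _ _ _ _ _ fl [set p].
    apply/forall_inP=> F /set1P->; apply/forall_inP=> G /set1P->.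
    by rewrite /Order.comparable lexx.
  have [k Rk ->] := Ay p (set11 p).
  have [|w Lw ->] := @fl_conn _ _ _ _ _ _ _ fl pred0 x y; first by [].
  by exists k, w; split=> //; apply: sub_all Lw => i /andP[].
rewrite /=; split=> [le_kl | [le_kl [u [u' [Lu Lu' e]]]]].
  split; first by have := fl_le fl Rk Rl le_kl.
  have [|t At] := @fl_chain _ _ _ _ _ _ _ fl
      [set fc k (walk r x w); fc l (walk r x w')].
    apply/forall_inP=> F /set2P[]->; apply/forall_inP=> G /set2P[]->;
      by rewrite /Order.comparable ?lexx ?le_kl ?orbT.
  have [k' Rk' ek] := At _ (set21 _ _); have [l' Rl' el] := At _ (set22 _ _).
  have kk' := face_index fl Rk Rk' ek; have ll' := face_index fl Rl Rl' el.
  subst k' l'; have [u Lu eu] := face_conn fl Rk ek.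
  have [u' Lu' eu'] := face_conn fl Rl el.
  exists u, u'; split=> //; rewrite catA walk_cat walk_cat walk_cat -eu eu'.
  by rewrite (walkK rK) ?(Lsub l) // (walkK rK).
have et : walk r (walk r x w) u = walk r (walk r x w') u'.
  have L' : all (letter_range lo hi) (rev u' ++ rev w').
    by rewrite all_cat !all_rev Lw' (Lsub _ _ Lu').
  apply: (walk_inj rK L'); rewrite -!walk_cat e.
  by rewrite catA -rev_cat walk_cat (walkK rK) // all_cat Lw' (Lsub _ _ Lu').
rewrite -(face_walk fl _ Rk Lu) et.
by rewrite -(face_walk fl (walk r x w') Rl Lu') (fl_mono fl).
Qed.

(** * Flags, ranks and automorphisms in terms of the letters *)

Section FlagsOfFlagged.
Variables (n : nat) (d : Order.disp_t) (P : finPOrderType d).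
Variables (X : finType) (r : nat -> X -> X) (fc : nat -> X -> P).
Hypothesis fl : flagged 0 n r fc.

Let rK := fl_inv fl.

Lemma rank_rangeE k : rank_range 0 n k = (k < n.+2).
Proof. by []. Qed.

Let Rord (k : 'I_n.+2) : rank_range 0 n k := ltn_ord k.

Definition flag_of (x : X) : {set P} := [set fc k x | k : 'I_n.+2].

Lemma face_in_flag k x : rank_range 0 n k -> fc k x \in flag_of x.
Proof. by move=> Rk; apply/imsetP; exists (@Ordinal n.+2 k Rk). Qed.

Lemma flag_ofP x F : reflect (exists2 k, rank_range 0 n k & F = fc k x)
  (F \in flag_of x).
Proof.
apply: (iffP imsetP) => [[k _ ->]|[k Rk ->]]; first by exists k.
by exists (@Ordinal n.+2 k Rk).
Qed.

Lemma in_flag_of k x y : rank_range 0 n k ->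
  (fc k x \in flag_of y) = (fc k x == fc k y).
Proof.
move=> Rk; apply/flag_ofP/eqP => [[l Rl e]|->]; last by exists k.
by rewrite e -(face_index fl Rk Rl e).
Qed.

Lemma card_flag_of x : #|flag_of x| = n.+2.
Proof.
rewrite card_in_imset ?card_ord // => k l _ _ e.
by apply/val_inj/(face_index fl (Rord k) (Rord l) e).
Qed.

Lemma flag_of_chain x : is_chain (flag_of x).
Proof.
apply/forall_inP=> _ /flag_ofP[k Rk ->]; apply/forall_inP=> _ /flag_ofP[l Rl ->].
rewrite /Order.comparable; have [kl|/ltnW lk] := leqP k l.
  by rewrite (fl_mono fl).
by rewrite orbC (fl_mono fl).
Qed.

Lemma chain_sub_flag (A : {set P}) : is_chain A -> exists x, A \subset flag_of x.
Proof.
move=> /(fl_chain fl)[x Ax]; exists x; apply/subsetP=> F /Ax[k Rk ->].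
exact: face_in_flag.
Qed.

Lemma flags_flag_of x : flag_of x \in flags P.
Proof.
rewrite inE; apply/maxsetP; split; first exact: flag_of_chain.
move=> A /chain_sub_flag[y sAy] sxA; apply/eqP; rewrite eqEsubset sxA andbT.
have /eqP-> : flag_of x == flag_of y; last by [].
by rewrite eqEcard (subset_trans sxA sAy) !card_flag_of leqnn.
Qed.

Lemma flagsP (A : {set P}) : A \in flags P -> exists x, A = flag_of x.
Proof.
rewrite inE => /maxsetP[chA maxA]; have [x sAx] := chain_sub_flag chA.
by exists x; rewrite (maxA _ (flag_of_chain x)).
Qed.

Lemma flag_of_face x y k : rank_range 0 n k -> flag_of x = flag_of y ->
  fc k x = fc k y.
Proof. by move=> Rk e; apply/eqP; rewrite -in_flag_of // -e face_in_flag. Qed.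

Lemma flag_of_inj : injective flag_of.
Proof.
by move=> x y e; apply: (face_inj fl) => k Rk; apply: flag_of_face.
Qed.

Lemma face_rankE k x : rank_range 0 n k -> face_rank (fc k x) = (k%:Z - 1)%R.
Proof.
move=> Rk; have Rj (j : 'I_k.+1) : rank_range 0 n j.
  by have := ltn_ord j; move: Rk; rewrite !rank_rangeE; lia.
rewrite /face_rank; set M := (\max_(_ | _) _).
suff -> : M = k.+1 by lia.
apply/eqP; rewrite eqn_leq; apply/andP; split.
  apply/bigmax_leqP=> A /andP[/(fl_chain fl)[y Ay] /forall_inP Ax].
  have sA : A \subset [set fc (val j) y | j : 'I_k.+1].
    apply/subsetP=> F FA; have [l Rl eF] := Ay F FA.
    have := Ax F FA; rewrite eF => /(fl_le fl Rl Rk) le_lk.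
    by apply/imsetP; exists (Ordinal (le_lk : l < k.+1)).
  apply: leq_trans (subset_leq_card sA) _.
  by rewrite (leq_trans (leq_imset_card _ _)) // card_ord.
rewrite -[leqLHS](_ : #|[set fc (val j) x | j : 'I_k.+1]| = _); last first.
  rewrite card_in_imset ?card_ord // => i j _ _ e.
  by apply/val_inj/(face_index fl (Rj i) (Rj j) e).
apply: leq_bigmax_cond; apply/andP; split.
  apply/forall_inP=> F FA; apply/forall_inP=> G GA.
  have sub : [set fc (val j) x | j : 'I_k.+1] \subset flag_of x.
    by apply/subsetP=> _ /imsetP[j _ ->]; apply: face_in_flag (Rj j).
  by move/forall_inP: (flag_of_chain x) => /(_ F (subsetP sub F FA))
     /forall_inP /(_ G (subsetP sub G GA)).
apply/forall_inP=> _ /imsetP[j _ ->]; apply: (fl_mono fl) => //.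
  exact: Rj.
by rewrite -ltnS (ltn_ord j).
Qed.

Lemma face_exists F : exists x k, rank_range 0 n k /\ F = fc k x.
Proof.
have [|x /subsetP sx] := @chain_sub_flag [set F].
  apply/forall_inP=> G /set1P->; apply/forall_inP=> H /set1P->.
  by rewrite /Order.comparable lexx.
by have /flag_ofP[k Rk ->] := sx F (set11 F); exists x, k.
Qed.

Lemma face_of_rank F k : face_rank F = (k%:Z - 1)%R ->
  rank_range 0 n k /\ exists x, F = fc k x.
Proof.
have [x [l [Rl ->]]] := face_exists F; rewrite face_rankE // => e.
have <- : l = k by lia.
by split=> //; exists x.
Qed.

Lemma flag_of_diff i x : letter_range 0 n i ->
  flag_of x :\: flag_of (r i x) = [set fc i.+1 x].
Proof.
move=> Li; have Ri : rank_range 0 n i.+1 by move: Li; rewrite /letter_range rank_rangeE; lia.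
apply/setP=> F; rewrite !inE; apply/andP/eqP => [[nF /flag_ofP[k Rk eF]]|->].
  have [<- //|ki] := eqVneq k i.+1; case/negP: nF.
  by rewrite eF -(fl_fix fl x Li Rk ki) face_in_flag.
split; last exact: face_in_flag.
by rewrite in_flag_of // eq_sym; apply/eqP/(fl_move fl).
Qed.

Lemma adjacent_flag_of i x : letter_range 0 n i ->
  adjacent (flag_of x) (flag_of (r i x)).
Proof.
move=> Li; rewrite /adjacent !flags_flag_of flag_of_diff // cards1 eqxx /=.
by rewrite -{2}[x](rK Li) flag_of_diff // cards1.
Qed.

Lemma adjacent_flag_ofP x y : adjacent (flag_of x) (flag_of y) ->
  exists2 i, letter_range 0 n i & y = r i x.
Proof.
case/and4P=> _ _ /cards1P[F eF] _.
have : F \in flag_of x :\: flag_of y by rewrite eF set11.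
rewrite inE => /andP[nF /flag_ofP[k Rk ek]].
have same l : rank_range 0 n l -> l != k -> fc l x = fc l y.
  move=> Rl lk; apply/eqP; rewrite -in_flag_of //; apply/negPn/negP=> nl.
  have : fc l x \in flag_of x :\: flag_of y by rewrite inE nl face_in_flag.
  rewrite eF inE ek => /eqP /(face_index fl Rl Rk) e.
  by rewrite e eqxx in lk.
have nxy : y <> x by move=> e; rewrite ek e face_in_flag in nF.
case: k Rk ek same => [|k] Rk ek same; last first.
  by have [//|//|[Lk ->]] := @face_inj_but _ _ _ _ _ _ _ fl k x y; exists k.
(* No letter moves the face of index 0, so flags that agree at all other indices are equal. *)
have [|w] := @fl_conn _ _ _ _ _ _ _ fl (predC1 0) x y.
  by move=> l Rl; apply: same.
by case: w => [_ /nxy|i w] //= /andP[/andP[]].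
Qed.

Lemma automorphism_le s : s \in automorphisms P ->
  {mono s : F G / (F <= G)%O}.
Proof. by rewrite inE => /'forall_'forall_eqP. Qed.

Lemma automorphism_face s x : s \in automorphisms P ->
  exists y, forall k, rank_range 0 n k -> s (fc k x) = fc k y.
Proof.
move=> /automorphism_le s_le.
have [|y ey] := @chain_align _ _ _ _ _ _ _ fl (fun k => s (fc k x)).
  move=> k Rk; have := face_lt fl x Rk.
  by rewrite !lt_neqAle s_le (inj_eq perm_inj).
by exists y => k Rk; rewrite ey.
Qed.

(** Automorphisms commute with letters: the flags themselves, with faces moved by [s], form a model
    to which [model_act] applies. *)
Lemma automorphism_act s x y w : s \in automorphisms P ->
  (forall k, rank_range 0 n k -> s (fc k x) = fc k y) ->
  all (letter_range 0 n) w ->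
  forall k, rank_range 0 n k -> s (fc k (walk r x w)) = fc k (walk r y w).
Proof.
move=> As exy Lw; have s_le := automorphism_le As.
have [||||//|_ e] := @model_act _ _ _ _ _ _ _ fl X r
    (fun k x => s (fc k x)) (fun=> True) _ _ _ _ x y w I Lw.
- by [].
- by move=> k b _ Rk; have := face_lt fl b Rk;
    rewrite !lt_neqAle s_le (inj_eq perm_inj).
- by move=> i k b _ Li Rk ki; rewrite (fl_fix fl).
- by move=> i b _ Li /perm_inj /(fl_move fl Li).
- by move=> k Rk; rewrite exy.
by move=> k Rk; rewrite e.
Qed.

Lemma automorphism_stab s x y w : s \in automorphisms P ->
  (forall k, rank_range 0 n k -> s (fc k x) = fc k y) ->
  all (letter_range 0 n) w -> walk r x w = x <-> walk r y w = y.
Proof.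
move=> As exy Lw; have e := automorphism_act As exy Lw; split=> e1.
  by apply: (face_inj fl) => k Rk; rewrite -e // e1 exy.
apply: (face_inj fl) => k Rk; apply: (@perm_inj _ s).
by rewrite e // e1 exy.
Qed.

Lemma setact_flag_of (s : {perm P}) x y :
  (forall k, rank_range 0 n k -> s (fc k x) = fc k y) ->
  ('P^*)%act (flag_of x) s = flag_of y.
Proof.
move=> e; apply/setP=> F; apply/imsetP/flag_ofP => [[G]|[k Rk ->]].
  by case/flag_ofP=> k Rk -> ->; exists k; rewrite //= /aperm e.
by exists (fc k x); [apply: face_in_flag | rewrite /= /aperm e].
Qed.

Lemma setact_flag_ofE s x y : s \in automorphisms P ->
  ('P^*)%act (flag_of x) s = flag_of y ->
  forall k, rank_range 0 n k -> s (fc k x) = fc k y.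
Proof.
move=> As e; have [z ez] := automorphism_face x As.
by have := setact_flag_of ez; rewrite e => /flag_of_inj->.
Qed.

Lemma automorphism_free s t x : s \in automorphisms P -> t \in automorphisms P ->
  (forall k, rank_range 0 n k -> s (fc k x) = t (fc k x)) -> s = t.
Proof.
move=> As At e; have [y ey] := automorphism_face x As.
apply/permP=> F; have [z [k [Rk ->]]] := face_exists F.
have [//|w Lw ->] := @fl_conn _ _ _ _ _ _ _ fl pred0 x z.
have {}Lw : all (letter_range 0 n) w by apply: sub_all Lw => i /andP[].
have et j : rank_range 0 n j -> t (fc j x) = fc j y by move=> Rj; rewrite -e ?ey.
by rewrite (automorphism_act As ey Lw) // (automorphism_act At et Lw).
Qed.

(** Two base flags with the same stabilizing words present the poset by the same data, and the
    resulting isomorphism of the poset with itself is the automorphism. *)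
Lemma automorphism_exists x y :
  (forall w, all (letter_range 0 n) w -> walk r x w = x <-> walk r y w = y) ->
  exists2 s, s \in automorphisms P
  & forall k w, rank_range 0 n k -> all (letter_range 0 n) w ->
      s (fc k (walk r x w)) = fc k (walk r y w).
Proof.
move=> St; have [f [f_bij f_le] ef] :=
  presented_iso (flagged_presented x fl) (flagged_presented y fl) St.
exists (perm (bij_inj f_bij)).
  by rewrite inE; apply/'forall_'forall_eqP=> F G; rewrite !permE f_le.
by move=> k w Rk Lw; rewrite permE ef.
Qed.

Lemma regular_flagged :
  (forall x y w, all (letter_range 0 n) w -> walk r x w = x -> walk r y w = y) ->
  regular P.
Proof.
move=> St; have [|x _] := @chain_sub_flag set0; last first.
  apply/imsetP; exists (flag_of x); first exact: flags_flag_of.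
  apply/setP=> A; apply/idP/orbitP => [/flagsP[y ->]|[s As <-]].
    have [|s As es] := @automorphism_exists x y.
      by move=> w Lw; split; apply: St.
    by exists s => //; apply: setact_flag_of => k Rk; apply: (es k [::]).
  by have [y /setact_flag_of->] := automorphism_face x As; apply: flags_flag_of.
by apply/forall_inP=> F; rewrite inE.
Qed.

(** The stabilizer condition puts flags of equal parity in one orbit, the last hypothesis separates
    the parities, and each letter changes the parity. *)
Lemma chiral_flagged (parity : X -> bool) :
  (forall i x, letter_range 0 n i -> parity (r i x) = ~~ parity x) ->
  0 < n ->
  (forall x y w, parity x = parity y -> all (letter_range 0 n) w ->
     walk r x w = x -> walk r y w = y) ->
  (forall x y s, s \in automorphisms P -> parity x != parity y ->
     ('P^*)%act (flag_of x) s <> flag_of y) ->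
  chiral P.
Proof.
move=> par_r n_gt0 St no_odd.
have orb x y : (orbit 'P^* (automorphisms P) (flag_of x) ==
    orbit 'P^* (automorphisms P) (flag_of y)) = (parity x == parity y).
  apply/eqP/eqP => [e|pxy].
    have : flag_of y \in orbit 'P^* (automorphisms P) (flag_of x).
      by rewrite e orbit_refl.
    case/orbitP=> s As es; have [//|nxy] := eqVneq (parity x) (parity y).
    by case: (no_odd x y s As nxy).
  apply/esym/orbit_eqP; have [|s As es] := @automorphism_exists x y.
    by move=> w Lw; split; apply: St.
  apply/orbitP; exists s => //.
  by apply: setact_flag_of => k Rk; apply: (es k [::]).
split=> [|Phi Psi adj]; last first.
  have /and4P[/flagsP[x ex] /flagsP[y ey] _ _] := adj.
  rewrite ex ey in adj *; have [i Li ->] := adjacent_flag_ofP adj.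
  by move/eqP; rewrite orb par_r //; case: (parity x).
have [|x _] := @chain_sub_flag set0; first by apply/forall_inP=> F; rewrite inE.
have L0 : letter_range 0 n 0 by [].
rewrite (_ : _ @: _ = [set orbit 'P^* (automorphisms P) (flag_of x);
   orbit 'P^* (automorphisms P) (flag_of (r 0 x))]).
  by rewrite cards2 orb par_r //; case: (parity x).
apply/setP=> O; apply/imsetP/set2P => [[A /flagsP[y ->] ->]|].
  have [e|ne] := eqVneq (parity x) (parity y).
    by left; apply/eqP; rewrite orb e.
  by right; apply/eqP; rewrite orb par_r //; case: (parity x) (parity y) ne => -[].
by case=> ->; [exists (flag_of x) | exists (flag_of (r 0 x))];
  rewrite ?flags_flag_of.
Qed.

End FlagsOfFlagged.

(** Strong connectivity is [fl_conn] for the set of indices at which the two flags agree; the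
    commutation of distant letters serves the diamond condition. *)
Lemma flagged_polytope n (d : Order.disp_t) (P : finTBPOrderType d)
    (X : finType) (r : nat -> X -> X) (fc : nat -> X -> P) :
  flagged 0 n r fc ->
  (forall i j x, i.+1 < j -> j < n -> r i (r j x) = r j (r i x)) ->
  polytope n P.
Proof.
move=> fl rC; split.
- by move=> A /(flagsP fl)[x ->]; rewrite (card_flag_of fl).
- move=> A B /(flagsP fl)[x ->] /(flagsP fl)[y ->].
  pose S k := fc k x == fc k y.
  have sub z k : rank_range 0 n k -> (forall l, rank_range 0 n l -> S l -> fc l z = fc l x) ->
      flag_of n fc x :&: flag_of n fc y \subset flag_of n fc z.
    move=> _ ez; apply/subsetP=> F /setIP[/flag_ofP[l Rl ->]].
    rewrite (in_flag_of fl) // => Sl; rewrite -ez //; exact: face_in_flag.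
  have [|w Lw ey] := @fl_conn _ _ _ _ _ _ _ fl S x y.
    by move=> k Rk /eqP.
  set R := [rel _ _ | _].
  suff h z : (forall l, rank_range 0 n l -> S l -> fc l z = fc l x) ->
      connect R (flag_of n fc z) (flag_of n fc (walk r z w)).
    by rewrite [X in connect _ _ (flag_of _ _ X)]ey; apply: h.
  elim: w z Lw {ey} => [|i w IHw] z //= /andP[/andP[Li Si] Lw] ez.
  have ez' l : rank_range 0 n l -> S l -> fc l (r i z) = fc l x.
    move=> Rl Sl; rewrite (fl_fix fl) ?ez //.
    by apply: contraNneq Si => <-.
  apply: connect_trans (IHw _ Lw ez'); apply: connect1 => /=.
  by rewrite (adjacent_flag_of fl) // !(sub _ 0).
- move=> F G lt_FG; have [|x /subsetP sx] := @chain_sub_flag _ _ _ _ _ _ fl [set F; G].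
    by apply/forall_inP=> H /set2P[]->; apply/forall_inP=> K /set2P[]->;
      rewrite /Order.comparable ?lexx ?(ltW lt_FG) ?orbT.
  have /flag_ofP[k Rk eF] := sx F (set21 _ _).
  have /flag_ofP[l Rl eG] := sx G (set22 _ _).
  rewrite eF eG !(face_rankE fl) // => ekl; have {ekl} el : l = k.+2 by lia.
  have Lk : letter_range 0 n k by move: Rl; rewrite el /rank_range /letter_range; lia.
  have Rk1 : rank_range 0 n k.+1 by move: Rl; rewrite el /rank_range; lia.
  rewrite el in Rl *.
  have lt1 y : (fc k y < fc k.+1 y)%O by apply: (face_lt fl); case/andP: Lk; lia.
  have lt2 y : (fc k.+1 y < fc k.+2 y)%O by apply: (face_lt fl); case/andP: Lk; lia.
  rewrite (_ : [set _ | _] = [set fc k.+1 x; fc k.+1 (r k x)]).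
    by rewrite cards2; case: eqP => // /esym /(fl_move fl Lk).
  have fixk y : fc k (r k y) = fc k y by rewrite (fl_fix fl) // neq_ltn ltnS leqnn.
  have fixk2 y : fc k.+2 (r k y) = fc k.+2 y by rewrite (fl_fix fl) // neq_ltn !ltnS leqnn orbT.
  apply/setP=> H; rewrite inE; apply/idP/set2P => [/andP[lt_kH lt_Hk]|]; last first.
    case=> ->; first by rewrite lt1 lt2.
    by rewrite -{1}fixk -fixk2 lt1 lt2.
  have [|y /subsetP sy] := @chain_sub_flag _ _ _ _ _ _ fl [set fc k x; H; fc k.+2 x].
    have lt_kk := lt_trans lt_kH lt_Hk.
    by apply/forall_inP=> A; rewrite !inE -orbA => /or3P[]/eqP->;
       apply/forall_inP=> B; rewrite !inE -orbA => /or3P[]/eqP->;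
       rewrite /Order.comparable ?lexx ?(ltW lt_kH) ?(ltW lt_Hk) ?(ltW lt_kk) ?orbT.
  have /flag_ofP[m Rm eH] : H \in flag_of n fc y by apply: sy; rewrite !inE eqxx orbT.
  have : fc k x \in flag_of n fc y by apply: sy; rewrite !inE eqxx.
  rewrite (in_flag_of fl) // => /eqP ek.
  have : fc k.+2 x \in flag_of n fc y by apply: sy; rewrite !inE eqxx !orbT.
  rewrite (in_flag_of fl) // => /eqP ek2.
  have em : m = k.+1.
    have := fl_le fl Rk Rm (x := x) (y := y); rewrite -eH (ltW lt_kH) => /(_ isT).
    have := fl_le fl Rm Rl (x := y) (y := x); rewrite -eH (ltW lt_Hk) => /(_ isT).
    have : m <> k by move=> e; rewrite eH e ek ltxx in lt_kH.
    have : m <> k.+2 by move=> e; rewrite eH e ek2 ltxx in lt_Hk.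
    by lia.
  rewrite {}em in eH Rm; rewrite {}eH.
  have [|w Lw ->] := @fl_conn _ _ _ _ _ _ _ fl (pred2 k k.+2) x y.
    by move=> j Rj /orP[]/eqP->.
  (* The word avoids the two neighbours of the letter [k]. Each of its letters is [k] or commutes
     with [k], so the face of index [k.+1] takes only two values. *)
  elim: w (x) Lw => [|i w IHw] z /=; first by left.
  rewrite negb_or !eqSS => /andP[/and3P[Li ik ik2] Lw].
  have [eik|nik] := eqVneq i k.
    have := IHw (r i z) Lw; rewrite eik (fl_inv fl Lk); tauto.
  have fixi t : fc k.+1 (r i t) = fc k.+1 t by rewrite (fl_fix fl) // eqSS eq_sym.
  have := IHw (r i z) Lw; rewrite fixi.
  suff -> : r k (r i z) = r i (r k z) by rewrite fixi.
  case/andP: Li Lk => _ lt_in /andP[_ lt_kn].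
  have [lt_ik|lt_ki|e] := ltngtP i k; last by rewrite e eqxx in nik.
    by apply/esym/rC; lia.
  by apply/rC; lia.
Qed.

(** A flag of the section is represented by the flag of [P] that completes it with the faces of [x0]
    of index at most [lo] or above [hi]. *)
Lemma section_flagged n lo hi (d : Order.disp_t) (P : finPOrderType d)
    (X : finType) (r : nat -> X -> X) (fc : nat -> X -> P) (x0 : X) :
  flagged 0 n r fc -> lo <= hi <= n ->
  exists (Y : finType) (rY : nat -> Y -> Y)
    (fY : nat -> Y -> section_of (fc lo x0) (fc hi.+1 x0)) (v : Y -> X) (y0 : Y),
  [/\ flagged lo hi rY fY, injective v, v y0 = x0,
      forall i y, letter_range lo hi i -> v (rY i y) = r i (v y)
    & forall k y, rank_range lo hi k -> val (fY k y) = fc k (v y)].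
Proof.
move=> fl lo_hi; have rK := fl_inv fl.
have sR k : rank_range lo hi k -> rank_range 0 n k by rewrite /rank_range; lia.
have sL i : letter_range lo hi i -> letter_range 0 n i by rewrite /letter_range; lia.
pose out k := (k <= lo) || (hi < k).
pose ok x := [forall k : 'I_n.+2, out k ==> (fc k x == fc k x0)].
have okP x : reflect (forall k, rank_range 0 n k -> out k -> fc k x = fc k x0) (ok x).
  apply: (iffP forallP) => [h k Rk ok_k|h k].
    by apply/eqP; have /implyP := h (@Ordinal n.+2 k Rk); apply.
  by apply/implyP=> ok_k; rewrite h // /rank_range; have := ltn_ord k; lia.
have ok0 : ok x0 by apply/okP.
have okr i x : letter_range lo hi i -> ok x -> ok (r i x).
  move=> Li /okP okx; apply/okP=> k Rk out_k; rewrite (fl_fix fl) ?okx ?sL //.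
  by move: Li out_k; rewrite /letter_range /out; lia.
pose Y := {x : X | ok x}.
pose rY i (y : Y) : Y := insubd y (r i (val y)).
have Rlo : rank_range 0 n lo by rewrite /rank_range; lia.
have Rhi : rank_range 0 n hi.+1 by rewrite /rank_range; lia.
have secP k (y : Y) : rank_range lo hi k ->
    (fc lo x0 <= fc k (val y) <= fc hi.+1 x0)%O.
  move=> Rk; have /okP oky := valP y.
  rewrite -(oky lo) /out ?leqnn // -(oky hi.+1) /out ?leqnn ?orbT //.
  by case/andP: (Rk) => lk kh; rewrite !(fl_mono fl) // sR.
have bP : (fc lo x0 <= fc lo x0 <= fc hi.+1 x0)%O.
  by rewrite lexx (fl_mono fl) //; lia.
pose S := section_of (fc lo x0) (fc hi.+1 x0).
pose b0 : S := Sub (fc lo x0) bP.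
pose fY k (y : Y) : S := insubd b0 (fc k (val y)).
have vrY i (y : Y) : letter_range lo hi i -> val (rY i y) = r i (val y).
  by move=> Li; rewrite val_insubd okr ?(valP y).
have vfY k (y : Y) : rank_range lo hi k -> val (fY k y) = fc k (val y).
  by move=> Rk; rewrite val_insubd secP.
exists Y, rY, fY, val, (Sub x0 ok0); split=> //; [|exact: val_inj].
have leS (F G : S) : (F <= G)%O = (val F <= val G)%O by [].
split.
- by move=> i Li y; apply: val_inj; rewrite !vrY ?rK ?sL.
- move=> i k y Li Rk ki; apply: val_inj.
  by rewrite !vfY // vrY // (fl_fix fl) ?sL ?sR.
- move=> i y Li /(congr1 val); rewrite !vfY ?vrY //; last 1 first.
  + by move: Li; rewrite /rank_range /letter_range; lia.
  + by apply: (fl_move fl); apply: sL.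
  + by move: Li; rewrite /rank_range /letter_range; lia.
- by move=> k l y Rk Rl kl; rewrite leS !vfY // (fl_mono fl) ?sR.
- by move=> k l x y Rk Rl; rewrite leS !vfY //; apply: (fl_le fl); apply: sR.
- move=> A /forall_inP chA.
  (* Adding the outer faces of [x0] forces the flag of [P] through the chain to represent a flag of
     the section. *)
  pose A' := [set val F | F in A] :|: [set fc (val k) x0 | k in [set k : 'I_n.+2 | out k]].
  have [|x Ax] := @fl_chain _ _ _ _ _ _ _ fl A'.
    have c1 F (k : 'I_n.+2) : out k -> (val (F : S) >=< fc k x0)%O.
      have Rk : rank_range 0 n k := ltn_ord k.
      move=> ok_k; have /andP[lF Fh] := valP F; rewrite /Order.comparable.
      case/orP: ok_k => [kl|hk].
        by rewrite orbC (le_trans _ lF) // (fl_mono fl).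
      by rewrite (le_trans Fh) // (fl_mono fl).
    apply/forall_inP=> F F_A; apply/forall_inP=> G G_A.
    case/setUP: F_A => /imsetP[F' F'A ->]; case/setUP: G_A => /imsetP[G' G'A ->].
    + by have /forall_inP := chA F' F'A; apply.
    + by apply: c1; rewrite inE in G'A.
    + by rewrite comparable_sym; apply: c1; rewrite inE in F'A.
    + have /forall_inP/(_ (fc F' x0)) := flag_of_chain fl x0.
      have inF (k : 'I_n.+2) : fc k x0 \in flag_of n fc x0.
        by apply: face_in_flag; apply: (ltn_ord k).
      by move/(_ (inF F'))/forall_inP/(_ (fc G' x0) (inF G')).
  have okx : ok x.
    apply/okP=> k Rk ok_k; have [|l Rl e] := Ax (fc k x0).
      apply/setUP; right; apply/imsetP; exists (@Ordinal n.+2 k Rk) => //.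
      by rewrite inE.
    by rewrite e -(face_index fl Rk Rl e).
  exists (Sub x okx) => F FA; have [|k Rk e] := Ax (val F).
    by apply/setUP; left; apply: imset_f.
  have Rk' : rank_range lo hi k.
    have /andP[lF Fh] := valP F; rewrite e in lF Fh.
    by rewrite /rank_range (fl_le fl Rlo Rk lF) (fl_le fl Rk Rhi Fh).
  by exists k => //; apply: val_inj; rewrite vfY.
- move=> T x y exy; have /okP okx := valP x; have /okP oky := valP y.
  have [|w Lw ew] := @fl_conn _ _ _ _ _ _ _ fl
      [pred k | out k || (rank_range lo hi k && T k)] (val x) (val y).
    move=> k Rk /orP[ok_k|/andP[Rk' Tk]]; first by rewrite okx ?oky.
    by rewrite -!vfY // exy.
  have Lw' : all [pred i | letter_range lo hi i & ~~ T i.+1] w.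
    apply: sub_all Lw => i /= /andP[Li]; rewrite negb_or negb_and.
    by move: Li; rewrite /letter_range /rank_range /out; case: (T _); lia.
  exists w => //; apply: val_inj; rewrite ew.
  pose E (a : X) (b : Y) := a = val b.
  apply: (@walk_morph _ _ r rY _ E _ w (val x) x Lw') => //.
  by move=> i a b /andP[Li _] ->; rewrite /E vrY.
Qed.

Section FlaggedTB.
Variables (n : nat) (d : Order.disp_t) (P : finTBPOrderType d).
Variables (X : finType) (r : nat -> X -> X) (fc : nat -> X -> P).
Hypothesis fl : flagged 0 n r fc.

Lemma flagged_extremal k (F : P) x : rank_range 0 n k ->
  (F >=< fc k x)%O -> (exists y, F = fc k y) -> F = fc k x.
Proof.
move=> Rk cF [y eF]; rewrite eF in cF *.
have [|t /subsetP At] := @chain_sub_flag _ _ _ _ _ _ fl [set fc k y; fc k x].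
  case/orP: cF => h; apply/forall_inP=> A /set2P[]->; apply/forall_inP=> B /set2P[]->;
    by rewrite /Order.comparable ?lexx ?h ?orbT.
have := At _ (set21 _ _); have := At _ (set22 _ _).
by rewrite !(in_flag_of fl) // => /eqP-> /eqP->.
Qed.

Lemma flagged_bot x : fc 0 x = \bot%O.
Proof.
have [y [k [Rk e]]] := face_exists fl (\bot%O : P).
have /(fl_le fl Rk (isT : rank_range 0 n 0)) : (fc k y <= fc 0 x)%O by rewrite -e le0x.
rewrite leqn0 => /eqP k0; rewrite k0 in e Rk.
by apply/esym/flagged_extremal => //; [rewrite /Order.comparable le0x | exists y].
Qed.

Lemma flagged_top x : fc n.+1 x = \top%O.
Proof.
have Rn : rank_range 0 n n.+1 by rewrite /rank_range leqnn.
have [y [k [Rk e]]] := face_exists fl (\top%O : P).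
have /(fl_le fl Rn Rk) : (fc n.+1 x <= fc k y)%O by rewrite -e lex1.
move=> le_nk; have k0 : k = n.+1 by move: Rk; rewrite /rank_range; lia.
rewrite k0 in e Rk.
apply/esym/flagged_extremal => //; last by exists y.
by rewrite /Order.comparable lex1 orbT.
Qed.

End FlaggedTB.

(** * The flags of a polytope *)

Section PolytopeFlagged.
Variables (n : nat) (d : Order.disp_t) (Q : finTBPOrderType d).
Hypothesis pQ : polytope n Q.
Implicit Types (A B : {set Q}) (F G H : Q).

Let cardA A : A \in flags Q -> #|A| = n.+2.
Proof. by case: pQ => h _ _; apply: h. Qed.

Lemma flag_chain A : A \in flags Q -> is_chain A.
Proof. by rewrite inE => /maxsetP[]. Qed.

Lemma chain_extend A : is_chain A -> exists2 B, B \in flags Q & A \subset B.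
Proof.
by move=> /maxset_exists[B maxB sAB]; exists B; rewrite ?inE.
Qed.

Lemma chain_flag A : is_chain A -> #|A| = n.+2 -> A \in flags Q.
Proof.
move=> /chain_extend[B fB sAB] cA.
by have /eqP-> : A == B; rewrite // eqEcard sAB cA cardA /=.
Qed.

Lemma chainP A : reflect {in A &, forall F G, (F >=< G)%O} (is_chain A).
Proof.
apply: (iffP forall_inP) => [h F G FA GA|h F FA].
  by have /forall_inP := h F FA; apply.
by apply/forall_inP=> G GA; apply: h.
Qed.

(** For a face of a flag this is its index plus one; the least face has height 1. *)
Definition height A F := #|[set G in A | (G <= F)%O]|.

Lemma height_le A F G : A \in flags Q -> F \in A -> G \in A ->
  (height A F <= height A G) = (F <= G)%O.
Proof.
move=> fA FA GA; have /chainP/(_ _ _ FA GA) := flag_chain fA.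
have mono F' G' : (F' <= G')%O -> height A F' <= height A G'.
  move=> le_FG; apply: subset_leq_card; apply/subsetP=> H; rewrite !inE.
  by case/andP=> -> /le_trans->.
case/orP=> [le_FG|le_GF]; first by rewrite le_FG mono.
apply/idP/idP; last exact: mono.
rewrite leq_eqVlt ltnNge mono // orbF => /eqP e.
have : F \in [set H in A | (H <= F)%O] by rewrite inE FA lexx.
have /eqP<- : [set H in A | (H <= G)%O] == [set H in A | (H <= F)%O].
  have le_e : #|[set H in A | (H <= F)%O]| <= #|[set H in A | (H <= G)%O]|.
    by rewrite -/(height A F) e.
  rewrite eqEcard le_e andbT.
  by apply/subsetP=> H; rewrite !inE => /andP[-> /le_trans->].
by rewrite inE => /andP[].
Qed.

Lemma height_inj A : A \in flags Q -> {in A &, injective (height A)}.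
Proof.
move=> fA F G FA GA e; apply/le_anti.
by rewrite -!(height_le fA) // e leqnn.
Qed.

Lemma height_range A F : A \in flags Q -> F \in A -> 0 < height A F <= n.+2.
Proof.
move=> fA FA; apply/andP; split.
  by apply/card_gt0P; exists F; rewrite inE FA lexx.
by rewrite -(cardA fA) subset_leq_card //; apply/subsetP=> G; rewrite inE => /andP[].
Qed.

Definition nth_face k A : Q :=
  odflt \bot%O [pick F in A | height A F == k.+1].

Lemma nth_faceP k A : A \in flags Q -> k < n.+2 ->
  nth_face k A \in A /\ height A (nth_face k A) = k.+1.
Proof.
move=> fA lt_k; rewrite /nth_face; case: pickP => [F /andP[FA /eqP]|no] //=.
pose h F : 'I_n.+2 := inord (height A F).-1.
have h_inj : {in A &, injective h}.
  move=> F G FA GA /(congr1 val); rewrite /h /= !inordK;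
    [|by have := height_range fA GA; lia|by have := height_range fA FA; lia].
  have := height_range fA FA; have := height_range fA GA => rG rF e.
  by apply: (height_inj fA) => //; lia.
have : h @: A == setT.
  by rewrite eqEcard subsetT card_in_imset // cardsT card_ord cardA /=.
move/eqP/setP/(_ (Ordinal lt_k)); rewrite inE => /imsetP[F FA e].
have := no F; rewrite /= FA /=; move/(congr1 val): e => /=.
rewrite inordK; last by have := height_range fA FA; lia.
by move=> e; have := height_range fA FA; rewrite e; lia.
Qed.

Lemma nth_face_height A F : A \in flags Q -> F \in A ->
  F = nth_face (height A F).-1 A.
Proof.
move=> fA FA; have rF := height_range fA FA.
have [|h1 h2] := @nth_faceP (height A F).-1 A fA; first lia.
by apply: (height_inj fA) => //; rewrite h2; lia.
Qed.

(** Any chain below [F] extends by the faces of [A] above [F]. Since all flags have the same size,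
    it cannot be longer than the part of [A] below [F]. *)
Lemma face_rank_height A F : A \in flags Q -> F \in A ->
  face_rank F = ((height A F)%:Z - 2)%R.
Proof.
move=> fA FA; rewrite /face_rank; set M := (\max_(_ | _) _).
suff -> : M = height A F by [].
have chA := flag_chain fA.
apply/eqP; rewrite eqn_leq; apply/andP; split; last first.
  apply: leq_bigmax_cond; apply/andP; split.
    by apply/chainP=> G H; rewrite !inE => /andP[GA _] /andP[HA _]; apply/(chainP _ chA).
  by apply/forall_inP=> G; rewrite inE => /andP[].
apply/bigmax_leqP=> B /andP[/chainP chB /forall_inP BF].
pose U := [set G in A | ~~ (G <= F)%O].
have FU G : G \in U -> (F <= G)%O.
  rewrite inE => /andP[GA nGF]; have := (chainP _ chA) F G FA GA.
  by rewrite /Order.comparable (negPf nGF) orbF.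
have disj : [disjoint B & U].
  by apply/pred0P=> G /=; apply/negP=> /andP[/BF le_G]; rewrite inE le_G andbF.
have : is_chain (B :|: U).
  apply/chainP=> G H /setUP[GB|GU] /setUP[HB|HU].
  - exact: chB.
  - by rewrite /Order.comparable (le_trans (BF G GB) (FU H HU)).
  - by rewrite /Order.comparable (le_trans (BF H HB) (FU G GU)) orbT.
  - move: GU HU; rewrite !inE => /andP[GA _] /andP[HA _]; exact: (chainP _ chA).
case/chain_extend=> C fC /subset_leq_card; rewrite cardsU disjoint_setI0 //.
rewrite cards0 subn0 (cardA fC) -(cardA fA).
have -> : #|A| = height A F + #|U|.
  rewrite -(cardsID [set G | (G <= F)%O] A) /height /U; congr (_ + _);
    by apply: eq_card => G; rewrite !inE // andbC.
by rewrite leq_add2r.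
Qed.

Lemma face_rank_nth k A : A \in flags Q -> k < n.+2 ->
  face_rank (nth_face k A) = (k%:Z - 1)%R.
Proof.
move=> fA lt_k; have [h1 h2] := nth_faceP fA lt_k.
by rewrite (face_rank_height fA h1) h2; lia.
Qed.

Lemma nth_face_rank k A F : A \in flags Q -> F \in A ->
  face_rank F = (k%:Z - 1)%R -> F = nth_face k A.
Proof.
move=> fA FA; rewrite (face_rank_height fA FA) => e.
have := height_range fA FA; rewrite [LHS](nth_face_height fA FA) => rF.
by congr nth_face; lia.
Qed.

Lemma face_rank_mono F G : (F <= G)%O -> (face_rank F <= face_rank G)%R.
Proof.
move=> le_FG; rewrite /face_rank; set M := \max_(_ | _) _; set N := \max_(_ | _) _.
suff : M <= N by lia.
apply/bigmax_leqP=> B /andP[chB /forall_inP BF]; apply: leq_bigmax_cond.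
by rewrite chB; apply/forall_inP=> H /BF /le_trans->.
Qed.

Lemma nth_face_le k l A B : A \in flags Q -> B \in flags Q ->
  k < n.+2 -> l < n.+2 -> (nth_face k A <= nth_face l B)%O -> k <= l.
Proof.
move=> fA fB lk ll /face_rank_mono; rewrite !face_rank_nth //; lia.
Qed.

Lemma nth_face_mono k l A : A \in flags Q -> l < n.+2 -> k <= l ->
  (nth_face k A <= nth_face l A)%O.
Proof.
move=> fA ll kl; have [h1 h2] := nth_faceP fA (leq_ltn_trans kl ll).
by have [h3 h4] := nth_faceP fA ll; rewrite -(height_le fA) // h2 h4.
Qed.

Lemma nth_face_lt k l A : A \in flags Q -> l < n.+2 -> k < l ->
  (nth_face k A < nth_face l A)%O.
Proof.
move=> fA ll kl; rewrite lt_neqAle nth_face_mono ?(ltnW kl) // andbT.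
have lk := ltn_trans kl ll; apply/eqP=> e.
by have := face_rank_nth fA ll; rewrite -e face_rank_nth //; lia.
Qed.

Lemma nth_face_index k l A B : A \in flags Q -> B \in flags Q ->
  k < n.+2 -> l < n.+2 -> nth_face k A = nth_face l B -> k = l.
Proof.
move=> fA fB lk ll e; apply/eqP; rewrite eqn_leq.
by rewrite (nth_face_le fA fB) ?e //= (nth_face_le fB fA) ?e.
Qed.

Lemma flag_ext A B : A \in flags Q -> B \in flags Q ->
  (forall k, k < n.+2 -> nth_face k A = nth_face k B) -> A = B.
Proof.
move=> fA fB e; apply/eqP; rewrite eqEcard !cardA // leqnn andbT.
apply/subsetP=> F FA; rewrite [F](nth_face_height fA FA).
have rF := height_range fA FA.
by rewrite e; last lia; apply: (nth_faceP fB _).1; lia.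
Qed.

Definition other_face i A : Q := odflt \bot%O
  [pick H | (nth_face i A < H < nth_face i.+2 A)%O && (H != nth_face i.+1 A)].

Definition flip i A : {set Q} := other_face i A |: A :\ nth_face i.+1 A.

Section Flip.
Variables (i : nat) (A : {set Q}).
Hypotheses (lt_i : i < n) (fA : A \in flags Q).

Let F1 := nth_face i.+1 A.

Lemma between_nth : (nth_face i A < F1 < nth_face i.+2 A)%O.
Proof. by rewrite !nth_face_lt //; lia. Qed.

Lemma between_two :
  [set H | (nth_face i A < H < nth_face i.+2 A)%O] = [set F1; other_face i A]
  /\ other_face i A != F1.
Proof.
case: pQ => _ _ /(_ (nth_face i A) (nth_face i.+2 A)).
rewrite nth_face_lt ?face_rank_nth //; try lia.
move/(_ isT) => h; have /eqP {}h := h ltac:(lia).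
set D := [set H | _] in h *; have F1D : F1 \in D by rewrite inE between_nth.
have : #|D :\ F1| == 1 by rewrite (cardsD1 F1) F1D in h.
case/cards1P=> H eH; have : H \in D :\ F1 by rewrite eH set11.
rewrite !inE => /andP[nH bH].
have eO : other_face i A = H.
  rewrite /other_face; case: pickP => [G|/(_ H)]; last by rewrite bH nH.
  by move=> /= bG; apply/set1P; rewrite -eH !inE andbC.
by rewrite eO; split=> //; rewrite -eH setD1K.
Qed.

Lemma other_faceP H : (nth_face i A < H < nth_face i.+2 A)%O -> H != F1 ->
  H = other_face i A.
Proof.
move=> bH nH; have [e _] := between_two.
have : H \in [set F1; other_face i A] by rewrite -e inE.
by rewrite !inE (negPf nH) => /eqP.
Qed.

Lemma other_between : (nth_face i A < other_face i A < nth_face i.+2 A)%O.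
Proof.
have [e _] := between_two.
by have := set22 F1 (other_face i A); rewrite -e inE.
Qed.

Lemma flip_flag : flip i A \in flags Q.
Proof.
have [_ nO] := between_two; have /andP[lO Oh] := other_between.
have [F1A hF1] : F1 \in A /\ height A F1 = i.+2 by apply: nth_faceP => //; lia.
have [FiA hi] : nth_face i A \in A /\ height A (nth_face i A) = i.+1.
  by apply: nth_faceP => //; lia.
have [F2A h2] : nth_face i.+2 A \in A /\ height A (nth_face i.+2 A) = i.+3.
  by apply: nth_faceP => //; lia.
have cO G : G \in A :\ F1 -> (G <= nth_face i A)%O \/ (nth_face i.+2 A <= G)%O.
  rewrite !inE => /andP[nG GA]; rewrite -!(height_le fA) // hi h2.
  have : height A G <> i.+2.
    by move=> e; case/eqP: nG; apply: (height_inj fA); rewrite // e hF1.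
  by lia.
have cO' G : G \in A :\ F1 -> (other_face i A >=< G)%O.
  move/cO; rewrite /Order.comparable => -[h|h].
    by rewrite (le_trans h (ltW lO)) orbT.
  by rewrite (le_trans (ltW Oh) h).
apply: chain_flag.
  apply/chainP=> G H /setU1P[->|GA] /setU1P[->|HA].
  - by rewrite /Order.comparable lexx.
  - exact: cO'.
  - by rewrite comparable_sym cO'.
  - by move: GA HA; rewrite !inE => /andP[_ GA] /andP[_ HA]; apply: (chainP _ (flag_chain fA)).
have nOA : other_face i A \notin A :\ F1.
  apply/negP=> /cO[h|h]; first by rewrite (lt_geF lO) in h.
  by rewrite (lt_geF Oh) in h.
by rewrite cardsU1 nOA -(cardA fA) (cardsD1 F1 A) F1A.
Qed.

Lemma flip_fix k : k < n.+2 -> k != i.+1 -> nth_face k (flip i A) = nth_face k A.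
Proof.
move=> lk ki; apply/esym/(nth_face_rank flip_flag); last exact: face_rank_nth.
have [kA hk] := nth_faceP fA lk.
rewrite !inE kA andbT; apply/orP; right; apply: contra ki => /eqP e.
by apply/eqP; apply: (nth_face_index fA fA _ _ e) => //; lia.
Qed.

Lemma flip_other : nth_face i.+1 (flip i A) = other_face i A.
Proof.
have OA : other_face i A \in flip i A by rewrite setU11.
have rO := height_range flip_flag OA.
have e := nth_face_height flip_flag OA; have /andP[lO Oh] := other_between.
rewrite e in lO Oh.
have := nth_face_le fA flip_flag _ _ (ltW lO) => /(_ ltac:(lia) ltac:(lia)) h1.
have := nth_face_le flip_flag fA _ _ (ltW Oh) => /(_ ltac:(lia) ltac:(lia)) h2.
rewrite [RHS]e; congr nth_face; apply/eqP.
have [e1|n1] := eqVneq (height (flip i A) (other_face i A)).-1 i.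
  by rewrite e1 flip_fix ?ltxx // in lO; lia.
have [e1|n2] := eqVneq (height (flip i A) (other_face i A)).-1 i.+2.
  by rewrite e1 flip_fix ?ltxx // in Oh; lia.
lia.
Qed.

(** Involutivity and commutation of flips follow from this uniqueness, without computing with the
    sets. *)
Lemma flipP B : B \in flags Q ->
  (forall k, k < n.+2 -> k != i.+1 -> nth_face k B = nth_face k A) ->
  nth_face i.+1 B <> nth_face i.+1 A -> B = flip i A.
Proof.
move=> fB e ne; apply: flag_ext flip_flag _ => // k lk.
have [->|ki] := eqVneq k i.+1; last by rewrite e // flip_fix.
rewrite flip_other; apply: other_faceP; last exact/eqP.
rewrite -!e; try lia.
by rewrite !nth_face_lt //; lia.
Qed.

End Flip.

Definition pflag := {A : {set Q} | A \in flags Q}.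
Definition pr i (A : pflag) : pflag := insubd A (flip i (val A)).
Definition pfc k (A : pflag) : Q := nth_face k (val A).

Lemma val_pr i (A : pflag) : i < n -> val (pr i A) = flip i (val A).
Proof. by move=> lt_i; rewrite val_insubd flip_flag // (valP A). Qed.

Lemma polytope_flagged : flagged 0 n pr pfc.
Proof.
have [_ sfc _] := pQ.
have fix' i k (x : pflag) : i < n -> k < n.+2 -> k != i.+1 -> pfc k (pr i x) = pfc k x.
  by move=> li lk ki; rewrite /pfc val_pr // flip_fix // (valP x).
have move' i (x : pflag) : i < n -> pfc i.+1 (pr i x) <> pfc i.+1 x.
  move=> li; rewrite /pfc val_pr // flip_other ?(valP x) //.
  by have [_ /eqP] := between_two li (valP x).
split.
- move=> i Li x; apply: val_inj; rewrite !val_pr //; apply/esym/flipP => //.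
  + by rewrite flip_flag // (valP x).
  + exact: valP.
  + by move=> k lk ki; rewrite flip_fix // (valP x).
  + by move=> e; apply: (move' i x) => //; rewrite /pfc val_pr.
- by move=> i k x; apply: fix'.
- by move=> i x; apply: move'.
- by move=> k l x _ Rl kl; apply: nth_face_mono => //; apply: valP.
- by move=> k l x y Rk Rl; apply: nth_face_le => //; apply: valP.
- move=> A /chain_extend[B fB sAB]; exists (Sub B fB) => F /(subsetP sAB) FB.
  exists (height B F).-1; last exact: nth_face_height.
  by have := height_range fB FB; rewrite /rank_range; lia.
move=> S x y exy; have := sfc _ _ (valP x) (valP y).
case/connectP=> p; set I0 := (_ :&: _).
have Iface k z : k < n.+2 -> S k -> I0 \subset val (z : pflag) -> pfc k z = pfc k x.
  move=> lk Sk sI; apply/esym/(nth_face_rank (valP z)); last exact: face_rank_nth (valP x) lk.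
  apply: (subsetP sI); rewrite inE (nth_faceP (valP x) lk).1.
  by rewrite -/(pfc k x) exy // (nth_faceP (valP y) lk).1.
have sIx : I0 \subset val x by apply: subsetIl.
set R := (X in path X _ _); set J := [pred i | _ & _].
suff h (z : pflag) : I0 \subset val z -> path R (val z) p ->
    val y = last (val z) p -> conn pr J z y by apply: h.
elim: p z => [|B p IHp] z sIz /=.
  by move=> _ e; have -> : y = z by [apply: val_inj]; exists [::].
case/andP=> /and3P[adj sz sB] pB eB.
have /and4P[_ fB /cards1P[F eF] _] := adj.
pose zB : pflag := Sub B fB.
apply: (@conn_trans _ _ _ _ zB); last exact: (IHp zB).
have : F \in val z :\: B by rewrite eF set11.
rewrite inE => /andP[nFB Fz].
have eFz := nth_face_height (valP z) Fz; have rF := height_range (valP z) Fz.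
set k := (height _ F).-1 in eFz; have lk : k < n.+2 by case/andP: rF => h0 hn; rewrite /k prednK.
have same l : l < n.+2 -> l != k -> nth_face l B = nth_face l (val z).
  move=> ll lk'; apply/esym/(nth_face_rank fB); last exact: face_rank_nth (valP z) ll.
  apply/negPn/negP=> nB; have [lz hl] := nth_faceP (valP z) ll.
  have : nth_face l (val z) \in val z :\: B by rewrite inE nB.
  rewrite eF inE eFz => /eqP /(nth_face_index (valP z) (valP z) ll lk) e.
  by rewrite e eqxx in lk'.
have notS : ~~ S k.
  apply/negP=> Sk; case/negP: nFB; rewrite eFz -/(pfc k z) (Iface k z) //.
  by rewrite -(Iface k zB) // /pfc (nth_faceP fB lk).1.
have neq : nth_face k B <> nth_face k (val z).
  by move=> e; case/negP: nFB; rewrite eFz -e (nth_faceP fB lk).1.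
(* Every flag contains the least and the greatest face, so the index changed by an adjacency is
   neither 0 nor [n.+1] and belongs to a letter. *)
have ext (H : {set Q}) : H \in flags Q -> (\bot%O \in H) /\ (\top%O \in H).
  rewrite inE => /maxsetP[/chainP chH maxH]; split.
    rewrite -(maxH (\bot%O |: H)) ?setU11 ?subsetUr //.
    apply/chainP=> G K /setU1P[->|GH] /setU1P[->|KH]; rewrite /Order.comparable ?le0x ?orbT //.
    exact: chH.
  rewrite -(maxH (\top%O |: H)) ?setU11 ?subsetUr //.
  apply/chainP=> G K /setU1P[->|GH] /setU1P[->|KH]; rewrite /Order.comparable ?lex1 ?orbT //.
  exact: chH.
have bot0 (H : {set Q}) : H \in flags Q -> nth_face 0 H = \bot%O.
  move=> fH; have [bH _] := ext H fH; apply/le_anti; rewrite le0x andbT.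
  rewrite [X in (_ <= X)%O](nth_face_height fH bH) nth_face_mono //.
  by case/andP: (height_range fH bH) => h0 hn; rewrite prednK.
have topn (H : {set Q}) : H \in flags Q -> nth_face n.+1 H = \top%O.
  move=> fH; have [_ tH] := ext H fH; apply/le_anti; rewrite lex1 /=.
  rewrite [X in (X <= _)%O](nth_face_height fH tH) nth_face_mono //.
  by case/andP: (height_range fH tH) => h0 hn; rewrite -ltnS prednK.
case ek: k => [|i]; first by case: neq; rewrite ek !bot0 // (valP z).
have li : i < n.
  rewrite ltn_neqAle; apply/andP; split; last by move: lk; rewrite ek !ltnS.
  by apply/eqP=> ein; case: neq; rewrite ek ein !topn // (valP z).
exists [:: i]; first by rewrite /= andbT; apply/andP; split; last rewrite -ek.
apply: val_inj; rewrite /= val_pr //; apply: flipP => //; first exact: valP.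
  by move=> l ll li'; apply: same; rewrite ?ek.
by rewrite -ek.
Qed.

Lemma pr_comm i j x : i.+1 < j -> j < n -> pr i (pr j x) = pr j (pr i x).
Proof.
move=> ij jn; have lin : i < n by lia.
have fx := valP x.
apply: val_inj; rewrite !val_pr //; apply/esym/flipP => //.
- exact: flip_flag jn fx.
- exact: flip_flag jn (flip_flag lin fx).
- move=> k lk ki; have [->|kj] := eqVneq k j.+1; last first.
    by rewrite !flip_fix ?flip_flag.
  rewrite !flip_other ?flip_flag //; apply: other_faceP => //.
    have := other_between jn (flip_flag lin fx).
    by rewrite !flip_fix //; lia.
  have [_ ] := between_two jn (flip_flag lin fx).
  by rewrite !flip_fix //; lia.
have lt_i1 : i.+1 < n.+2 by rewrite ltnS ltnW.
have ij' : i.+1 != j.+1 by rewrite neq_ltn ltnS (ltnW ij).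
rewrite (flip_fix jn (flip_flag lin fx) lt_i1 ij') (flip_fix jn fx lt_i1 ij').
rewrite (flip_other lin fx).
by apply/eqP; have [_] := between_two lin fx.
Qed.

End PolytopeFlagged.

(** * The polytope of a flag system *)

Definition avoiding n k : pred nat := [pred i | letter_range 0 n i & i.+1 != k].

(* [fs_conn] is the intersection property; for [S] empty it says that the flags
   form a single orbit. *)
Record flag_system := FlagSystem {
  fs_rank : nat;
  fs_flag : finType;
  fs_r : nat -> fs_flag -> fs_flag;
  fs_base : fs_flag;
  fs_inv : forall i, letter_range 0 fs_rank i -> involutive (fs_r i);
  fs_comm : forall i j x, i.+1 < j -> j < fs_rank ->
    fs_r i (fs_r j x) = fs_r j (fs_r i x);
  fs_free : forall i x, letter_range 0 fs_rank i -> fs_r i x <> x;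
  fs_conn : forall (S : pred nat) x y,
    (forall k, rank_range 0 fs_rank k -> S k ->
       conn fs_r (avoiding fs_rank k) x y) ->
    conn fs_r [pred i | letter_range 0 fs_rank i & ~~ S i.+1] x y }.

Section FlagSystemPoset.
Variable fs : flag_system.
Local Notation n := (fs_rank fs).
Local Notation X := (fs_flag fs).
Local Notation r := (@fs_r fs).

Let rKL k i : avoiding n k i -> involutive (r i).
Proof. by case/andP=> Li _; apply: fs_inv. Qed.

Definition fs_class k (x : X) : {set X} := [set y | `[< conn r (avoiding n k) x y >]].

Lemma in_fs_class k x y : reflect (conn r (avoiding n k) x y) (y \in fs_class k x).
Proof. by rewrite inE; apply: asboolP. Qed.

Lemma fs_class_refl k x : x \in fs_class k x.
Proof. by apply/in_fs_class; apply: conn_refl. Qed.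

Lemma fs_classE k x y : y \in fs_class k x -> fs_class k y = fs_class k x.
Proof.
move=> /in_fs_class xy; apply/setP=> z; apply/in_fs_class/in_fs_class => h.
  exact: conn_trans xy h.
exact: conn_trans (conn_sym (@rKL k) xy) h.
Qed.

(** The index is stored with the class because the least and the greatest face both have the set of
    all flags as their class. *)
Definition fs_face := {p : 'I_n.+2 * {set X} | [exists x, p.2 == fs_class p.1 x]}.

HB.instance Definition _ := SubFinite.on fs_face.

Fact fs_fc_subproof (k : 'I_n.+2) x :
  [exists y, (k, fs_class k x).2 == fs_class (k, fs_class k x).1 y].
Proof. by apply/existsP; exists x. Qed.

Definition fs_fc k (x : X) : fs_face :=
  Sub (inord k : 'I_n.+2, fs_class (inord k : 'I_n.+2) x)
    (fs_fc_subproof (inord k) x).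

Definition idx (F : fs_face) : nat := (val F).1.
Definition pts (F : fs_face) : {set X} := (val F).2.

Lemma idx_fc k x : rank_range 0 n k -> idx (fs_fc k x) = k.
Proof. exact: inordK. Qed.

Lemma idx_range F : rank_range 0 n (idx F).
Proof. exact: (ltn_ord (val F).1). Qed.

Lemma pts_fc k x : rank_range 0 n k -> pts (fs_fc k x) = fs_class k x.
Proof. by move=> Rk; rewrite /pts /= inordK. Qed.

Lemma fs_face_fc F x : x \in pts F -> F = fs_fc (idx F) x.
Proof.
move=> xF; apply: val_inj; rewrite /= inord_val; case: F xF => -[k A] /= AP.
rewrite /pts /idx /= => xA; congr (_, _); case/existsP: AP => y /= /eqP eA.
by rewrite eA in xA *; rewrite (fs_classE xA).
Qed.

Lemma pts_inhabited F : exists x, x \in pts F.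
Proof.
by have /existsP[x /eqP e] := valP F; exists x; rewrite /pts e fs_class_refl.
Qed.

Definition fs_le (F G : fs_face) : bool :=
  (idx F <= idx G) && [exists x, (x \in pts F) && (x \in pts G)].

Lemma fs_leP F G : reflect (idx F <= idx G /\ exists2 x, x \in pts F & x \in pts G)
  (fs_le F G).
Proof.
apply: (iffP andP) => [[h /existsP[x /andP[xF xG]]]|[h [x xF xG]]].
  by split=> //; exists x.
by split=> //; apply/existsP; exists x; rewrite xF.
Qed.

Definition low l : pred nat := [pred i | letter_range 0 n i & i.+1 < l].
Definition high l : pred nat := [pred i | letter_range 0 n i & l < i.+1].

Lemma walk_high l i x u : low l i -> all (high l) u ->
  walk r (r i x) u = r i (walk r x u).
Proof.
move=> /andP[Li il]; elim: u x => [|j u IHu] x //= /andP[/andP[Lj jl] Hu].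
rewrite -IHu //; congr (walk _ _ u); apply/esym/fs_comm; first lia.
by case/andP: Lj.
Qed.

(** Letters below and above the omitted one commute, so a word can be sorted. Transitivity of the
    order and the existence of flags through chains both rest on this. *)
Lemma conn_split l x y : conn r (avoiding n l) x y ->
  exists2 t, conn r (high l) x t & conn r (low l) t y.
Proof.
case=> w Lw ->; elim: w x Lw => [|i w IHw] x /=.
  by move=> _; exists x; apply: conn_refl.
case/andP=> /andP[Li il] /IHw - /(_ (r i x))[t [u Hu et] low_t].
have [lt_il|lt_li|e] := ltngtP i.+1 l; last by rewrite e eqxx in il.
  exists (walk r x u); first by exists u.
  apply: conn_trans low_t; exists [:: i]; first by rewrite /avoiding /low /high /= Li lt_il.
  by rewrite et (@walk_high l) // /low /= Li.
exists t => //; exists (i :: u) => //.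
by rewrite /= Hu /high /= Li lt_li.
Qed.

Lemma low_class l k x y : l <= k -> conn r (low l) x y -> conn r (avoiding n k) x y.
Proof.
by move=> lk; apply: sub_conn => i /andP[Li il]; rewrite /avoiding /low /high /= Li; lia.
Qed.

Lemma high_class l k x y : k <= l -> conn r (high l) x y -> conn r (avoiding n k) x y.
Proof.
by move=> lk; apply: sub_conn => i /andP[Li il]; rewrite /avoiding /low /high /= Li; lia.
Qed.

Lemma pts_conn F x y : x \in pts F -> conn r (avoiding n (idx F)) x y -> y \in pts F.
Proof.
move=> xF xy; rewrite (fs_face_fc xF) pts_fc ?idx_range //.
exact/in_fs_class.
Qed.

Lemma conn_pts F x y : x \in pts F -> y \in pts F -> conn r (avoiding n (idx F)) x y.
Proof.
move=> xF; rewrite {1}(fs_face_fc xF) pts_fc ?idx_range //.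
by move/in_fs_class.
Qed.

Lemma pts_merge F x : x \in pts F ->
  forall y, y \in pts F -> exists2 t, conn r (high (idx F)) x t
                             & conn r (low (idx F)) t y.
Proof. by move=> xF y yF; apply: conn_split; apply: conn_pts. Qed.

Fact fs_le_refl : reflexive fs_le.
Proof.
by move=> F; apply/fs_leP; split=> //; have [x xF] := pts_inhabited F; exists x.
Qed.

Fact fs_le_anti : antisymmetric fs_le.
Proof.
move=> F G /andP[/fs_leP[h1 [x xF xG]] /fs_leP[h2 _]].
by rewrite (fs_face_fc xF) (fs_face_fc xG) (anti_leq (introT andP (conj h1 h2))).
Qed.

Let low_sym l x y : conn r (low l) x y -> conn r (low l) y x.
Proof. by apply: conn_sym => i /andP[Li _]; apply: fs_inv. Qed.

(** A flag shared by [F] and [G] is joined inside [G] to one shared by [G] and [H]. High letters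
    keep [F] and low letters keep [H], so the flag at the turning point lies in both. *)
Fact fs_le_trans : transitive fs_le.
Proof.
move=> G F H /fs_leP[FG [x xF xG]] /fs_leP[GH [y yG yH]].
have [t xt ty] := pts_merge xG yG; apply/fs_leP; split; first exact: leq_trans FG GH.
exists t; first exact: pts_conn xF (high_class FG xt).
exact: pts_conn yH (low_class GH (low_sym ty)).
Qed.

HB.instance Definition _ := Order.Le_isPOrder.Build (Order.Disp tt tt)
  fs_face fs_le_refl fs_le_anti fs_le_trans.

Lemma fs_le0 x (F : fs_face) : (fs_fc 0 x <= F)%O.
Proof.
apply/fs_leP; rewrite idx_fc //; split=> //; have [y yF] := pts_inhabited F.
exists y => //; rewrite pts_fc //; apply/in_fs_class.
have [//|w Lw ->] := @fs_conn fs pred0 x y.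
by exists w => //; apply: sub_all Lw => i /andP[Li _]; rewrite /avoiding /low /high /= Li.
Qed.

Lemma fs_le1 x (F : fs_face) : (F <= fs_fc n.+1 x)%O.
Proof.
have Rn : rank_range 0 n n.+1 by rewrite /rank_range leqnn.
apply/fs_leP; rewrite idx_fc //; split; first by have := idx_range F.
have [y yF] := pts_inhabited F; exists y => //; rewrite pts_fc //; apply/in_fs_class.
have [//|w Lw ->] := @fs_conn fs pred0 x y.
exists w => //; apply: sub_all Lw => i /andP[Li _]; rewrite /avoiding /low /high /= Li.
by move: Li; rewrite /letter_range; lia.
Qed.

HB.instance Definition _ := Order.hasBottom.Build (Order.Disp tt tt) fs_face
  (fs_le0 (fs_base fs)).
HB.instance Definition _ := Order.hasTop.Build (Order.Disp tt tt) fs_face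
  (fs_le1 (fs_base fs)).

(** The flag is built by increasing index. To add [F], only the largest face [G] already treated
    matters: splitting a path inside [G] yields a flag in [F] without leaving the smaller faces. *)
Lemma fs_chain (A : {set fs_face}) : is_chain A -> exists x, forall F, F \in A -> x \in pts F.
Proof.
move=> /forall_inP chA.
have cmp F G : F \in A -> G \in A -> idx F <= idx G -> fs_le F G.
  move=> FA GA FG; have /forall_inP/(_ G GA)/orP[//|/fs_leP[GF [x xG xF]]] := chA F FA.
  by apply/fs_leP; split=> //; exists x.
suff main m : exists x, (forall F, F \in A -> idx F < m -> x \in pts F) /\
    ((forall F, F \in A -> m <= idx F) \/ exists G,
     [/\ G \in A, idx G < m & forall F, F \in A -> idx F < m -> idx F <= idx G]).
  by have [x [h _]] := main n.+2; exists x => F FA; apply: h => //; apply: idx_range.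
elim: m => [|m [x [xP cases]]].
  by exists (fs_base fs); split=> [F _|] //; left.
case: (pselect (exists2 F, F \in A & idx F = m)) => [[F FA eF]|no]; last first.
  have lt_m F : F \in A -> idx F < m.+1 -> idx F < m.
    move=> FA; rewrite ltnS leq_eqVlt => /predU1P[e|//].
    by case: no; exists F.
  exists x; split=> [F FA /(lt_m F FA)|]; first exact: xP.
  case: cases => [h|[G [GA Gm Gmax]]]; [left=> F FA|right].
    have := h F FA; rewrite leq_eqVlt => /predU1P[e|//].
    by case: no; exists F.
  exists G; split=> // [|F FA /(lt_m F FA)]; [exact: ltnW | exact: Gmax].
have [t [tF tP]] : exists t, t \in pts F /\ forall G, G \in A -> idx G < m -> t \in pts G.
  case: cases => [h|[G [GA Gm Gmax]]].
    have [t tF] := pts_inhabited F; exists t; split=> // G GA.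
    by rewrite ltnNge h.
  have GF : idx G <= idx F by rewrite eF ltnW.
  have /fs_leP[_ [y yG yF]] := cmp G F GA FA GF.
  have [t xt ty] := pts_merge (xP G GA Gm) yG.
  exists t; split; first exact: pts_conn yF (low_class GF (low_sym ty)).
  by move=> H HA Hm; apply: pts_conn (xP H HA Hm) (high_class (Gmax H HA Hm) xt).
exists t; split=> [G GA|]; last first.
  by right; exists F; rewrite eF; split=> // G GA.
rewrite ltnS leq_eqVlt => /predU1P[e|]; last exact: tP.
suff -> : G = F by [].
by apply: fs_le_anti; rewrite !cmp // e eF.
Qed.

Lemma fs_flagged : flagged 0 n r (fun k x => fs_fc k x : fs_face).
Proof.
have fcE k x y : rank_range 0 n k -> fs_fc k x = fs_fc k y <-> conn r (avoiding n k) x y.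
  move=> Rk; split=> [e|xy].
    by apply/in_fs_class; rewrite -pts_fc // e pts_fc // fs_class_refl.
  by rewrite [RHS](@fs_face_fc _ x) ?idx_fc // pts_fc //; apply/in_fs_class;
     apply: conn_sym xy; apply: rKL.
have fix' i k x : letter_range 0 n i -> k != i.+1 -> conn r (avoiding n k) (r i x) x.
  move=> Li ki; exists [:: i]; first by rewrite /avoiding /low /high /= Li eq_sym ki.
  by rewrite /= fs_inv.
have Ri i : letter_range 0 n i -> rank_range 0 n i.+1.
  by rewrite /letter_range /rank_range; lia.
split.
- exact: fs_inv.
- by move=> i k x Li Rk ki; apply/fcE => //; apply: fix'.
(* If the moved face stayed the same, [x] and [r i x] would share every face, and the intersection
   property for all indices would identify them. *)
- move=> i x Li /(fcE _ _ _ (Ri i Li)) h; apply: (@fs_free fs i x Li).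
  have [|w] := @fs_conn fs predT (r i x) x; last first.
    by case: w => [_ /esym//|j w] /andP[/andP[_]].
  move=> k Rk _; have [->|ki] := eqVneq k i.+1; first exact: h.
  exact: fix'.
- move=> k l x Rk Rl kl; apply/fs_leP; rewrite !idx_fc // !pts_fc //.
  by split=> //; exists x; apply: fs_class_refl.
- by move=> k l x y Rk Rl /fs_leP[]; rewrite !idx_fc.
- move=> A /fs_chain[x xA]; exists x => F /xA xF; exists (idx F); first exact: idx_range.
  exact: fs_face_fc.
- move=> S x y e; apply: fs_conn => k Rk Sk; apply/fcE => //; exact: e.
Qed.

Lemma fs_polytope : polytope n fs_face.
Proof. exact: flagged_polytope fs_flagged (@fs_comm fs). Qed.

End FlagSystemPoset.

(** * The hexagonal tessellation *)

(* The flag [(v, u, u')] consists of the tile with centre [v], the edge between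
   the tiles [v] and [v + u], and the vertex common to the tiles [v], [v + u]
   and [v + u'], where [u] and [u'] are unit vectors at an angle of 60 degrees. *)
Notation hex_flag := (hex_point * hex_point * hex_point)%type.

(** Letter 0 reflects [u'] in the line of [u], reaching the other end of the edge; letter 1 passes
    to the other edge of the tile at the vertex; letter 2 crosses the edge and rewrites the flag
    from the centre [v + u]. *)
Definition hex_r (i : nat) (a : hex_flag) : hex_flag :=
  let: (v, u, u') := a in
  match i with
  | 0 => (v, u, u - u')%R
  | 1 => (v, u', u)
  | 2 => (v + u, - u, u' - u)%R
  | _ => a
  end.

Lemma hex_rK i : involutive (hex_r i).
Proof.
case: i => [|[|[|i]]] [[v u] u'] //=; first by rewrite subKr.
by rewrite addrK opprK subrK.
Qed.

Definition hex_shift (t : hex_point) (a : hex_flag) : hex_flag :=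
  let: (v, u, u') := a in (v + t, u, u')%R.

Lemma hex_shiftD s t a : hex_shift s (hex_shift t a) = hex_shift (t + s)%R a.
Proof. by case: a => [[v u] u'] /=; rewrite addrA. Qed.

Lemma hex_shift0 a : hex_shift 0%R a = a.
Proof. by case: a => [[v u] u'] /=; rewrite addr0. Qed.

Lemma walk_hex_shift t a w :
  walk hex_r (hex_shift t a) w = hex_shift t (walk hex_r a w).
Proof.
elim: w a => [|i w IHw] a //=; rewrite -IHw; congr (walk _ _ w).
case: a => [[v u] u']; case: i => [|[|[|i]]] //=.
by rewrite addrAC.
Qed.

Definition hex_turn (L : hex_point -> hex_point) (a : hex_flag) : hex_flag :=
  let: (v, u, u') := a in (L v, L u, L u').

Lemma walk_hex_turn (L : {additive hex_point -> hex_point}) a w :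
  walk hex_r (hex_turn L a) w = hex_turn L (walk hex_r a w).
Proof.
elim: w a => [|i w IHw] a //=; rewrite -IHw; congr (walk _ _ w).
by case: a => [[v u] u']; case: i => [|[|[|i]]] //=;
  rewrite ?raddfB ?raddfD ?raddfN.
Qed.

(** The twelve ordered pairs of unit vectors at 60 degrees, in both orientations. Up to translation
    there are only twelve flags, so statements about flags reduce to a computation on this list. *)
Definition hex_units : seq (hex_point * hex_point) :=
  let s := [:: (1, 0); (0, 1); (-1, 1); (-1, 0); (0, -1); (1, -1)]%R in
  zip s (seq.rot 1 s) ++ zip (seq.rot 1 s) s.

Definition hex_valid (a : hex_flag) : bool := (a.1.2, a.2) \in hex_units.

Lemma hex_units_all (C : pred (hex_point * hex_point)) :
  all C hex_units -> forall v u u', hex_valid (v, u, u') -> C (u, u').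
Proof. by move=> /allP h v u u'; apply: h. Qed.

Lemma hex_valid_r i a : hex_valid a -> hex_valid (hex_r i a).
Proof.
case: a => [[v u] u'] Va.
have := @hex_units_all (fun q => all (fun i => hex_valid (hex_r i (0, q.1, q.2)%R)) [:: 0; 1; 2])
  ltac:(by vm_compute) v u u' Va.
by case/and4P=> h0 h1 h2 _; case: i => [|[|[|i]]].
Qed.

Lemma hex_valid_walk w a : hex_valid a -> hex_valid (walk hex_r a w).
Proof. by elim: w a => [|i w IHw] a //= Va; apply/IHw/hex_valid_r. Qed.

Lemma hex_valid_shift t a : hex_valid (hex_shift t a) = hex_valid a.
Proof. by case: a => [[v u] u']. Qed.

(** On components of unit vectors this and [neg_part2] are min(0, x) and min(0, x, y). The
    tessellation names a vertex or an edge by the componentwise minimum of its tile centres; a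
    vertex has kind [true] when this minimum is not one of the centres. *)
Definition neg_part (x : int) : int := if x is Negz _ then (-1)%R else 0%R.
Definition neg_part2 (x y : int) : int :=
  if x is Negz _ then (-1)%R else neg_part y.

Definition vertex_offset (u u' : hex_point) : hex_point :=
  (neg_part2 u.1 u'.1, neg_part2 u.2 u'.2).
Definition vertex_kind (u u' : hex_point) : bool :=
  vertex_offset u u' \notin [:: 0%R; u; u'].
Definition edge_offset (u : hex_point) : hex_point :=
  (neg_part u.1, neg_part u.2).
Definition edge_kind (u : hex_point) : 'I_3 :=
  if u.2 == 0%R then @Ordinal 3 0 isT
  else if u.1 == 0%R then @Ordinal 3 1 isT else @Ordinal 3 2 isT.

Definition hex_face (k : nat) (a : hex_flag) : hexagonal_tessellation :=
  let: (v, u, u') := a in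
  match k with
  | 0 => HexLeast
  | 1 => HexVertex (vertex_kind u u') (vertex_offset u u' + v)%R
  | 2 => HexEdge (edge_kind u) (edge_offset u + v)%R
  | 3 => HexTile v
  | _ => HexGreatest
  end.

Lemma hex_face_shift t k a :
  hex_face k (hex_shift t a) = hex_translate t (hex_face k a).
Proof. by case: a => [[v u] u']; case: k => [|[|[|[|k]]]] //=; rewrite addrA. Qed.

Lemma hex_flag0 v u u' : (v, u, u') = hex_shift v (0%R, u, u').
Proof. by rewrite /= add0r. Qed.

Lemma hex_r_shift i t a : hex_r i (hex_shift t a) = hex_shift t (hex_r i a).
Proof. exact: (walk_hex_shift t a [:: i]). Qed.

Lemma hex_face_fix i k a : hex_valid a -> i < 3 -> k < 5 -> k != i.+1 ->
  hex_face k (hex_r i a) = hex_face k a.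
Proof.
case: a => [[v u] u'] Va; rewrite hex_flag0 hex_r_shift !hex_face_shift.
have := @hex_units_all (fun q => all (fun i => all (fun k => (k != i.+1) ==>
    (hex_face k (hex_r i (0%R, q.1, q.2)) == hex_face k (0%R, q.1, q.2))) (iota 0 5))
    (iota 0 3))
  ltac:(by vm_compute) v u u' Va.
move=> /allP h lt_i lt_k ki; congr hex_translate; apply/eqP.
have /allP/(_ k) := h i ltac:(by rewrite mem_iota).
by rewrite mem_iota => /(_ lt_k)/implyP/(_ ki).
Qed.

Lemma hex_face_mono k l a : hex_valid a -> k <= l -> l < 5 ->
  (hex_face k a <= hex_face l a)%O.
Proof.
case: a => [[v u] u'] Va kl lt_l; rewrite hex_flag0 !hex_face_shift.
apply: hex_translate_le.
have := @hex_units_all (fun q => all (fun k => all (fun l => (k <= l) ==>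
    hex_le (hex_face k (0%R, q.1, q.2)) (hex_face l (0%R, q.1, q.2))) (iota 0 5))
    (iota 0 5))
  ltac:(by vm_compute) v u u' Va.
move=> /allP h; have /allP/(_ l) := h k ltac:(rewrite mem_iota; lia).
by rewrite mem_iota => /(_ lt_l)/implyP/(_ kl).
Qed.

Lemma hex_level_face k a : k < 5 -> hex_level (hex_face k a) = k.
Proof. by case: a => [[v u] u']; case: k => [|[|[|[|[|k]]]]]. Qed.

Lemma hex_level_translate t F : hex_level (hex_translate t F) = hex_level F.
Proof. by case: F. Qed.

(** Alternating words of length 0 to 11 run through a dihedral group of order 12, enough to go
    around a hexagon. *)
Definition hex_words (i j : nat) : seq (seq nat) :=
  [seq take k (flatten (nseq 6 [:: i; j])) | k <- iota 0 12].

(* The words alternating between the two letters other than [k.-1]. *)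
Definition face_words (k : nat) : seq (seq nat) :=
  if k == 1 then hex_words 1 2 else if k == 2 then
   [:: [::]; [:: 0]; [:: 2]; [:: 0; 2]] else hex_words 0 1.

Definition hex_base : hex_flag := (0, (1, 0), (0, 1))%R.

(** A chosen flag through each proper face: flags sharing a face are connected by joining both to
    it, and its compatibility with translations makes this a finite check. *)
Definition hex_canonical (F : hexagonal_tessellation) : hex_flag :=
  match F with
  | HexVertex false v => hex_shift v (0, (1, 0), (0, 1))%R
  | HexVertex true v => hex_shift v ((1, 0), (-1, 1), (0, 1))%R
  | HexEdge k v => hex_shift v (nth hex_base
      [:: (0, (1, 0), (0, 1)); (0, (0, 1), (1, 0)); ((1, 0), (-1, 1), (0, 1))] k)%R
  | HexTile v => hex_shift v hex_base
  | _ => hex_base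
  end.

Lemma hex_canonical_shift t F : hex_level F \in [:: 1; 2; 3] ->
  hex_canonical (hex_translate t F) = hex_shift t (hex_canonical F).
Proof. by case: F => [|[] v|k v|v|] // _; rewrite /hex_translate /hex_canonical hex_shiftD. Qed.

Lemma hex_canonicalP F : hex_valid (hex_canonical F) /\
  hex_face (hex_level F) (hex_canonical F) = F.
Proof.
pose Pr F := hex_valid (hex_canonical F) && (hex_face (hex_level F) (hex_canonical F) == F).
suff : Pr F by case/andP=> -> /eqP.
have shift v F0 : hex_level F0 \in [:: 1; 2; 3] -> Pr F0 -> Pr (hex_translate v F0).
  move=> lev /andP[VF /eqP eF]; rewrite /Pr hex_canonical_shift // hex_valid_shift VF.
  by rewrite hex_level_translate hex_face_shift eF eqxx.
have I3 (k : 'I_3) : k \in [:: @Ordinal 3 0 isT; @Ordinal 3 1 isT; @Ordinal 3 2 isT].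
  by rewrite !inE -!val_eqE /=; have := ltn_ord k; lia.
case: F => [|s v|k v|v|] //.
- have -> : HexVertex s v = hex_translate v (HexVertex s 0%R) by rewrite /= add0r.
  by apply: shift => //; case: s; vm_compute.
- have -> : HexEdge k v = hex_translate v (HexEdge k 0%R) by rewrite /= add0r.
  apply: shift => //; have := I3 k; rewrite !inE => /or3P[]/eqP->; by vm_compute.
- have -> : HexTile v = hex_translate v (HexTile 0%R) by rewrite /= add0r.
  by apply: shift => //; vm_compute.
Qed.

Lemma face_words_ok k : k \in [:: 1; 2; 3] ->
  all (all (fun i => (i < 3) && (i.+1 != k))) (face_words k).
Proof. by rewrite !inE => /or3P[]/eqP->. Qed.

Lemma hex_canonical_conn k a : hex_valid a -> k \in [:: 1; 2; 3] ->
  exists2 w, w \in face_words k & walk hex_r a w = hex_canonical (hex_face k a).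
Proof.
case: a => [[v u] u'] Va Rk.
have lev : hex_level (hex_face k (0%R, u, u')) \in [:: 1; 2; 3].
  by rewrite hex_level_face //; move: Rk; rewrite !inE; lia.
rewrite hex_flag0 hex_face_shift hex_canonical_shift //.
have := @hex_units_all (fun q => all (fun k => has (fun w => walk hex_r (0%R, q.1, q.2) w ==
   hex_canonical (hex_face k (0%R, q.1, q.2))) (face_words k)) [:: 1; 2; 3])
  ltac:(by vm_compute) v u u' Va.
move/allP/(_ k Rk)/hasP=> [w Ww /eqP e]; exists w => //.
by rewrite walk_hex_shift e.
Qed.

(** The half-turn about an edge (letters 2, 0) combined with the half-turn about a tile (three times
    1, 0) is a translation, by the vector [u] of the flag. Conjugating by letter 1 replaces [u] by
    [u']. *)
Definition hex_T1 : seq nat := [:: 2; 0; 1; 0; 1; 0; 1; 0].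
Definition hex_T2 : seq nat := 1 :: hex_T1 ++ [:: 1].

Lemma walk_hex_T1 v u u' : walk hex_r (v, u, u') hex_T1 = (v + u, u, u')%R.
Proof.
rewrite /hex_T1 /=; congr (_, _, _); apply/eqP; rewrite -subr_eq0;
  rewrite !(opprD, opprK, opprB) !addrA;
  by case: u u' => [x y] [x' y']; apply/eqP; congr (_, _); rewrite /=; lia.
Qed.

Lemma walk_hex_T2 v u u' : walk hex_r (v, u, u') hex_T2 = (v + u', u, u')%R.
Proof. have -> : walk hex_r (v, u, u') hex_T2 = walk hex_r (v, u', u) (hex_T1 ++ [:: 1]) by [].
by rewrite walk_cat walk_hex_T1. Qed.

Definition hex_trans (n1 n2 : nat) : seq nat :=
  flatten (nseq n1 hex_T1) ++ flatten (nseq n2 hex_T2).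

Lemma walk_hex_trans n1 n2 v u u' :
  walk hex_r (v, u, u') (hex_trans n1 n2) = (v + u *+ n1 + u' *+ n2, u, u')%R.
Proof.
rewrite /hex_trans walk_cat.
have -> n x : walk hex_r (x, u, u') (flatten (nseq n hex_T1)) = (x + u *+ n, u, u')%R.
  elim: n x => [|n IHn] x; first by rewrite /= mulr0n addr0.
  have -> : flatten (nseq n.+1 hex_T1) = hex_T1 ++ flatten (nseq n hex_T1) by [].
  rewrite walk_cat walk_hex_T1 IHn.
  by rewrite -addrA -mulrS.
elim: n2 (v + _)%R => [|n IHn] v'; first by rewrite /= mulr0n addr0.
have -> : flatten (nseq n.+1 hex_T2) = hex_T2 ++ flatten (nseq n hex_T2) by [].
by rewrite walk_cat walk_hex_T2 IHn -addrA -mulrS.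
Qed.

Lemma hex_trans_letters n1 n2 : all (letter_range 0 3) (hex_trans n1 n2).
Proof.
rewrite /hex_trans all_cat; apply/andP; split.
  by elim: n1 => //= n IHn.
by elim: n2 => //= n IHn.
Qed.

(** [hex_trans] gives only non-negative multiples, so [t] is written as a difference and both flags
    are joined to a common further translate. *)
Lemma hex_shift_conn v t : conn hex_r (letter_range 0 3)
  (hex_shift v hex_base) (hex_shift t (hex_shift v hex_base)).
Proof.
have inv i : letter_range 0 3 i -> involutive (hex_r i) by move=> _; apply: hex_rK.
have fwd n1 n2 s : conn hex_r (letter_range 0 3) (hex_shift s hex_base)
    (hex_shift (s + (n1%:Z, n2%:Z))%R hex_base).
  exists (hex_trans n1 n2); first exact: hex_trans_letters.
  rewrite /= walk_hex_trans !add0r -!addrA; congr (s + _, _, _)%R.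
  by rewrite !pairMnE; congr (_, _); rewrite /= mul0rn ?addr0 ?add0r natz.
rewrite hex_shiftD; case: t => t1 t2.
have [n1 [m1 e1]] : exists n m : nat, t1 = (n%:Z - m%:Z)%R.
  by case: t1 => k; [exists k, 0; lia | exists 0, k.+1; lia].
have [n2 [m2 e2]] : exists n m : nat, t2 = (n%:Z - m%:Z)%R.
  by case: t2 => k; [exists k, 0; lia | exists 0, k.+1; lia].
apply: conn_trans (fwd n1 n2 v) _; apply: conn_sym => //.
have -> : (v + (n1%:Z, n2%:Z) = v + (t1, t2) + (m1%:Z, m2%:Z))%R.
  by rewrite -addrA; congr (_ + _)%R; congr (_, _); rewrite /= ?e1 ?e2; lia.
exact: fwd.
Qed.

Lemma hex_conn a b : hex_valid a -> hex_valid b -> conn hex_r (letter_range 0 3) a b.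
Proof.
have inv i : letter_range 0 3 i -> involutive (hex_r i) by move=> _; apply: hex_rK.
have can c : hex_valid c -> conn hex_r (letter_range 0 3) c (hex_shift c.1.1 hex_base).
  move=> Vc; have [w Ww e] := @hex_canonical_conn 3 c Vc isT.
  exists w; last by rewrite e; case: c {Vc e} => [[]].
  by have /allP/(_ w Ww) := face_words_ok (isT : 3 \in [:: 1; 2; 3]);
    apply: sub_all => i /andP[].
move=> /can ca /can cb; apply: conn_trans ca _; apply: conn_trans (conn_sym inv cb).
have := @hex_shift_conn a.1.1 (b.1.1 - a.1.1)%R.
by rewrite hex_shiftD addrC subrK.
Qed.

Lemma hex_face_conn k a b : hex_valid a -> hex_valid b -> k < 5 ->
  hex_face k a = hex_face k b ->
  conn hex_r [pred i | letter_range 0 3 i & i.+1 != k] a b.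
Proof.
move=> Va Vb lt_k e; have [Rk|nRk] := boolP (k \in [:: 1; 2; 3]); last first.
  apply: sub_conn (hex_conn Va Vb) => i /=; rewrite /letter_range !inE in nRk *; lia.
have inv i : [pred i | letter_range 0 3 i & i.+1 != k] i -> involutive (hex_r i).
  by move=> _; apply: hex_rK.
have can c : hex_valid c -> conn hex_r [pred i | letter_range 0 3 i & i.+1 != k]
    c (hex_canonical (hex_face k c)).
  move=> Vc; have [w Ww e'] := hex_canonical_conn Vc Rk; exists w => //.
  by have /allP/(_ w Ww) := face_words_ok Rk.
by apply: conn_trans (can a Va) _; rewrite e; apply: conn_sym (can b Vb).
Qed.

(** The tiles of the larger face are among those of the smaller one, which leaves finitely many
    candidates once the centre of [a] is moved to 0; turning around the smaller face reaches each of
    them. *)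
Lemma hex_le_flag k l a b : hex_valid a -> hex_valid b -> k < 5 -> l < 5 ->
  (hex_face k a <= hex_face l b)%O -> k <= l /\ exists z,
  [/\ hex_valid z, hex_face k z = hex_face k a & hex_face l z = hex_face l b].
Proof.
move=> Va Vb lt_k lt_l le_ab.
have [e|] := hex_le_level le_ab.
  have ekl : k = l by rewrite -(hex_level_face a lt_k) e hex_level_face.
  by subst l; split=> //; exists a.
rewrite !hex_level_face // => kl; split; first exact: ltnW.
have [k0|k_gt0] := posnP k.
  by exists b; split=> //; rewrite k0; case: (a) (b) => [[? ?] ?] [[? ?] ?].
have [l4|l_ne4] := eqVneq l 4.
  by exists a; split=> //; rewrite l4; case: (a) (b) => [[? ?] ?] [[? ?] ?].
have Rk : k \in [:: 1; 2] by rewrite !inE; lia.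
have Rl : l \in [:: 2; 3] by rewrite !inE; lia.
suff [w Ww ew] : exists2 w, w \in face_words k
    & hex_face l (walk hex_r a w) = hex_face l b.
  exists (walk hex_r a w); split=> //; first exact: hex_valid_walk.
  have Rk' : k \in [:: 1; 2; 3] by move: Rk; rewrite !inE; lia.
  have /allP/(_ w Ww) := face_words_ok Rk'.
  elim: w a Va {ew Ww le_ab} => [|i w IHw] a Va //= /andP[/andP[i3 ik] Lw].
  by rewrite IHw ?hex_valid_r // hex_face_fix // eq_sym.
move: (hex_face l b) (hex_level_face b lt_l) le_ab => G levG.
case: a Va => [[v u] u'] Va; rewrite hex_flag0 hex_face_shift => le_FG.
have {}le_FG : (hex_face k (0%R, u, u') <= hex_translate (- v)%R G)%O.
  have := hex_translate_le (- v)%R le_FG.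
  suff -> : hex_translate (- v)%R (hex_translate v (hex_face k (0%R, u, u'))) =
    hex_face k (0%R, u, u') by [].
  by case: (hex_face _ _) => *; rewrite /= ?addrK.
suff [w Ww ew] : exists2 w, w \in face_words k
    & hex_face l (walk hex_r (0%R, u, u') w) = hex_translate (- v)%R G.
  exists w => //; rewrite walk_hex_shift hex_face_shift ew.
  by case: (G) => *; rewrite /= ?addrNK.
have {levG} : hex_level (hex_translate (- v)%R G) = l by rewrite hex_level_translate.
move: (hex_translate _ _) le_FG => {}G le_FG levG.
(* Candidate edges are recovered from their first tile; for the third direction this is
   [(x + 1, y)], whence the subtraction of [(1, 0)]. *)
have := @hex_units_all (fun q => let a := (0%R, q.1, q.2) in
   all (fun k => all (fun t => has (fun w => hex_face 3 (walk hex_r a w) == HexTile t)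
      (face_words k)) (hex_tiles (hex_face k a))) [:: 1; 2] &&
   all (fun j => all (fun t : hex_point =>
     let F := HexEdge j (t - (if j == @Ordinal 3 2 isT then (1, 0) else 0))%R in
      hex_le (hex_face 1 a) F ==> has (fun w => hex_face 2 (walk hex_r a w) == F)
      (face_words 1)) (hex_tiles (hex_face 1 a)))
      [:: @Ordinal 3 0 isT; @Ordinal 3 1 isT; @Ordinal 3 2 isT])
  ltac:(by vm_compute) v u u' Va.
case/andP=> /allP h3 /allP h2.
have hexleE F' G' : hex_level F' \in [:: 1; 2] -> (F' <= G')%O ->
    all [in hex_tiles F'] (hex_tiles G').
  by case: F' => [|s v'|j v'|v'|] //; case: G' => [|s'' v''|j'' v''|v''|].
have levF : hex_level (hex_face k (0%R, u, u')) \in [:: 1; 2] by rewrite hex_level_face.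
have tilesG := hexleE _ _ levF le_FG.
move: Rl; rewrite !inE => /orP[]/eqP el; rewrite el in levG *.
  have k1 : k = 1 by lia.
  rewrite {}k1 in le_FG tilesG h3 *.
  case: G le_FG levG tilesG => [|//|j [x y]|//|//] // le_FG _ tilesG.
  have j3 : j \in [:: @Ordinal 3 0 isT; @Ordinal 3 1 isT; @Ordinal 3 2 isT].
    by rewrite !inE -!val_eqE /=; have := ltn_ord j; lia.
  have /allP := h2 j j3.
  have [t et tF] : exists2 t : hex_point,
      (t - (if j == @Ordinal 3 2 isT then (1, 0) else 0) = (x, y))%R
      & t \in hex_tiles (hex_face 1 (0%R, u, u')).
    have /allP h := tilesG; move: j3; rewrite !inE => /or3P[]/eqP ej.
    - by exists (x, y); [rewrite ej /= subr0 | apply: h; rewrite ej /= inE eqxx].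
    - by exists (x, y); [rewrite ej /= subr0 | apply: h; rewrite ej /= inE eqxx].
    - exists (x + 1, y)%R; first by rewrite ej /=; congr (_, _); rewrite /= ?addrK ?subr0.
      by apply: h; rewrite ej /= inE eqxx.
  move/(_ t tF); cbv zeta; rewrite et => /implyP/(_ le_FG)/hasP[w Ww /eqP ew].
  by exists w.
case: G le_FG levG tilesG => [|//|//|[x y]|] // le_FG _ /=; rewrite andbT => tF.
have /allP/(_ _ tF)/hasP[w Ww /eqP ew] := h3 k Rk.
by exists w.
Qed.

Section TorusPresented.
Variables b c : nat.
Local Notation T := (hexagonal_torus b c).
Local Open Scope quotient_scope.

Lemma torus_latticeD s t : torus_lattice b c s -> torus_lattice b c t ->
  torus_lattice b c (s + t)%R.
Proof.
move=> [k [l ->]] [k' [l' ->]]; exists (k + k')%R, (l + l')%R.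
by rewrite !mulrzDr addrACA.
Qed.

Lemma torus_latticeN s : torus_lattice b c s -> torus_lattice b c (- s)%R.
Proof. by move=> [k [l ->]]; exists (- k)%R, (- l)%R; rewrite !mulrNz opprD. Qed.

Lemma torus_piP F G : \pi_T F = \pi_T G <->
  exists2 t, torus_lattice b c t & G = hex_translate t F.
Proof. by split=> [/eqmodP/asboolP|h]; [|apply/eqmodP/asboolP]. Qed.

Lemma torus_leP (x y : T) : (x <= y)%O <->
  exists F G, [/\ x = \pi_T F, y = \pi_T G & (F <= G)%O].
Proof. by split=> [/asboolP|h]; [|apply/asboolP]. Qed.

Definition torus_stab (w : seq nat) : Prop := exists2 t, torus_lattice b c t
  & walk hex_r hex_base w = hex_shift t hex_base.

(** [hexagonal_torus] carries no finite type, so [flagged] does not apply. Incidence is read in the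
    tessellation after translations [t] and [t'] of representatives, and only their difference
    enters the word. *)
Lemma torus_presented : presented 0 3
  (fun k w => \pi_T (hex_face k (walk hex_r hex_base w))) torus_stab.
Proof.
have V0 : hex_valid hex_base by [].
have inv i : letter_range 0 3 i -> involutive (hex_r i) by move=> _; apply: hex_rK.
have Lsub m u : all [pred i | letter_range 0 3 i & i.+1 != m] u ->
      all (letter_range 0 3) u by apply: sub_all => i /andP[].
have fixw m u a : m < 5 -> hex_valid a -> all [pred i | letter_range 0 3 i & i.+1 != m] u ->
    hex_face m (walk hex_r a u) = hex_face m a.
  move=> lt_m; elim: u a => [|i u IHu] a Va //= /andP[/andP[Li im] Lu].
  by rewrite IHu ?hex_valid_r // hex_face_fix // eq_sym.
split=> [x|k l w w' Rk Rl Lw Lw'].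
  have [VF eF] := hex_canonicalP (repr x).
  have [w Lw ew] := hex_conn V0 VF.
  exists (hex_level (repr x)), w; split=> //; first by case: (repr x).
  by rewrite -ew eF reprK.
have Vw := hex_valid_walk w V0; have Vw' := hex_valid_walk w' V0.
set a := walk _ _ w in Vw *; set a' := walk _ _ w' in Vw' *.
split=> [/torus_leP[F [G [/torus_piP[t lt ->] /torus_piP[t' lt' ->]]]]|].
  rewrite -!hex_face_shift => /hex_le_flag[]; rewrite ?hex_valid_shift // => kl.
  case=> z [Vz ek el]; split=> //.
  have [||||u Lu eu] := @hex_face_conn k (hex_shift t a) z; rewrite ?hex_valid_shift //.
  have [||||u' Lu' eu'] := @hex_face_conn l (hex_shift t' a') z; rewrite ?hex_valid_shift //.
  exists u, u'; split=> //.
  exists (t' - t)%R; first exact: torus_latticeD lt' (torus_latticeN lt).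
  have e : walk hex_r a u = hex_shift (t' - t)%R (walk hex_r a' u').
    have : hex_shift t (walk hex_r a u) = hex_shift t' (walk hex_r a' u').
      by rewrite -(walk_hex_shift t a) -(walk_hex_shift t' a') -eu.
    by move/(congr1 (hex_shift (- t)%R)); rewrite !hex_shiftD subrr hex_shift0.
  rewrite (walk_cat hex_r hex_base w) -/a (walk_cat hex_r a u) e walk_hex_shift.
  congr hex_shift; rewrite walk_cat (walkK inv) ?(Lsub l) //.
  exact: walkK inv _ _ Lw'.
case=> kl [u [u' [Lu Lu' [s ls e]]]].
have {}e : walk hex_r a u = hex_shift s (walk hex_r a' u').
  have L' : all (letter_range 0 3) (rev u' ++ rev w').
    by rewrite all_cat !all_rev Lw' (Lsub _ _ Lu').
  apply: (walk_inj inv L'); rewrite walk_hex_shift -!walk_cat -?catA e.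
  rewrite catA -rev_cat walk_cat (walkK inv) //.
  by rewrite all_cat Lw' (Lsub _ _ Lu').
apply/torus_leP; exists (hex_face k (walk hex_r a u)), (hex_face l (walk hex_r a u)).
split; last by apply: hex_face_mono; rewrite // hex_valid_walk.
  by rewrite fixw.
by rewrite e hex_face_shift fixw //; apply/torus_piP; exists s.
Qed.

End TorusPresented.

(** * The groups SL2 and L2 *)

(** With tau_i = rho_0 rho_i, the pair of g and a parity stands for the image under g of the base
    flag or of its 0-neighbour, and this is the action of letter i. Only products of two reflections
    occur, so the formula makes sense in a rotation group. *)
Definition grp_r (gT : finGroupType) (tau : nat -> gT) (i : nat) (x : gT * bool) :
    gT * bool :=
  ((if x.2 then (tau i)^-1 * x.1 else tau i * x.1)%g, ~~ x.2).

Section M2.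
Variable F : comUnitRingType.
Local Open Scope ring_scope.

Definition M2 (a b c d : F) : 'M[F]_2 :=
  \matrix_(i, j) if i == 0 then (if j == 0 then a else b)
                 else (if j == 0 then c else d).

Let I2 (i : 'I_2) : i = 0 \/ i = 1.
Proof. by case: i => [[|[|//]] lt_i]; [left | right]; apply: val_inj. Qed.

Lemma M2_eta (M : 'M[F]_2) : M = M2 (M 0 0) (M 0 1) (M 1 0) (M 1 1).
Proof. by apply/matrixP=> i j; rewrite mxE; case: (I2 i) (I2 j) => -> [] ->. Qed.

Lemma M2_mul a b c d a' b' c' d' : M2 a b c d *m M2 a' b' c' d' =
  M2 (a * a' + b * c') (a * b' + b * d') (c * a' + d * c') (c * b' + d * d').
Proof.
apply/matrixP=> i j; rewrite !mxE big_ord_recl big_ord1 !mxE /=.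
by case: (i == 0); case: (j == 0).
Qed.

Lemma M2_det a b c d : \det (M2 a b c d) = a * d - b * c.
Proof.
rewrite (expand_det_row _ 0) big_ord_recl big_ord1 /cofactor !det_mx11 !mxE /=.
by rewrite expr0 expr1 mul1r mulN1r mulrN.
Qed.

Lemma M2_inj a b c d a' b' c' d' : M2 a b c d = M2 a' b' c' d' ->
  [/\ a = a', b = b', c = c' & d = d'].
Proof.
move/matrixP=> e; have := (e 0 0, e 0 1, e 1 0, e 1 1).
by rewrite !mxE /= => -[[[-> ->] ->] ->].
Qed.

Lemma M2_1 : M2 1 0 0 1 = 1%:M.
Proof. by apply/matrixP=> i j; rewrite !mxE; case: (I2 i) (I2 j) => -> [] ->. Qed.

End M2.

Section SL2Theory.
Variable F : finFieldType.
Local Open Scope ring_scope.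
Implicit Types a b c d e x y : F.

(* Stated over an abstract field, since computing in ['F_p] is prohibitive. *)
Definition SLF : {set {'GL_2[F]}} := [set g : {'GL_2[F]} | \det (GLval g) == 1].

Fact SLF_group_set : group_set SLF.
Proof.
apply/group_setP; split=> [|g h]; first by rewrite inE det1.
by rewrite !inE GL_MxE det_mulmx => /eqP-> /eqP->; rewrite mulr1.
Qed.

Canonical SLF_group := Group SLF_group_set.

Definition sl2mx a b c d : {'GL_2[F]} := insubd (1%g : {'GL_2[F]}) (M2 a b c d).

Arguments sl2mx (a b c d)%_R.

Lemma GLval_inj (g h : {'GL_2[F]}) : GLval g = GLval h -> g = h.
Proof. exact: val_inj. Qed.

Lemma val_S2 a b c d : a * d - b * c = 1 -> GLval (sl2mx a b c d) = M2 a b c d.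
Proof.
move=> e; have uM : M2 a b c d \is a GRing.unit.
  by rewrite [_ \is a GRing.unit]unitmxE M2_det e unitr1.
by rewrite /GLval /sl2mx /insubd insubT.
Qed.

Lemma S2_in a b c d : a * d - b * c = 1 -> sl2mx a b c d \in SLF.
Proof. by move=> e; rewrite inE val_S2 // M2_det e. Qed.

Lemma S2_mul a b c d a' b' c' d' : a * d - b * c = 1 -> a' * d' - b' * c' = 1 ->
  (sl2mx a b c d * sl2mx a' b' c' d')%g =
  sl2mx (a * a' + b * c') (a * b' + b * d') (c * a' + d * c') (c * b' + d * d').
Proof.
move=> e e'; apply: GLval_inj; rewrite GL_MxE !val_S2 // ?M2_mul //.
rewrite -[RHS](mulr1 1) -{1}e -e'; ring.
Qed.

Lemma S2_1 : sl2mx 1 0 0 1 = 1%g.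
Proof. by apply: GLval_inj; rewrite val_S2 ?M2_1 // mulr1 mulr0 subr0. Qed.

Lemma S2_inj a b c d a' b' c' d' : a * d - b * c = 1 -> a' * d' - b' * c' = 1 ->
  sl2mx a b c d = sl2mx a' b' c' d' -> [/\ a = a', b = b', c = c' & d = d'].
Proof. by move=> e e' /(congr1 (@GLval _ _)); rewrite !val_S2 // => /M2_inj. Qed.

Lemma S2P g : g \in SLF -> exists a b c d, a * d - b * c = 1 /\ g = sl2mx a b c d.
Proof.
rewrite inE (M2_eta (GLval g)) M2_det; set a := GLval g 0 0; set b := GLval g 0 1.
set c := GLval g 1 0; set d := GLval g 1 1 => /eqP e.
exists a, b, c, d; split=> //; apply: GLval_inj.
by rewrite val_S2 //; apply: M2_eta.
Qed.

Definition detm (g : {'GL_2[F]}) : {unit F} := insubd (1%g : {unit F}) (\det (GLval g)).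

Lemma val_detm g : val (detm g) = \det (GLval g).
Proof.
have u : \det (GLval g) \is a GRing.unit by rewrite unitfE GL_det.
by rewrite /detm /insubd insubT.
Qed.

Fact detm_morph : {in [set: {'GL_2[F]}] &, {morph detm : g h / (g * h)%g}}.
Proof.
move=> g h _ _; apply: val_inj.
by rewrite val_detm GL_MxE det_mulmx /= -!val_detm.
Qed.

Canonical detm_morphism := Morphism detm_morph.

Lemma card_SL2 : #|SLF| = (#|F| * (#|F| ^ 2 - 1))%N.
Proof.
have p_gt1 := finRing_gt1 F.
have kerE : ('ker detm_morphism)%g = SLF.
  apply/setP=> g; rewrite !inE /= -(inj_eq val_inj) /= val_detm.
  by [].
have imE : (detm_morphism @* [set: {'GL_2[F]}])%g = [set: {unit F}].
  apply/setP=> u; rewrite [RHS]inE; apply/morphimP.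
  have uM : M2 (val u) 0 0 1 \is a GRing.unit.
    by rewrite [_ \is a _]unitmxE M2_det mulr1 mulr0 subr0 (valP u).
  exists (Sub (M2 (val u) 0 0 1) uM : {'GL_2[F]}); rewrite ?inE //.
  by apply: val_inj; rewrite val_detm /= M2_det mulr1 mulr0 subr0.
have := card_morphim detm_morphism [set: {'GL_2[F]}]%G.
rewrite imE card_finField_unit setIid kerE => e.
have := Lagrange (subsetT (SLF)); rewrite -e card_GL_2; set p := #|F| in p_gt1 *.
have -> : (p * p.-1 ^ 2 * p.+1 = (p * (p ^ 2 - 1)) * p.-1)%N.
  by case: (p) p_gt1 => // k _; rewrite /= !expnS !expn0; nia.
by move/eqP; rewrite eqn_pmul2r; [move/eqP | rewrite -ltnS (ltn_predK p_gt1)].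
Qed.

(** With 4k + 1 elements, the polynomial X^(2k) - 1 cannot vanish at all 4k non-zero ones; where it
    does not, x^(2k) = -1. *)
Lemma exists_sqrt_neg1 : (#|F| %% 4 = 1)%N -> exists i : F, i ^+ 2 = -1.
Proof.
move=> p4; have p_gt1 := finRing_gt1 F; set p := #|F| in p4 p_gt1 *; pose k := (p %/ 4)%N.
have ep : p = (k * 4 + 1)%N by rewrite {1}(divn_eq p 4) p4.
have k_gt0 : (0 < k)%N by move: p_gt1; rewrite ep; case: (k).
have [/forallP all1|] := boolP [forall x : F, (x != 0) ==> (x ^+ (k * 2) == 1)].
  pose P : {poly F} := 'X^(k * 2) - 1.
  have P0 : P != 0 by rewrite -size_poly_eq0 size_XnsubC ?muln_gt0 ?k_gt0.
  have := @max_poly_roots _ P (enum [pred x : F | x != 0]) P0.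
  rewrite enum_uniq size_XnsubC ?muln_gt0 ?k_gt0 // -cardE => /(_ _ isT).
  rewrite [#|_|](_ : _ = p.-1); last first.
    by rewrite -(cardC1 (0 : F)); apply: eq_card.
  move=> h; exfalso; move: h; rewrite ep => h.
  suff /h : all (root P) (enum [pred x : F | x != 0]) by lia.
  apply/allP=> x; rewrite mem_enum inE => x0; have /implyP/(_ x0)/eqP e := all1 x.
  by rewrite /root /P !(hornerE, hornerXn) e subrr.
rewrite negb_forall => /existsP[x]; rewrite negb_imply => /andP[x0 nx1].
exists (x ^+ k); rewrite -exprM.
have : (x ^+ (k * 2) - 1) * (x ^+ (k * 2) + 1) = 0.
  have -> : (x ^+ (k * 2) - 1) * (x ^+ (k * 2) + 1) = x ^+ (k * 4) - 1.
    by rewrite -subr_sqr -exprM -mulnA expr1n.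
  apply/eqP; rewrite subr_eq0; apply/eqP.
  have := expf_card x; rewrite -/p {1}ep exprD expr1 => e.
  by apply: (mulIf x0); rewrite e mul1r.
by move/eqP; rewrite mulf_eq0 subr_eq0 (negPf nx1) addr_eq0 => /eqP.
Qed.

End SL2Theory.

(* The group SL2(F) through its coordinates; keeping the group type abstract
   prevents unification from unfolding matrix groups. *)
Section Coordinates.
Variables (F : finFieldType) (gT : finGroupType) (G : {group gT}).
Variable S2 : F -> F -> F -> F -> gT.
Local Open Scope ring_scope.
Implicit Types a b c d e x y : F.

Hypothesis S2_in : forall a b c d, a * d - b * c = 1 -> S2 a b c d \in G.
Hypothesis S2_mul : forall a b c d a' b' c' d',
  a * d - b * c = 1 -> a' * d' - b' * c' = 1 -> (S2 a b c d * S2 a' b' c' d')%g =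
  S2 (a * a' + b * c') (a * b' + b * d') (c * a' + d * c') (c * b' + d * d').
Hypothesis S2_1 : S2 1 0 0 1 = 1%g.
Hypothesis S2_inj : forall a b c d a' b' c' d',
  a * d - b * c = 1 -> a' * d' - b' * c' = 1 ->
  S2 a b c d = S2 a' b' c' d' -> [/\ a = a', b = b', c = c' & d = d'].
Hypothesis S2P : forall g, g \in G ->
  exists a b c d, a * d - b * c = 1 /\ g = S2 a b c d.

Lemma S2_inv a b c d : a * d - b * c = 1 -> ((S2 a b c d)^-1)%g = S2 d (- b) (- c) a.
Proof.
move=> e; apply/eqP; rewrite eq_invg_mul S2_mul //; last by rewrite -[RHS]e; ring.
apply/eqP; rewrite -S2_1; congr S2; rewrite -?e; ring.
Qed.

Definition upper x := S2 1 x 0 1.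
Definition lower x := S2 1 0 x 1.
Arguments upper x%_R.
Arguments lower x%_R.

Let det_upper x : 1 * 1 - x * 0 = 1 :> F. Proof. by ring. Qed.
Let det_lower x : 1 * 1 - 0 * x = 1 :> F. Proof. by ring. Qed.

Lemma upper_lower_gen (K : {group gT}) :
  (forall x, upper x \in K) -> (forall x, lower x \in K) -> G \subset K.
Proof.
move=> U L; have main a b c d : a * d - b * c = 1 -> c != 0 -> S2 a b c d \in K.
  move=> e c0; have -> : S2 a b c d = (upper ((a - 1) / c) * lower c * upper ((d - 1) / c))%g.
    rewrite /upper /lower !S2_mul ?det_upper ?det_lower //; last by field.
    congr S2; try by field.
    have -> : b = (a * d - 1) / c by rewrite -e; field.
    by field.
  by rewrite !groupM.
apply/subsetP=> g /S2P[a [b [c [d [e ->]]]]].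
have [c0|c0] := eqVneq c 0; last exact: main.
have d0 : d != 0.
  by apply: contra_eq_neq e => ->; rewrite c0 !mulr0 subr0 eq_sym oner_neq0.
rewrite -(groupMr _ (L 1)) S2_mul ?det_lower //; apply: main; last by rewrite c0 mul0r add0r mulr1.
by rewrite -[RHS]e; ring.
Qed.

(** Multiplying by upper unipotents makes the given element antidiagonal, and it then conjugates
    upper unipotents into lower ones. *)
Lemma upper_gen (K : {group gT}) a b c d : a * d - b * c = 1 -> c != 0 ->
  (forall x, upper x \in K) -> S2 a b c d \in K -> G \subset K.
Proof.
move=> e c0 U gK; apply: upper_lower_gen => // y.
have wK : S2 0 (- c^-1) c 0 \in K.
  have -> : S2 0 (- c^-1) c 0 = (upper (- a / c) * S2 a b c d * upper (- d / c))%g.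
    rewrite /upper !S2_mul ?det_upper //; last by rewrite -[RHS]e; field.
    congr S2; try by field.
    have -> : b = (a * d - 1) / c by rewrite -e; field.
    by field.
  by rewrite !groupM.
have dw : 0 * 0 - (- c^-1) * c = 1 by field.
have -> : lower y = (S2 0 (- c^-1) c 0 * upper (- y / c ^+ 2) * (S2 0 (- c^-1) c 0)^-1)%g.
  rewrite S2_inv // /upper /lower !S2_mul ?det_upper //; try by field.
  by congr S2; field.
by rewrite groupM ?groupV // groupM.
Qed.

Lemma lower_gen (K : {group gT}) a b c d : a * d - b * c = 1 -> b != 0 ->
  (forall x, lower x \in K) -> S2 a b c d \in K -> G \subset K.
Proof.
move=> e b0 L gK; apply: upper_lower_gen => // y.
have wK : S2 0 b (- b^-1) 0 \in K.
  have -> : S2 0 b (- b^-1) 0 = (lower (- d / b) * S2 a b c d * lower (- a / b))%g.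
    rewrite /lower !S2_mul ?det_lower //; last by rewrite -[RHS]e; field.
    congr S2; try by field.
    have -> : c = (a * d - 1) / b by rewrite -e; field.
    by field.
  by rewrite !groupM.
have dw : 0 * 0 - b * (- b^-1) = 1 by field.
have -> : upper y = (S2 0 b (- b^-1) 0 * lower (- y / b ^+ 2) * (S2 0 b (- b^-1) 0)^-1)%g.
  rewrite S2_inv // /upper /lower !S2_mul ?det_lower //; try by field.
  by congr S2; field.
by rewrite groupM ?groupV // groupM.
Qed.

Lemma lowerX x n : (lower x ^+ n)%g = lower (x *+ n).
Proof.
elim: n => [|n IHn]; first by rewrite expg0 mulr0n /lower S2_1.
by rewrite expgS IHn /lower S2_mul ?det_lower //; congr S2; rewrite ?mulrS; ring.
Qed.

Lemma upperX x n : (upper x ^+ n)%g = upper (x *+ n).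
Proof.
elim: n => [|n IHn]; first by rewrite expg0 mulr0n /upper S2_1.
by rewrite expgS IHn /upper S2_mul ?det_upper //; congr S2; rewrite ?mulrS; ring.
Qed.

Hypothesis prime_field : forall x y, x != 0 -> exists n : nat, y = x *+ n.
Hypothesis two_neq0 : 2 != 0 :> F.
Hypothesis fifteen_neq0 : 15 != 0 :> F.

(** Conjugation produces an element of [N] with top-left entry 0; its commutator with a diagonal
    matrix is lower triangular, and a further commutator is a non-trivial lower unipotent, whose
    powers are all lower unipotents over a prime field. *)
Lemma SL2_normal_sub (N : {group gT}) a b c d :
  N \subset G -> G \subset 'N(N)%g -> a * d - b * c = 1 -> S2 a b c d \in N ->
  [|| b != 0, c != 0 | a != d] -> G \subset N.
Proof.
move=> sN nN e gN nc.
have conj h g : h \in G -> g \in N -> (h * g * h^-1)%g \in N.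
  move=> hS gN'; rewrite -[X in (X * _ * _)%g]invgK -mulgA -conjgE memJ_norm //.
  by rewrite groupV (subsetP nN).
have [a1 [b1 [c1 [d1 [e1 c10 gN1]]]]] : exists a b c d,
    [/\ a * d - b * c = 1, c != 0 & S2 a b c d \in N].
  have [c0|c0] := eqVneq c 0; last by exists a, b, c, d.
  have [b0|b0] := eqVneq b 0; last first.
    have dw : 0 * 0 - (-1) * 1 = 1 :> F by ring.
    exists d, (- c), (- b), a; split; [by rewrite -[RHS]e; ring | by rewrite oppr_eq0 |].
    have := conj _ _ (S2_in dw) gN; rewrite S2_inv // !S2_mul //;
      try first [by ring | by rewrite -[RHS]e; ring].
    by congr (S2 _ _ _ _ \in N); ring.
  have nad : a - d != 0 by rewrite subr_eq0; move: nc; rewrite b0 c0 eqxx.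
  exists a, 0, (a - d), d; split=> //; first by rewrite -[RHS]e b0 c0; ring.
  have := conj _ _ (S2_in (det_lower 1)) gN.
  rewrite S2_inv ?det_lower // !S2_mul ?det_lower //;
    try first [by ring | by rewrite -[RHS]e b0 c0; ring].
  by congr (S2 _ _ _ _ \in N); rewrite ?b0 ?c0; ring.
have [t gN2] : exists t, S2 0 (- c1^-1) c1 t \in N.
  exists (a1 + d1); have := conj _ _ (S2_in (det_upper (- a1 / c1))) gN1.
  rewrite S2_inv ?det_upper // !S2_mul ?det_upper //;
    try first [by field | by rewrite -[RHS]e1; field].
  congr (S2 _ _ _ _ \in N); try by field.
  have -> : b1 = (a1 * d1 - 1) / c1 by rewrite -e1; field.
  by field.
have det2 s : 0 * s - (- c1^-1) * c1 = 1 by field.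
(* For f = 2 the condition reads 2^4 - 1 = 15 non-zero, the origin of the hypothesis on 15. *)
have [f f0 f4] : exists2 f : F, f != 0 & 1 - f ^- 4 != 0.
  have h (g : F) : g != 0 -> 1 - g ^- 4 = (g ^+ 4 - 1) / g ^+ 4 by move=> g0; field.
  exists 2 => //; rewrite h // mulf_neq0 ?invr_eq0 ?expf_neq0 //.
  by have -> : 2 ^+ 4 - 1 = 15 :> F by ring.
pose q := c1 * t * (f ^- 2 - 1).
have gN3 : S2 (f ^+ 2) 0 q (f ^- 2) \in N.
  have dD : f * f^-1 - 0 * 0 = 1 :> F by field.
  have := groupM (conj _ _ (S2_in dD) gN2) (groupVr gN2).
  rewrite !S2_inv // !S2_mul //;
    try first [by field; rewrite ?f0 ?c10
      | by rewrite -[RHS](det2 t); field; rewrite ?f0 ?c10].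
  by congr (S2 _ _ _ _ \in N); rewrite /q; field; rewrite ?f0 ?c10.
have det3 : f ^+ 2 * f ^- 2 - 0 * q = 1 by field.
have gN4 : lower (1 - f ^- 4) \in N.
  have := groupM (conj _ _ (S2_in (det_lower 1)) gN3) (groupVr gN3).
  rewrite !S2_inv ?det_lower // /lower !S2_mul ?det_lower //;
    try first [by field | by rewrite -[RHS]det3; field].
  by congr (S2 _ _ _ _ \in N); field.
have L y : lower y \in N.
  by have [n ->] := prime_field y f4; rewrite -lowerX groupX.
by apply: lower_gen (det2 t) _ L gN2; rewrite oppr_eq0 invr_eq0.
Qed.

Definition LG := (G / 'Z(G))%G.

Definition negS2 : gT := S2 (-1) 0 0 (-1).

Let det_neg : (-1) * (-1) - 0 * 0 = 1 :> F. Proof. by ring. Qed.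

Lemma negS2_mul a b c d : a * d - b * c = 1 ->
  (negS2 * S2 a b c d)%g = S2 (- a) (- b) (- c) (- d).
Proof. by move=> e; rewrite S2_mul //; congr S2; ring. Qed.

Lemma center_SL2 : 'Z(G)%g = [set 1%g; negS2].
Proof.
apply/setP=> g; rewrite !inE; apply/andP/orP => [[gS /centP gC]|].
  have [a [b [c [d [e eg]]]]] := S2P gS.
  have := gC _ (S2_in (det_upper 1)); have := gC _ (S2_in (det_lower 1)).
  rewrite /commute eg !S2_mul ?det_upper ?det_lower //.
  case/S2_inj; try by rewrite -[RHS]e; ring.
  move=> eb _ _ _; case/S2_inj; try by rewrite -[RHS]e; ring.
  move=> ec ead _ _.
  have {}eb : b = 0.
    move: eb; rewrite !(mulr1, mulr0, mul1r, mul0r, addr0, add0r).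
    by move=> /(canRL (addKr a)); rewrite addNr.
  have {}ec : c = 0.
    move: ec; rewrite !(mulr1, mulr0, mul1r, mul0r, addr0, add0r).
    by move=> /esym/(canRL (addKr a)); rewrite addNr.
  have {}ead : a = d.
    move: ead; rewrite eb !(mulr1, mulr0, mul1r, mul0r, addr0, add0r); by [].
  have : (a - 1) * (a + 1) = 0.
    have -> : (a - 1) * (a + 1) = a * a - 1 by ring.
    by rewrite -e eb ec -ead; ring.
  move/eqP; rewrite mulf_eq0 subr_eq0 addr_eq0 eb ec -ead => /orP[]/eqP->.
    by left; rewrite S2_1.
  by right.
have cN h : h \in G -> commute negS2 h.
  move=> /S2P[a [b [c [d [e ->]]]]]; rewrite /commute !S2_mul //.
  by congr S2; ring.
case=> /eqP->; split; rewrite ?group1 ?S2_in //.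
by apply/centP=> h /cN.
Qed.

Lemma negS2_neq1 : negS2 != 1%g.
Proof.
apply/eqP; rewrite -S2_1 => /S2_inj[]; rewrite ?mulr1 ?mulr0 ?subr0 ?mulrNN ?mulr1 //.
by move/eqP; rewrite eq_sym -subr_eq0 opprK -[1 + 1]/(2%:R) (negPf two_neq0).
Qed.

Local Notation Z := 'Z(G)%g.
Definition cl (g : gT) : coset_of Z := coset Z g.

Lemma norm_SL2 g : g \in G -> g \in 'N(Z)%g.
Proof. by move=> gS; rewrite (subsetP _ _ gS) // normal_norm ?center_normal. Qed.

Lemma clM g h : g \in G -> h \in G -> (cl g * cl h)%g = cl (g * h).
Proof. by move=> gS hS; rewrite /cl morphM ?norm_SL2. Qed.

Lemma clV g : g \in G -> (cl g)^-1%g = cl (g^-1).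
Proof. by move=> gS; rewrite /cl morphV ?norm_SL2. Qed.

Lemma cl1 : cl 1 = 1%g. Proof. exact: morph1. Qed.

Lemma cl_L2 g : g \in G -> cl g \in LG.
Proof. by move=> gS; apply: mem_quotient. Qed.

Lemma cl_eq g h : g \in G -> h \in G ->
  cl g = cl h <-> g = h \/ g = (negS2 * h)%g.
Proof.
move=> gS hS; split.
  move/(rcoset_kercosetP (norm_SL2 gS) (norm_SL2 hS))/rcosetP=> [z].
  move=> zZ ->; have : z \in [set 1%g; negS2] by rewrite -center_SL2.
  by case/set2P=> ->; rewrite ?mul1g; [left | right].
move=> gh; apply/(rcoset_kercosetP (norm_SL2 gS) (norm_SL2 hS)).
have nZ : negS2 \in 'Z(G)%g by rewrite center_SL2 set22.
by apply/rcosetP; case: gh => ->; [exists 1%g; rewrite ?mul1g ?group1 | exists negS2].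
Qed.

Lemma cl_S2_eq a b c d a' b' c' d' : a * d - b * c = 1 -> a' * d' - b' * c' = 1 ->
  cl (S2 a b c d) = cl (S2 a' b' c' d') ->
  [/\ a = a', b = b', c = c' & d = d'] \/
  [/\ a = - a', b = - b', c = - c' & d = - d'].
Proof.
move=> e e' /(cl_eq (S2_in e) (S2_in e'))[/S2_inj[]//|]; first by left.
by rewrite negS2_mul // => /S2_inj[]//; [rewrite -[RHS]e'; ring | right].
Qed.

Lemma cl_neg a b c d : a * d - b * c = 1 ->
  cl (S2 (- a) (- b) (- c) (- d)) = cl (S2 a b c d).
Proof.
move=> e; have e' : (- a) * (- d) - (- b) * (- c) = 1 by rewrite -[RHS]e; ring.
by apply/(cl_eq (S2_in e') (S2_in e)); right; rewrite negS2_mul.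
Qed.

Lemma L2_simple (N : {group coset_of Z}) : N \subset LG -> LG \subset 'N(N)%g ->
  N :=: 1%g \/ LG \subset N.
Proof.
move=> sN nN; have nZ : (Z <| G)%g by apply: center_normal.
pose K := (coset Z @*^-1 N)%G.
have sK : K \subset G by rewrite sub_cosetpre_quo.
have nK : G \subset 'N(K)%g.
  have : (K <| G)%g.
    have := cosetpre_normal N (G / 'Z(G))%g.
    by rewrite (quotientGK nZ) => ->; rewrite /normal sN.
  by case/andP.
have [sKZ|nsKZ] := boolP (K \subset Z).
  left; apply/trivgP; rewrite -[gval N](cosetpreK N); apply/subsetP=> x.
  case/morphimP=> g _ gK ->; rewrite inE; apply/eqP/coset_id; exact: (subsetP sKZ).
right; case/subsetPn: nsKZ => g gK; have [a [b [c [d [e eg]]]]] := S2P (subsetP sK g gK).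
move=> ngZ'; have {ngZ'} : g \notin [set 1%g; negS2] by rewrite -center_SL2.
rewrite eg => ngZ.
have sSK : G \subset K.
  rewrite eg in gK; apply: (SL2_normal_sub sK nK e gK).
  apply: contraR ngZ; rewrite !negb_or !negbK => /and3P[/eqP b0 /eqP c0 /eqP ad].
  have : (a - 1) * (a + 1) = 0.
    have -> : (a - 1) * (a + 1) = a * a - 1 by ring.
    by rewrite -e b0 c0 -ad; ring.
  move/eqP; rewrite mulf_eq0 subr_eq0 addr_eq0 b0 c0 -ad => /orP[]/eqP->.
    by rewrite S2_1 set21.
  by rewrite set22.
by rewrite -[gval N](cosetpreK N) quotientS.
Qed.

Lemma card_L2 : (2 * #|LG| = #|G|)%N.
Proof.
rewrite card_quotient ?normal_norm ?center_normal //.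
rewrite -(Lagrange (center_sub G)); congr (_ * _)%N; apply/esym.
have : #|'Z(G)%g| = 2 by rewrite center_SL2 cards2 eq_sym negS2_neq1.
exact.
Qed.

(* The root [l] is the trace of an element of order 5. *)
Lemma exists_golden : (5 %| #|G|)%N -> exists l : F, l ^+ 2 + l - 1 = 0.
Proof.
move=> h5; have [||g gS og] := @Cauchy _ 5 G; rewrite //.
have g5 : (g ^+ 5)%g = 1%g by rewrite -og expg_order.
have [a [b [c [d [e eg]]]]] := S2P gS.
pose l := a + d; exists l.
(* [P u v] is the matrix u g + v and [N u v] its determinant. By Cayley-Hamilton, g^2 = l g - 1, so
   multiplying by g sends (u, v) to (u l + v, -u). *)
pose P u v := S2 (u * a + v) (u * b) (u * c) (u * d + v).
pose N u v := (u * a + v) * (u * d + v) - (u * b) * (u * c).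
have bc : b * c = a * d - 1 by rewrite -e; ring.
have NP u v : N (u * l + v) (- u) = N u v by rewrite /N /l; ring: bc.
have gP u v : N u v = 1 -> (g * P u v)%g = P (u * l + v) (- u).
  by move=> Nuv; rewrite eg S2_mul //; congr S2; rewrite /l; ring: bc.
have N1 : N 1 0 = 1 by rewrite -[RHS]e /N; ring.
have eg1 : g = P 1 0 by rewrite eg; congr S2; ring.
pose u2 := 1 * l + 0; pose u3 := u2 * l + - 1; pose u4 := u3 * l + - u2; pose u5 := u4 * l + - u3.
have N2 : N u2 (-1) = 1 by rewrite NP.
have N3 : N u3 (- u2) = 1 by rewrite NP.
have N4 : N u4 (- u3) = 1 by rewrite NP.
have N5 : N u5 (- u4) = 1 by rewrite NP.
have : (g ^+ 5)%g = P u5 (- u4).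
  by rewrite !expgS expg0 mulg1 {5}eg1 !gP.
have d1 : 1 * 1 - 0 * 0 = 1 :> F by ring.
rewrite g5 -S2_1 => /(S2_inj d1 N5)[/esym e1 /esym e2 /esym e3 /esym e4].
(* The identity is u5 g - u4. If u5 is non-zero, g is scalar and has order at most 2; otherwise -u4
   = 1 factors as (l - 1)(l^2 + l - 1) = 0, and l = 1 would give u5 = -1. *)
have [u0|u0] := eqVneq u5 0.
  rewrite u0 mul0r add0r in e1.
  have : (l - 1) * (l ^+ 2 + l - 1) = 0.
    have -> : (l - 1) * (l ^+ 2 + l - 1) = 1 - (- u4) by rewrite /u4 /u3 /u2; ring.
    by rewrite e1 subrr.
  move/eqP; rewrite mulf_eq0 subr_eq0 => /orP[/eqP l1|/eqP//].
  have : u5 = - 1 by rewrite /u5 /u4 /u3 /u2 l1; ring.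
  by rewrite u0 => /eqP; rewrite eq_sym oppr_eq0 oner_eq0.
move/eqP: e2; rewrite mulf_eq0 (negPf u0) => /eqP b0.
move/eqP: e3; rewrite mulf_eq0 (negPf u0) => /eqP c0.
have ad : a = d.
  by apply: (mulfI u0); apply: (addIr (- u4)); rewrite e1 e4.
have g2 : (g ^+ 2)%g = 1%g.
  rewrite expgS expg1 eg S2_mul // -S2_1 b0 c0 -ad.
  have a2 : a * a = 1 by rewrite -e b0 c0 -ad; ring.
  by congr S2; rewrite ?a2; ring.
have : (#[g]%g %| 2)%N by rewrite order_dvdn g2.
by rewrite og.
Qed.

(** * Matrices satisfying the relations of the rotation group of {6,3,5} *)

Variables (a l : F).
Hypothesis Ha : a ^+ 4 = a ^+ 2 - 1.
Hypothesis Hl : l ^+ 2 = 1 - l.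

(** The hypothesis on [a] is the 12th cyclotomic equation, so [a'] is 1/a and [eta] is 1/a^2, the
    sixth root of unity by which conjugation by [tcl 1] scales translations; [kappa] is the length
    of the basic translation. *)
Local Notation a' := (a - a ^+ 3).
Local Notation kappa := (l * a ^+ 3).
Local Notation eta := (1 - a ^+ 2).

(** Modulo signs the first has order 6 and the other two are involutions. The inverse of the first
    times the second has trace 1, hence order 3; the inverse of the second times the third has trace
    [l], hence order 5. The first two are triangular, which makes the facet group affine. *)
Definition tmx (i : nat) : gT :=
  match i with
  | 1 => S2 a 0 0 a'
  | 2 => S2 (a ^+ 3) l 0 (- a ^+ 3)
  | 3 => S2 0 1 (-1) 0
  | _ => 1%g
  end.

Definition tcl (i : nat) : coset_of Z := cl (tmx i).

Let det1 : a * a' - 0 * 0 = 1. Proof. by ring: Ha. Qed.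
Let det2 : a ^+ 3 * (- a ^+ 3) - l * 0 = 1. Proof. by ring: Ha. Qed.
Let det3 : 0 * 0 - 1 * (-1) = 1 :> F. Proof. by ring. Qed.

Let a_neq0 : a != 0.
Proof. by apply: contra_eq_neq det1 => ->; rewrite !mul0r subr0 eq_sym oner_neq0. Qed.

Let l_neq0 : l != 0.
Proof.
apply: contra_eq_neq Hl => ->.
by rewrite expr0n subr0 eq_sym oner_neq0.
Qed.

Let kappa_neq0 : kappa != 0.
Proof. by rewrite mulf_neq0 ?expf_neq0. Qed.

Let three_neq0 : 3 != 0 :> F.
Proof.
apply: contra_neq fifteen_neq0 => h.
have -> : 15 = 3 * 5 :> F by ring.
by rewrite h mul0r.
Qed.

Let eta_neq : 1 - 2 * eta != 0.
Proof.
apply: contra_neq three_neq0 => h.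
have -> : 3 = 4 * (eta ^+ 2 - eta + 1) - (1 - 2 * eta) ^+ 2 by ring.
have -> : eta ^+ 2 - eta + 1 = 0 by ring: Ha.
by rewrite h mulr0 expr0n subr0.
Qed.

Lemma tmx_in i : tmx i \in G.
Proof. by case: i => [|[|[|[|i]]]] /=; rewrite ?group1 ?S2_in. Qed.

Lemma tcl_in i : tcl i \in LG.
Proof. exact: cl_L2 (tmx_in i). Qed.

Let clS (b c d e : F) (b' c' d' e' : F) : b * e - c * d = 1 -> b' * e' - c' * d' = 1 ->
  (cl (S2 b c d e) * cl (S2 b' c' d' e'))%g =
  cl (S2 (b * b' + c * d') (b * c' + c * e') (d * b' + e * d') (d * c' + e * e')).
Proof. by move=> h h'; rewrite clM ?S2_in // S2_mul. Qed.

Let clSV (b c d e : F) : b * e - c * d = 1 ->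
  ((cl (S2 b c d e))^-1)%g = cl (S2 e (- c) (- d) b).
Proof. by move=> h; rewrite clV ?S2_in // S2_inv. Qed.

Lemma tcl22 : (tcl 2 * tcl 2)%g = 1%g.
Proof.
rewrite /tcl /= clS // -cl1 -S2_1 -[RHS]cl_neg; last by ring.
by congr (cl (S2 _ _ _ _)); ring: Ha.
Qed.

Lemma tcl33 : (tcl 3 * tcl 3)%g = 1%g.
Proof.
rewrite /tcl /= clS // -cl1 -S2_1 -[RHS]cl_neg; last by ring.
by congr (cl (S2 _ _ _ _)); ring.
Qed.

Lemma tcl13 : ((tcl 1)^-1 * tcl 3 = (tcl 3)^-1 * tcl 1)%g.
Proof.
rewrite /tcl /= !clSV // !clS //; try by ring: Ha.
rewrite -[RHS]cl_neg; last by ring: Ha.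
by congr (cl (S2 _ _ _ _)); ring.
Qed.

Lemma tcl_braid12 : (tcl 1 * (tcl 2)^-1 * tcl 1 = tcl 2 * (tcl 1)^-1 * tcl 2)%g.
Proof.
rewrite /tcl /= !clSV // !clS //; try by ring: Ha.
first [ by congr (cl (S2 _ _ _ _)); ring: Ha Hl
      | by rewrite -[RHS]cl_neg; [congr (cl (S2 _ _ _ _)); ring: Ha Hl | ring: Ha Hl]].
Qed.

Lemma tcl_braid23 : (tcl 2 * (tcl 3)^-1 * tcl 2 * (tcl 3)^-1 * tcl 2 =
  tcl 3 * (tcl 2)^-1 * tcl 3 * (tcl 2)^-1 * tcl 3)%g.
Proof.
rewrite /tcl /= !clSV // !clS //; try by ring: Ha Hl.
first [ by congr (cl (S2 _ _ _ _)); ring: Ha Hl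
      | by rewrite -[RHS]cl_neg; [congr (cl (S2 _ _ _ _)); ring: Ha Hl | ring: Ha Hl]].
Qed.

Lemma tcl_upper : (tcl 2 * tcl 1 ^+ 3)%g = cl (upper kappa).
Proof.
rewrite /tcl /= !expgS expg0 mulg1 !clS //; try by ring: Ha.
rewrite /upper -[RHS]cl_neg; last by ring.
by congr (cl (S2 _ _ _ _)); ring: Ha.
Qed.

Lemma tcl1_order : (tcl 1 ^+ 3 = (tcl 1)^-1 ^+ 3)%g.
Proof.
rewrite /tcl /= !expgS !expg0 !mulg1 !clSV // !clS //; try by ring: Ha.
rewrite -[RHS]cl_neg; last by ring: Ha.
by congr (cl (S2 _ _ _ _)); ring: Ha.
Qed.

Lemma tcl_upper_conj x : ((tcl 1)^-1 * cl (upper x) * tcl 1)%g = cl (upper (eta * x)).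
Proof.
rewrite /tcl /upper /= !clSV // !clS //; try by ring: Ha.
by congr (cl (S2 _ _ _ _)); ring: Ha.
Qed.

Lemma tcl_upper_conjV x :
  (tcl 1 * cl (upper x) * (tcl 1)^-1)%g = cl (upper ((1 - eta) * x)).
Proof.
rewrite /tcl /upper /= !clSV // !clS //; try by ring: Ha.
by congr (cl (S2 _ _ _ _)); ring: Ha.
Qed.

Let upper_in x : upper x \in G. Proof. by rewrite S2_in // det_upper. Qed.

Let cl_upperX x n : (cl (upper x) ^+ n)%g = cl (upper (x *+ n)).
Proof. by rewrite -upperX /cl morphX ?norm_SL2. Qed.

Lemma cl_upper_eq1 x : cl (upper x) = 1%g -> x = 0.
Proof.
rewrite -cl1 -S2_1 /upper => /cl_S2_eq[]; try by ring.
  by case.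
by case=> _ ->; rewrite oppr0.
Qed.

(** [tcl 2] times the cube of [tcl 1] is a non-trivial upper unipotent, whose powers are all of them
    over a prime field; [tcl 3] supplies the non-zero lower-left entry for [upper_gen]. *)
Lemma tcl_gen (K : {group coset_of Z}) :
  tcl 1 \in K -> tcl 2 \in K -> tcl 3 \in K -> LG \subset K.
Proof.
move=> K1 K2 K3; pose K0 := (coset Z @*^-1 K)%G.
have inK0 g : g \in G -> cl g \in K -> g \in K0.
  by move=> gG gK; rewrite mem_morphpre // norm_SL2.
have U x : upper x \in K0.
  apply: inK0 => //; have [n ->] := prime_field x kappa_neq0.
  by rewrite -cl_upperX -tcl_upper groupX // groupM // groupX.
have sGK : G \subset K0.
  by apply: upper_gen det3 _ U (inK0 _ (tmx_in 3) K3); rewrite oppr_eq0 oner_neq0.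
by rewrite -[gval K](cosetpreK K) quotientS.
Qed.

(** By simplicity the centre is trivial or everything, and [tcl 1] does not commute with the
    unipotent of [kappa], as eta differs from 1. *)
Lemma center_LG : 'Z(LG)%g = 1%g.
Proof.
have nZ : LG \subset 'N('Z(LG))%g by rewrite normal_norm // center_normal.
have [//|sLZ] := L2_simple (center_sub LG) nZ.
have c1 : tcl 1 \in 'Z(LG)%g by rewrite (subsetP sLZ) ?tcl_in.
have /centP/(_ (cl (upper kappa)) (cl_L2 (upper_in _))) cU : tcl 1 \in 'C(LG)%g.
  by case/setIP: c1.
have := tcl_upper_conj kappa; rewrite -mulgA -cU mulgA mulVg mul1g => /esym e.
have n1 : 1 <> -1 :> F.
  by apply/eqP; rewrite -subr_eq0 opprK; apply: two_neq0.
move: e; rewrite /upper => /cl_S2_eq[]; try (by ring); last by case=> /n1.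
case=> _ e _ _; have : a ^+ 2 * kappa = 0.
  by transitivity (kappa - eta * kappa); [ring | rewrite e subrr].
by move/eqP; rewrite mulf_eq0 (negPf kappa_neq0) orbF expf_eq0 (negPf a_neq0).
Qed.

(** The translation U = t_2 t_1^3 is fixed by [f]. The equation b + c eta = 0 is a relation between
    U and its conjugate by t_1; [f] turns this into conjugation by the inverse of t_1, hence eta
    into 1 - eta. Both relations together give c (1 - 2 eta) = 0. *)
Lemma tcl_no_reflection (f : {morphism LG >-> coset_of Z}) (b c : nat) :
  f (tcl 1) = (tcl 1)^-1%g -> f (tcl 2) = (tcl 2)^-1%g ->
  b%:R + c%:R * eta = 0 -> c%:R != 0 :> F -> False.
Proof.
move=> f1 f2 ebc c0; have t1L := tcl_in 1; have t2L := tcl_in 2.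
have t2V : (tcl 2)^-1%g = tcl 2 by apply/eqP; rewrite eq_invg_mul tcl22.
have [U eU] : exists U, U = (tcl 2 * tcl 1 ^+ 3)%g by eexists.
have UL : U \in LG by rewrite eU groupM // groupX.
have fU : f U = U by rewrite eU morphM ?groupX // morphX // f1 f2 t2V -tcl1_order.
have e1 : (U ^+ b * ((tcl 1)^-1 * U * tcl 1) ^+ c)%g = 1%g.
  rewrite eU tcl_upper tcl_upper_conj !cl_upperX /upper clS; try by ring.
  rewrite -cl1 -S2_1; congr (cl (S2 _ _ _ _)); try by ring.
  rewrite -(mulr_natr kappa b) -(mulr_natr (eta * kappa) c).
  transitivity (kappa * (b%:R + c%:R * eta)); first by ring.
  by rewrite ebc mulr0.
have /(congr1 f) := e1.
rewrite morph1 morphM ?groupX ?groupM ?groupV // morphX // morphX ?groupM ?groupV //.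
rewrite morphM ?groupM ?groupV // morphM ?groupV // morphV // f1 fU invgK.
rewrite eU tcl_upper tcl_upper_conjV !cl_upperX /upper clS; try by ring.
have -> : cl (S2 (1 * 1 + kappa *+ b * 0) (1 * ((1 - eta) * kappa *+ c) + kappa *+ b * 1)
    (0 * 1 + 1 * 0) (0 * ((1 - eta) * kappa *+ c) + 1 * 1)) =
    cl (upper (kappa * (b%:R + c%:R * (1 - eta)))).
  by congr (cl (S2 _ _ _ _)); rewrite -?(mulr_natr kappa b)
    -?(mulr_natr ((1 - eta) * kappa) c); ring.
move/cl_upper_eq1/eqP; rewrite mulf_eq0 (negPf kappa_neq0) /= => /eqP e2.
have : c%:R * (1 - 2 * eta) = 0.
  transitivity ((b%:R + c%:R * (1 - eta)) - (b%:R + c%:R * eta)); first by ring.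
  by rewrite ebc e2 subr0.
by move/eqP; rewrite mulf_eq0 (negPf c0) (negPf eta_neq).
Qed.

(** Reduction of the Eisenstein integers to the field, with the vector [(0, 1)] at 60 degrees going
    to the sixth root of unity [eta]. *)
Definition hex_val (v : hex_point) : F := v.1%:~R + v.2%:~R * eta.

Lemma hex_valD u v : hex_val (u + v) = hex_val u + hex_val v.
Proof. by rewrite /hex_val /= !rmorphD /=; ring. Qed.

Lemma hex_valN v : hex_val (- v) = - hex_val v.
Proof. by rewrite /hex_val /= !rmorphN /=; ring. Qed.

(* [S2 s n 0 s'] is the affine map [z |-> s^2 z + n s] taking the base flag to
   the given one, up to the reflection [hex_r 0] when [x.2] holds. *)
Definition hex_rel (h : hex_flag) (x : coset_of Z * bool) : Prop :=
  let: (v, u, u') := h in exists s s' n,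
  [/\ s * s' = 1, x.1 = (cl (S2 s n 0 s'))^-1%g, hex_val u = s * s,
      hex_val v * kappa = n * s
    & hex_val u' = hex_val u * (if x.2 then 1 - eta else eta)].

(** The witnesses are the entries of [S2 s n 0 s'] multiplied on the right by [tmx i] or its
    inverse, according to the parity. *)
Lemma hex_rel_r i h (x : coset_of Z * bool) : letter_range 0 3 i -> hex_rel h x ->
  hex_rel (hex_r i h) (grp_r tcl i x).
Proof.
case: h x => [[v u] u'] [g e] Li [s [s' [n [ss eg eu ev eu']]]] /=.
have es : s * s' - n * 0 = 1 by rewrite ss mulr0 subr0.
rewrite /= in eg eu'; rewrite {}eg.
have [|[|]] : i = 0%N \/ i = 1%N \/ i = 2%N by move: Li; rewrite /letter_range; lia.
- move=> ->; exists s, s', n; split=> //.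
  + by case: (e); rewrite /grp_r /= /tcl /= cl1 ?invg1 mul1g.
  + by rewrite hex_valD hex_valN eu'; case: (e) => /=; ring.
- move=> ->; case: e eu' => eu'.
  + exists (s * a), (s' * a'), (n * a'); split.
    * by rewrite mulrACA ss; ring: Ha.
    * rewrite /grp_r /= -invMg /tcl /= clS //.
      by congr (_^-1)%g; congr (cl (S2 _ _ _ _)); ring.
    * by rewrite eu' eu; ring: Ha.
    * by rewrite ev; ring: Ha.
    * by rewrite eu' /=; ring: Ha.
  + exists (s * a'), (s' * a), (n * a); split.
    * by rewrite mulrACA ss; ring: Ha.
    * apply: invg_inj; rewrite /grp_r /= /tcl /= invMg !invgK clSV // clS //; last by ring: Ha.
      by congr (cl (S2 _ _ _ _)); ring.
    * by rewrite eu' eu; ring: Ha.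
    * by rewrite ev; ring: Ha.
    * by rewrite eu' /=; ring: Ha.
- move=> ->; case: e eu' => eu'.
  + exists (s * a ^+ 3), (- s' * a ^+ 3), (s * l - n * a ^+ 3); split.
    * by rewrite mulrACA mulrN ss; ring: Ha.
    * rewrite /grp_r /= -invMg /tcl /= clS //.
      by congr (_^-1)%g; congr (cl (S2 _ _ _ _)); ring.
    * by rewrite hex_valN eu; ring: Ha.
    * by rewrite hex_valD mulrDl ev eu; ring: Ha.
    * by rewrite hex_valD !hex_valN eu' /=; ring: Ha.
  + exists (- s * a ^+ 3), (s' * a ^+ 3), (n * a ^+ 3 - s * l); split.
    * by rewrite mulrACA mulNr ss; ring: Ha.
    * apply: invg_inj; rewrite /grp_r /= /tcl /= invMg !invgK clSV // clS //; last by ring: Ha.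
      by congr (cl (S2 _ _ _ _)); ring.
    * by rewrite hex_valN eu; ring: Ha.
    * by rewrite hex_valD mulrDl ev eu; ring: Ha.
    * by rewrite hex_valD !hex_valN eu' /=; ring: Ha.
Qed.

(** The invertibility of 2 and 3 keeps the values of the other unit vectors away from 1 and
    [eta]. *)
Lemma hex_val_base (u u' : hex_point) : (u, u') \in hex_units ->
  hex_val u = 1 -> hex_val u' = eta -> u = (1, 0) /\ u' = (0, 1).
Proof.
have e2 : eta ^+ 2 = eta - 1 by ring: Ha.
have n1 : eta <> 1.
  move=> e; have := oner_neq0 F; have -> : 1 = eta - eta ^+ 2 by rewrite e2; ring.
  by rewrite e expr1n subrr eqxx.
have n2 : eta <> 2.
  move=> e; have := three_neq0; have -> : 3 = eta ^+ 2 - (eta - 1) by rewrite e; ring.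
  by rewrite e2 subrr eqxx.
have n3 : eta <> -1.
  move=> e; have := three_neq0; have -> : 3 = eta ^+ 2 - (eta - 1) by rewrite e; ring.
  by rewrite e2 subrr eqxx.
have n4 : eta <> 0.
  move=> e; have := oner_neq0 F; have -> : 1 = eta - eta ^+ 2 by rewrite e2; ring.
  by rewrite e expr0n subrr eqxx.
have n5 : 1 <> -1 :> F.
  by apply/eqP; rewrite -subr_eq0 opprK; apply: two_neq0.
have vE (x y : int) : hex_val (x, y) = x%:~R + y%:~R * eta by [].
have c1 : hex_val (1, 0) = 1 by rewrite vE; ring.
have c2 : hex_val (0, 1) = eta by rewrite vE; ring.
have c3 : hex_val (-1, 1) = eta - 1 by rewrite vE; ring.
have c4 : hex_val (-1, 0) = -1 by rewrite vE; ring.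
have c5 : hex_val (0, -1) = - eta by rewrite vE; ring.
have c6 : hex_val (1, -1) = 1 - eta by rewrite vE; ring.
have d1 (x : hex_point) : x \in [:: (1, 0); (0, 1); (-1, 1); (-1, 0); (0, -1); (1, -1)] ->
    hex_val x = 1 -> x = (1, 0).
  rewrite !inE => /or4P[/eqP->|/eqP->|/eqP->|/or3P[]/eqP->] //; rewrite ?c2 ?c3 ?c4 ?c5 ?c6 => e.
  - by case: n1.
  - by case: n2; rewrite -[LHS](subrK 1) e; ring.
  - by case: n5.
  - by case: n3; rewrite -[LHS]opprK e.
  - by case: n4; rewrite -[LHS](subKr 1) e subrr.
have d2 (x : hex_point) : x \in [:: (1, 0); (0, 1); (-1, 1); (-1, 0); (0, -1); (1, -1)] ->
    hex_val x = eta -> x = (0, 1).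
  rewrite !inE => /or4P[/eqP->|/eqP->|/eqP->|/or3P[]/eqP->] //; rewrite ?c1 ?c3 ?c4 ?c5 ?c6 => e.
  - by case: n1.
  - by case/eqP: (oner_neq0 F); transitivity (eta - (eta - 1)); [ring | rewrite e subrr].
  - by case: n3.
  - case: n4; apply/eqP; rewrite -(inj_eq (mulfI two_neq0)) mulr0; apply/eqP.
    transitivity (eta - (- eta)); first by ring.
    by rewrite e subrr.
  - by case/eqP: eta_neq; transitivity ((1 - eta) - eta); [ring | rewrite e subrr].
have /allP units_ok : all (fun q =>
    (q.1 \in [:: (1, 0); (0, 1); (-1, 1); (-1, 0); (0, -1); (1, -1)])
  && (q.2 \in [:: (1, 0); (0, 1); (-1, 1); (-1, 0); (0, -1); (1, -1)])) hex_units by vm_compute.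
by move=> /units_ok/andP[/= u6 u6'] /(d1 _ u6) -> /(d2 _ u6') ->.
Qed.

Lemma hex_stab w : all (letter_range 0 3) w ->
  walk (grp_r tcl) (1%g, false) w = (1%g, false) <->
  exists2 v, walk hex_r hex_base w = hex_shift v hex_base & hex_val v = 0.
Proof.
move=> Lw; have R0 : hex_rel hex_base (1%g, false).
  exists 1, 1, 0; rewrite S2_1 cl1 invg1 /hex_val /=; split=> //; ring.
have := @walk_morph _ _ hex_r (grp_r tcl) (letter_range 0 3) hex_rel
  (fun i h z Li Rhz => hex_rel_r Li Rhz) w _ _ Lw R0.
have : hex_valid (walk hex_r hex_base w) by apply: hex_valid_walk.
case: (walk hex_r hex_base w) => [[v u] u'] Vh [s [s' [n [ss eg eu ev eu']]]].
have es : s * s' - n * 0 = 1 by rewrite ss mulr0 subr0.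
split=> [e|[t [ev' eu1 eu2] t0]].
  rewrite e /= in eg eu'; exists v.
    have /cl_S2_eq[] : cl (S2 s n 0 s') = cl (S2 1 0 0 1).
      by apply: invg_inj; rewrite -eg S2_1 cl1 invg1.
    - exact: es.
    - by ring.
    - case=> s1 n0 _ _; rewrite s1 mulr1 in eu; rewrite eu mul1r in eu'.
      by have [-> ->] := @hex_val_base u u' Vh eu eu'; rewrite /= add0r.
    - case=> s1 n0 _ _; rewrite s1 mulrNN mulr1 in eu; rewrite eu mul1r in eu'.
      by have [-> ->] := @hex_val_base u u' Vh eu eu'; rewrite /= add0r.
  have n0 : n = 0.
    have /cl_S2_eq[] : cl (S2 s n 0 s') = cl (S2 1 0 0 1).
      by apply: invg_inj; rewrite -eg S2_1 cl1 invg1.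
    - exact: es.
    - by ring.
    - by case.
    - by case=> _ ->; rewrite oppr0.
  by move/eqP: ev; rewrite n0 mul0r mulf_eq0 (negPf kappa_neq0) orbF => /eqP.
subst u u'; rewrite add0r in ev'; subst v.
have v1 : hex_val (1, 0) = 1 by rewrite /hex_val /=; ring.
have v2 : hex_val (0, 1) = eta by rewrite /hex_val /=; ring.
have s0 : s != 0 by apply: contra_eq_neq ss => ->; rewrite mul0r eq_sym oner_neq0.
have n0 : n = 0.
  by move/eqP: ev; rewrite t0 mul0r eq_sym mulf_eq0 (negPf s0) orbF => /eqP.
rewrite v1 in eu; rewrite v1 v2 mul1r in eu'.
case: (walk _ _ _) eg eu' => g [] /= eg eu'.
  (* Odd parity would exchange eta with its conjugate 1 - eta. *)
  by case/eqP: eta_neq; transitivity ((1 - eta) - eta); [ring | rewrite -eu' subrr].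
congr (_, _); rewrite eg n0.
have : (s - 1) * (s + 1) = 0.
  by transitivity (s * s - 1); [ring | rewrite -eu subrr].
have s's : s' = s by apply: (mulfI s0); rewrite ss -eu.
move/eqP; rewrite mulf_eq0 subr_eq0 addr_eq0 s's => /orP[]/eqP->.
  by rewrite S2_1 cl1 invg1.
rewrite -(cl_neg (a := -1)); last by ring.
by rewrite opprK oppr0 S2_1 cl1 invg1.
Qed.

End Coordinates.

(** * The icosahedron *)

Definition alternating (i j m : nat) : seq nat :=
  mkseq (fun k => if odd k then j else i) m.

(* Matsumoto's argument: if [B] is the Cayley graph of a Coxeter group with
   Coxeter matrix [m] and length function [len], then [B] maps onto the orbit of
   any point under involutions satisfying the braid relations. *)
Section Braid.
Variables (B : eqType) (rB : nat -> B -> B) (Bs : seq B) (b0 : B) (len : B -> nat).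
Variables (letters : seq nat) (m : nat -> nat -> nat).
Variables (X : Type) (r : nat -> X -> X) (x0 : X).

Definition descent b s := len (rB s b) < len b.

Fixpoint descending b w :=
  if w is i :: w' then descent b i && descending (rB i b) w' else true.

Hypothesis Bs0 : b0 \in Bs.
Hypothesis Bs_r : forall b i, b \in Bs -> i \in letters -> rB i b \in Bs.
Hypothesis rBK : forall b i, b \in Bs -> i \in letters -> rB i (rB i b) = b.
Hypothesis len_neq : forall b i, b \in Bs -> i \in letters -> len (rB i b) != len b.
Hypothesis Bs_descent : forall b, b \in Bs -> b != b0 -> has (descent b) letters.
Hypothesis len0 : len b0 = 0.
Hypothesis descent2 : forall b i j, b \in Bs -> i \in letters -> j \in letters ->
  i != j -> descent b i -> descent b j ->
  descending b (alternating i j (m i j)) /\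
  walk rB b (alternating i j (m i j)) = walk rB b (alternating j i (m i j)).
Hypothesis mC : forall i j, m i j = m j i.
Hypothesis m_gt0 : forall i j, i \in letters -> j \in letters -> i != j -> 0 < m i j.
Hypothesis rK : forall i, i \in letters -> involutive (r i).
Hypothesis braid : forall x i j, i \in letters -> j \in letters -> i != j ->
  walk r x (rev (alternating i j (m i j))) = walk r x (rev (alternating j i (m i j))).

Let first_descent b := nth 0 letters (find (descent b) letters).

(** The argument [n] is fuel: any bound on [len b] gives the same word. *)
Fixpoint descent_word n b : seq nat :=
  if n is n'.+1 then
    if b == b0 then [::] else rcons (descent_word n' (rB (first_descent b) b)) (first_descent b)
  else [::].

Let f b := walk r x0 (descent_word (len b) b).

Let first_descentP b : b \in Bs -> b != b0 ->
  first_descent b \in letters /\ descent b (first_descent b).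
Proof.
move=> bB nb; have h := Bs_descent bB nb; split; first by rewrite mem_nth // -has_find.
exact: nth_find.
Qed.

Let descent_word_fuel n n' b : b \in Bs -> len b <= n -> len b <= n' ->
  descent_word n b = descent_word n' b.
Proof.
elim: n n' b => [|n IHn] [|n'] b bB //= le_n le_n'; case: eqP => // /eqP nb;
  have [dB dd] := first_descentP bB nb; move: dd; rewrite /descent; try lia.
by move=> dd; rewrite (IHn n') ?Bs_r //; lia.
Qed.

Let f_first b : b \in Bs -> b != b0 ->
  f b = r (first_descent b) (f (rB (first_descent b) b)).
Proof.
move=> bB nb; have [dB dd] := first_descentP bB nb; rewrite /f -walk_rcons.
have {1}-> : len b = (len b).-1.+1 by move: dd; rewrite /descent; lia.
rewrite /= (negPf nb); congr (walk _ _ (rcons _ _)).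
by apply: descent_word_fuel; rewrite ?Bs_r //; move: dd; rewrite /descent; lia.
Qed.

(** The chosen first descent may be replaced by any descent: alternating descending words starting
    with either letter meet at the bottom of the dihedral coset of [b], and the braid relation
    equates their effects on [X]. *)
Let f_descent n b s : len b <= n -> b \in Bs -> s \in letters -> descent b s ->
  f b = r s (f (rB s b)).
Proof.
elim: n b s => [|n IHn] b s le_n bB sL ds.
  by move: ds; rewrite /descent; lia.
have nb : b != b0 by apply: contraTneq ds => ->; rewrite /descent len0.
have f_path w b' : len b' <= n -> b' \in Bs -> all (mem letters) w ->
    descending b' w -> f b' = walk r (f (walk rB b' w)) (rev w).
  elim: w b' => [|i w IHw] b' le' b'B //= /andP[iL wL] /andP[di dw].
  rewrite rev_cons walk_rcons -IHw ?Bs_r //; first exact: IHn.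
  exact: leq_trans (ltnW di) le'.
have [dB dd] := first_descentP bB nb; rewrite f_first //.
set d := first_descent b in dB dd *; have [->//|nds] := eqVneq d s.
have [dw1 e] := descent2 bB dB sL nds dd ds.
have nsd : s != d by rewrite eq_sym.
have [dw2 _] := descent2 bB sL dB nsd ds dd.
have go i j : i \in letters -> j \in letters -> i != j -> descent b i ->
    descending b (alternating i j (m i j)) ->
    r i (f (rB i b)) = walk r (f (walk rB b (alternating i j (m i j))))
                         (rev (alternating i j (m i j))).
  move=> iL jL nij di; have := m_gt0 iL jL nij.
  have Lalt : all (mem letters) (alternating i j (m i j)).
    by apply/allP=> k /mapP[l _ ->]; case: ifP.
  move: Lalt; rewrite /alternating; case: (m i j) => [//|k] /=.
  set w := map _ _ => /andP[_ Lw] _ /andP[_ dw]; rewrite rev_cons walk_rcons.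
  by rewrite -f_path ?Bs_r // -ltnS; apply: leq_trans di le_n.
by rewrite (go d s) // (go s d) // e (mC s d) (braid _ dB sL nds).
Qed.

Lemma braid_walk w : all (mem letters) w -> walk rB b0 w = b0 -> walk r x0 w = x0.
Proof.
have fr b s : b \in Bs -> s \in letters -> f (rB s b) = r s (f b).
  move=> bB sL; have := len_neq bB sL; rewrite neq_ltn => /orP[lt_s|lt_s].
    by rewrite (@f_descent (len b) b s) // rK.
  rewrite (@f_descent (len (rB s b)) (rB s b) s) ?Bs_r //; last by rewrite /descent rBK.
  by rewrite rBK.
have fw u b : b \in Bs -> all (mem letters) u -> f (walk rB b u) = walk r (f b) u.
  elim: u b => [|i u IHu] b bB //= /andP[iL uL].
  by rewrite IHu ?Bs_r // fr.
move=> wL e; have f0 : f b0 = x0 by rewrite /f len0.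
by rewrite -f0 -fw // e.
Qed.

End Braid.

(** A copy of [icosa_adj] on numerical codes, so that the checks over all flags can be computed. *)
Definition ico_adjn (a b : nat) : bool :=
  let i := a %/ 4 in let s := odd (a %/ 2) in let t := odd a in
  let j := b %/ 4 in let s' := odd (b %/ 2) in let t' := odd b in
  [|| [&& j == i, s != s' & t == t'], (j == i.+1 %% 3) && (t == s')
    | (i == j.+1 %% 3) && (t' == s)].

(* The vertex [(i, s, t)] has code [4 i + 2 s + t]. *)
Definition ico_dec (a : nat) : icosa_vertex :=
  (inZp (a %/ 4) : 'Z_3, odd (a %/ 2), odd a).

Notation ico_flag := (nat * nat * nat)%type.

Definition ico_valid (b : ico_flag) : bool :=
  let: (v, w, u) := b in
  [&& v < 12, w < 12, u < 12, ico_adjn v w, ico_adjn w u & ico_adjn v u].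

(* The flag [(v, w, u)] consists of the vertex [v], the edge [v w] and the
   triangle [v w u]; letters are shifted by 1, as in a vertex-figure. *)
Definition ico_r (i : nat) (b : ico_flag) : ico_flag :=
  let: (v, w, u) := b in
  match i with
  | 1 => (w, v, u)
  | 2 => (v, u, w)
  | 3 => (v, w, head 0 [seq x <- iota 0 12 | [&& ico_adjn v x, ico_adjn w x & x != u]])
  | _ => b
  end.

Definition ico_flags : seq ico_flag :=
  [seq b <- [seq (vw.1, vw.2, u) | vw <- [seq (v, w) | v <- iota 0 12, w <- iota 0 12],
     u <- iota 0 12] | ico_valid b].

Definition ico_base : ico_flag := head (0, 0, 0) ico_flags.

(** Layers by distance from the base flag: a letter changes the length by one, so only the previous
    layer must be removed. The longest element of H_3 has length 15, which explains the 16 layers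
    below. *)
Fixpoint ico_levels_rec n (prev cur : seq ico_flag) : seq (seq ico_flag) :=
  if n is n'.+1 then
    cur :: ico_levels_rec n' cur
      (undup [seq b <- flatten [seq [seq ico_r i b | i <- [:: 1; 2; 3]] | b <- cur]
              | b \notin prev])
  else [::].

Definition ico_levels : seq (seq ico_flag) :=
  Eval vm_compute in ico_levels_rec 16 [::] [:: ico_base].

Definition ico_len (b : ico_flag) : nat := find (fun L => b \in L) ico_levels.

(** The Coxeter matrix of H_3; a pair of distinct letters among 1, 2, 3 is recognized by its sum. *)
Definition ico_m (i j : nat) : nat :=
  if i + j == 3 then 3 else if i + j == 5 then 5 else 2.

Definition ico_letters := [:: 1; 2; 3].

Lemma mem_ico_flags b : (b \in ico_flags) = ico_valid b.
Proof.
rewrite mem_filter andb_idr //; case: b => [[v w] u] /and5P[lv lw lu _ _].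
apply/allpairsP; exists ((v, w), u); split; last by [].
  by apply/allpairsP; exists (v, w); split; rewrite ?mem_iota.
by rewrite mem_iota.
Qed.

Definition ico_check (b : ico_flag) : bool :=
  [&& all (fun i => [&& ico_valid (ico_r i b), ico_r i (ico_r i b) == b
                      & ico_len (ico_r i b) != ico_len b]) ico_letters,
      (b == ico_base) || has (descent ico_r ico_len b) ico_letters
    & all (fun i => all (fun j => [&& i != j, descent ico_r ico_len b i & descent ico_r ico_len b j]
        ==> (descending ico_r ico_len b (alternating i j (ico_m i j)) &&
             (walk ico_r b (alternating i j (ico_m i j)) ==
              walk ico_r b (alternating j i (ico_m i j)))))
       ico_letters) ico_letters].

Lemma ico_checkP b : ico_valid b -> ico_check b.
Proof.
rewrite -mem_ico_flags; move: b; apply/allP.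
by vm_compute.
Qed.

Lemma ico_valid_r i b : ico_valid b -> letter_range 1 4 i -> ico_valid (ico_r i b).
Proof.
move=> /ico_checkP/and3P[/allP h _ _] Li.
by have /h/and3P[] : i \in ico_letters by move: Li; rewrite /letter_range !inE; lia.
Qed.

Lemma ico_braid_walk (X : Type) (r : nat -> X -> X) (x0 : X) w :
  (forall i, letter_range 1 4 i -> involutive (r i)) ->
  (forall x, r 1 (r 2 (r 1 x)) = r 2 (r 1 (r 2 x))) ->
  (forall x, r 1 (r 3 x) = r 3 (r 1 x)) ->
  (forall x, r 2 (r 3 (r 2 (r 3 (r 2 x)))) = r 3 (r 2 (r 3 (r 2 (r 3 x))))) ->
  all (letter_range 1 4) w -> walk ico_r ico_base w = ico_base -> walk r x0 w = x0.
Proof.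
move=> rK b12 b13 b23 Lw.
have LI i : (i \in ico_letters) = letter_range 1 4 i.
  by rewrite /letter_range !inE; lia.
have Lw' : all (mem ico_letters) w by apply: sub_all Lw => i; rewrite -LI.
apply: (@braid_walk _ ico_r ico_flags ico_base ico_len ico_letters ico_m) Lw'.
- by vm_compute.
- by move=> b i; rewrite !mem_ico_flags => Vb; rewrite LI => /ico_valid_r; apply.
- by move=> b i; rewrite mem_ico_flags => /ico_checkP/and3P[/allP h _ _] /h/and3P[_ /eqP].
- by move=> b i; rewrite mem_ico_flags => /ico_checkP/and3P[/allP h _ _] /h/and3P[].
- by move=> b; rewrite mem_ico_flags => /ico_checkP/and3P[_ /orP[->|]].
- by vm_compute.
- move=> b i j; rewrite mem_ico_flags => /ico_checkP/and3P[_ _ /allP h] iL jL nij di dj.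
  have /allP/(_ j jL)/implyP := h i iL; rewrite nij di dj => /(_ isT)/andP[-> /eqP ->].
  by [].
- by move=> i j; rewrite /ico_m addnC.
- by move=> i j _ _ _; rewrite /ico_m; case: ifP => // _; case: ifP.
- by move=> i; rewrite LI; apply: rK.
- move=> x i j; rewrite !inE => /or3P[]/eqP-> /or3P[]/eqP-> // _;
    by rewrite /alternating /= ?b12 ?b13 ?b23.
Qed.

Section IcoModel.
Implicit Types b : ico_flag.

Definition ico_set (k : nat) b : {set icosa_vertex} :=
  let: (v, w, u) := b in
  match k with
  | 1 => set0
  | 2 => [set ico_dec v]
  | 3 => [set ico_dec v; ico_dec w]
  | 4 => [set ico_dec v; ico_dec w; ico_dec u]
  | _ => setT
  end.

Lemma ico_dec_check : all (fun a => all (fun c =>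
   ((ico_dec a == ico_dec c) == (a == c)) &&
   (icosa_adj (ico_dec a) (ico_dec c) == ico_adjn a c)) (iota 0 12)) (iota 0 12).
Proof. by vm_compute. Qed.

Lemma ico_decE (a b : nat) : a < 12 -> b < 12 -> (ico_dec a == ico_dec b) = (a == b).
Proof.
move=> la lb; have /allP/(_ a) := ico_dec_check; rewrite mem_iota => /(_ la).
by move/allP/(_ b); rewrite mem_iota => /(_ lb)/andP[/eqP].
Qed.

Lemma ico_adjE (a b : nat) : a < 12 -> b < 12 -> icosa_adj (ico_dec a) (ico_dec b) = ico_adjn a b.
Proof.
move=> la lb; have /allP/(_ a) := ico_dec_check; rewrite mem_iota => /(_ la).
by move/allP/(_ b); rewrite mem_iota => /(_ lb)/andP[_ /eqP].
Qed.

Lemma ico_adjn_sym (a b : nat) : ico_adjn a b = ico_adjn b a.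
Proof.
rewrite /ico_adjn [b %/ 4 == a %/ 4]eq_sym [odd (b %/ 2) == _]eq_sym [odd b == _]eq_sym.
by rewrite [odd b == odd a]eq_sym; congr (_ || _); apply: orbC.
Qed.

Lemma ico_adjn_irr a : ico_adjn a a = false.
Proof.
rewrite /ico_adjn !eqxx /=; have := ltn_pmod (a %/ 4).+1 (isT : 0 < 3).
by case: eqP => //=; lia.
Qed.

Lemma ico_setP k b : ico_valid b -> icosa_face (ico_set k b).
Proof.
case: b => [[v w] u] /and5P[lv lw lu vw /andP[wu vu]].
apply/orP; case: k => [|[|[|[|[|k]]]]]; try by left.
all: right; apply/forall_inP=> x; rewrite ?inE => hx; apply/forall_inP=> y; rewrite ?inE => hy.
all: move: hx hy; rewrite -?orbA => hx hy.
- by [].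
- by rewrite (eqP hx) (eqP hy) eqxx.
- by case/orP: hx => /eqP->; case/orP: hy => /eqP->; rewrite ?eqxx //; apply/implyP=> _;
    rewrite ico_adjE // ico_adjn_sym.
- by case/or3P: hx => /eqP->; case/or3P: hy => /eqP->; rewrite ?eqxx //; apply/implyP=> _;
    rewrite ico_adjE // ico_adjn_sym.
Qed.

Lemma ico_neq v w u : ico_valid (v, w, u) -> [/\ v != w, w != u & v != u].
Proof.
case/and5P=> lv lw lu vw /andP[wu vu].
by split; [move: vw | move: wu | move: vu]; apply: contraTneq => ->; rewrite ico_adjn_irr.
Qed.

Lemma ico_set_proper k b : ico_valid b -> 1 <= k <= 4 -> ico_set k b \proper ico_set k.+1 b.
Proof.
case: b => [[v w] u] Vb; have [nvw nwu nvu] := ico_neq Vb.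
have /and5P[lv lw lu _ _] := Vb.
have sub3 (A : {set icosa_vertex}) : #|A| <= 3 -> A \proper setT.
  move=> hA; rewrite properT; apply: contraTneq hA => ->.
  by rewrite cardsT !card_prod card_ord card_bool.
case: k => [|[|[|[|[|k]]]]] // _.
- by rewrite proper0; apply/set0Pn; exists (ico_dec v); rewrite set11.
- rewrite properE sub1set !inE eqxx /=; apply/subsetPn; exists (ico_dec w).
    by rewrite !inE eqxx orbT.
  by rewrite inE ico_decE // eq_sym.
- rewrite properE subsetUl /=; apply/subsetPn; exists (ico_dec u).
    by rewrite !inE eqxx orbT.
  by rewrite !inE !ico_decE // ![u == _]eq_sym negb_or nvu.
- apply: sub3; rewrite /ico_set -setUA cardsU1 cardsU1 cards1; by do 2!case: (_ \notin _).
Qed.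

Lemma ico_set_fix i k b : ico_valid b -> letter_range 1 4 i -> 1 <= k <= 5 -> k != i.+1 ->
  ico_set k (ico_r i b) = ico_set k b.
Proof.
case: b => [[v w] u] Vb Li Rk ki.
have : i \in [:: 1; 2; 3] by move: Li; rewrite /letter_range !inE; lia.
rewrite !inE => /or3P[]/eqP ei; subst i.
- case: k Rk ki => [|[|[|[|[|k]]]]] // _ _; first by rewrite /= setUC.
  by rewrite /= [[set ico_dec w; _]]setUC.
- case: k Rk ki => [|[|[|[|[|k]]]]] // _ _.
  by rewrite /= -!setUA [[set _] :|: [set ico_dec w]]setUC.
- by case: k Rk ki => [|[|[|[|[|k]]]]].
Qed.

Lemma ico_set_inj b b' : ico_valid b -> ico_valid b' ->
  (forall k, 1 <= k <= 5 -> ico_set k b = ico_set k b') -> b = b'.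
Proof.
case: b b' => [[v w] u] [[v' w'] u'] Vb Vb' e.
have [nvw nwu nvu] := ico_neq Vb; have /and5P[lv lw lu _ _] := Vb.
have /and5P[lv' lw' lu' _ _] := Vb'.
have ev : v = v'.
  by have /setP/(_ (ico_dec v)) := e 2 isT; rewrite !inE eqxx ico_decE // => /esym/eqP.
have ew : w = w'.
  have /setP/(_ (ico_dec w)) := e 3 isT; rewrite !inE eqxx orbT !ico_decE // -ev.
  by rewrite [w == v]eq_sym (negPf nvw) => /esym/eqP.
have eu : u = u'.
  have /setP/(_ (ico_dec u)) := e 4 isT; rewrite !inE eqxx orbT !ico_decE // -ev -ew.
  by rewrite ![u == _]eq_sym (negPf nvu) (negPf nwu) => /esym/eqP.
by rewrite ev ew eu.
Qed.

Definition ico_least : icosahedron := Sub set0 (ico_setP 1 (isT : ico_valid (0, 2, 4))).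

Definition ico_face (k : nat) b : icosahedron := insubd ico_least (ico_set k b).

Lemma val_ico_face k b : ico_valid b -> val (ico_face k b) = ico_set k b.
Proof. by move=> Vb; rewrite val_insubd ico_setP. Qed.

Lemma ico_stab (d : Order.disp_t) (S : finPOrderType d) (X : finType)
    (r : nat -> X -> X) (fc : nat -> X -> S) :
  flagged 1 4 r fc -> poset_iso S icosahedron ->
  exists x, forall w, all (letter_range 1 4) w ->
    walk r x w = x -> walk ico_r ico_base w = ico_base.
Proof.
move=> fl [h [[g hK gK] h_le]].
have g_le : {mono g : x y / (x <= y)%O} by move=> x y; rewrite -h_le !gK.
have g_inj := can_inj gK.
pose gb k b := g (ico_face k b).
have V0 : ico_valid ico_base by vm_compute.
have lt' k b : ico_valid b -> 1 <= k <= 4 -> (gb k b < gb k.+1 b)%O.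
  move=> Vb Rk; have := ico_set_proper Vb Rk; rewrite lt_neqAle g_le (inj_eq g_inj).
  rewrite -(inj_eq val_inj) /Order.le /= /icosa_le !val_ico_face //.
  by rewrite properEneq.
have fix' i k b : ico_valid b -> letter_range 1 4 i -> rank_range 1 4 k -> k != i.+1 ->
    gb k (ico_r i b) = gb k b.
  move=> Vb Li Rk ki; congr g; apply: val_inj; rewrite !val_ico_face ?ico_valid_r //.
  exact: ico_set_fix.
have move' i b : ico_valid b -> letter_range 1 4 i -> gb i.+1 (ico_r i b) <> gb i.+1 b.
  move=> Vb Li /g_inj/(congr1 val); rewrite !val_ico_face ?ico_valid_r // => e.
  have : ico_r i b = b.
    apply: ico_set_inj; rewrite ?ico_valid_r // => k Rk.
    by have [->//|ki] := eqVneq k i.+1; apply: ico_set_fix.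
  have /and3P[/allP/(_ i) h1 _ _] := ico_checkP Vb.
  have /h1/and3P[_ _ ne] : i \in ico_letters by move: Li; rewrite /letter_range !inE; lia.
  by move=> e'; rewrite e' eqxx in ne.
have [x ex] := @model_flag _ _ _ _ _ _ _ fl _ gb ico_valid lt' ico_base V0.
exists x => w Lw ew.
have [Vw e] := @model_act _ _ _ _ _ _ _ fl _ ico_r gb ico_valid
  (fun i b Li Vb => ico_valid_r Vb Li) lt' fix' move' ico_base x w V0 Lw ex.
apply: ico_set_inj => // k Rk.
by rewrite -!val_ico_face //; congr val; apply: g_inj; rewrite -/(gb k _) -e // ew ex.
Qed.

End IcoModel.

(** * Translation lattices *)

Lemma hex_mulz (x y k : int) : ((x, y) *~ k = (x * k, y * k) :> hex_point)%R.
Proof.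
have pos (n : nat) : ((x, y) *~ n%:Z = (x * n%:Z, y * n%:Z) :> hex_point)%R.
  by rewrite -pmulrn pairMnE /= -(mulr_natr x n) -(mulr_natr y n) !natz.
case: k => n; first exact: pos.
by rewrite NegzE mulrNz pos !mulrN.
Qed.

Lemma torus_latticeP (b c : nat) (v : hex_point) : torus_lattice b c v <->
  exists k l : int,
    v = (b%:Z * k - c%:Z * l, c%:Z * k + (b%:Z + c%:Z) * l)%R.
Proof.
by split=> -[k [l ->]]; exists k, l; rewrite /rot60 !hex_mulz /=; congr (_, _); rewrite /=; ring.
Qed.

(** The form c x - b y vanishes at (b, c) and takes the value -p at its image under [rot60]. The
    lattice has index p, so it is the kernel of the form modulo p. *)
Lemma torus_lattice_dvd (p b c : nat) (v : hex_point) :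
  prime p -> p = b ^ 2 + b * c + c ^ 2 -> 0 < b -> 0 < c ->
  torus_lattice b c v <-> (p%:Z %| (c%:Z * v.1 - b%:Z * v.2)%R)%Z.
Proof.
move=> p_pr ep b0 c0; have epz : (p%:Z = b%:Z ^+ 2 + b%:Z * c%:Z + c%:Z ^+ 2)%R by lia.
case: v => x y; split=> /= [/torus_latticeP[k [l [-> ->]]]|].
  apply/dvdzP; exists (- l)%R; rewrite epz; ring.
case/dvdzP=> q eq; pose l := (- q)%R.
have cop : coprimez p%:Z c%:Z.
  rewrite coprimezE /= prime_coprime //; apply/negP=> /dvdn_leq - /(_ c0); rewrite ep; nia.
(* Cramer's rule asks for k = (x (b + c) + y c)/p; its integrality is checked after multiplying by
   c, which is prime to p. *)
have : (p%:Z %| (c%:Z * (x * (b%:Z + c%:Z) + y * c%:Z))%R)%Z.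
  apply/dvdzP; exists (q * (b%:Z + c%:Z) + y)%R; rewrite epz.
  have -> : (c%:Z * (x * (b%:Z + c%:Z) + y * c%:Z) =
    (c%:Z * x - b%:Z * y) * (b%:Z + c%:Z) + y * (b%:Z ^+ 2 + b%:Z * c%:Z + c%:Z ^+ 2))%R by ring.
  by rewrite eq epz; ring.
rewrite Gauss_dvdzr // => /dvdzP[k ek].
have p0 : (p%:Z != 0)%R by have := prime_gt0 p_pr; lia.
have ex : (x = b%:Z * k - c%:Z * l)%R.
  apply: (mulfI p0); transitivity (b%:Z * (k * p%:Z) + c%:Z * (q * p%:Z))%R.
    by rewrite -ek -eq epz; ring.
  by rewrite /l; ring.
have ey : (y = c%:Z * k + (b%:Z + c%:Z) * l)%R.
  apply: (mulfI p0); transitivity (c%:Z * (k * p%:Z) - (b%:Z + c%:Z) * (q * p%:Z))%R.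
    by rewrite -ek -eq epz; ring.
  by rewrite /l; ring.
by apply/torus_latticeP; exists k, l; rewrite ex ey.
Qed.

Lemma torus_lattice_diag (m : nat) (v : hex_point) :
  torus_lattice m 0 v <-> exists k l : int, v = (m%:Z * k, m%:Z * l)%R.
Proof.
split=> [/torus_latticeP[k [l ->]]|[k [l ->]]]; last apply/torus_latticeP;
  by exists k, l; congr (_, _); ring.
Qed.

Lemma torus_lattice_scale (m b c : nat) (v : hex_point) :
  torus_lattice (m * b) (m * c) v <->
  exists2 u, torus_lattice b c u & v = (m%:Z * u.1, m%:Z * u.2)%R.
Proof.
split=> [/torus_latticeP[k [l ->]]|[u /torus_latticeP[k [l ->]] ->]].
  exists (b%:Z * k - c%:Z * l, c%:Z * k + (b%:Z + c%:Z) * l)%R.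
    by apply/torus_latticeP; exists k, l.
  by congr (_, _); rewrite /= !PoszM; ring.
by apply/torus_latticeP; exists k, l; congr (_, _); rewrite /= !PoszM; ring.
Qed.

Section TorusMeet.
Variables (p b c m : nat).
Hypotheses (p_pr : prime p) (ep : p = b ^ 2 + b * c + c ^ 2) (b0 : 0 < b) (c0 : 0 < c).

Lemma torus_meet_dvd v : p %| m ->
  (torus_lattice b c v /\ torus_lattice m 0 v) <-> torus_lattice m 0 v.
Proof.
move=> pm; split=> [[]//|vm]; split=> //; apply/(torus_lattice_dvd _ p_pr ep b0 c0).
have /torus_lattice_diag[k [l ->]] := vm.
have -> : (c%:Z * (m%:Z * k) - b%:Z * (m%:Z * l) = m%:Z * (c%:Z * k - b%:Z * l))%R by ring.
by rewrite dvdz_mulr.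
Qed.

(** As m is invertible modulo p, a multiple m u lies in the lattice of (b, c) only if u does. *)
Lemma torus_meet_coprime v : ~~ (p %| m) ->
  (torus_lattice b c v /\ torus_lattice m 0 v) <-> torus_lattice (m * b) (m * c) v.
Proof.
move=> pm; have cop : coprimez p%:Z m%:Z by rewrite coprimezE /= prime_coprime.
split=> [[vbc /torus_lattice_diag[k [l ev]]]|/torus_lattice_scale[u ubc ev]].
  apply/torus_lattice_scale; exists (k, l) => //.
  apply/(torus_lattice_dvd _ p_pr ep b0 c0) => /=.
  move/(torus_lattice_dvd _ p_pr ep b0 c0): vbc; rewrite ev /=.
  have -> : (c%:Z * (m%:Z * k) - b%:Z * (m%:Z * l) = m%:Z * (c%:Z * k - b%:Z * l))%R by ring.
  by rewrite Gauss_dvdzr.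
split; last by apply/torus_lattice_diag; exists u.1, u.2.
apply/(torus_lattice_dvd _ p_pr ep b0 c0); rewrite ev /=.
move/(torus_lattice_dvd _ p_pr ep b0 c0): ubc => ubc.
have -> : (c%:Z * (m%:Z * u.1) - b%:Z * (m%:Z * u.2) = m%:Z * (c%:Z * u.1 - b%:Z * u.2))%R by ring.
by rewrite dvdz_mull.
Qed.

(** The vector is the mirror image of (mb, mc), and the linear form takes the value m c (2b + c) on
    it. If p divided 2b + c, then 4p = (2b + c)^2 + 3c^2 would make it divide 3c^2. *)
Lemma torus_not_reflexible : 3 < p -> ~~ (p %| m) ->
  ~ torus_lattice (m * b) (m * c) ((m * b + m * c)%:Z, - (m * c)%:Z)%R.
Proof.
move=> lt3 pm /(torus_meet_coprime _ pm)[/(torus_lattice_dvd _ p_pr ep b0 c0) /= h _].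
have epz : (p%:Z = b%:Z ^+ 2 + b%:Z * c%:Z + c%:Z ^+ 2)%R by lia.
have lt_cp : c < p by rewrite ep; nia.
have ndvd n : 0 < n -> n < p -> coprimez p%:Z n%:Z.
  move=> n0 np; rewrite coprimezE /= prime_coprime //; apply/negP=> /dvdn_leq - /(_ n0); lia.
have copm : coprimez p%:Z m%:Z by rewrite coprimezE /= prime_coprime.
have copc := ndvd c c0 lt_cp.
have {h} : (p%:Z %| (m%:Z * (c%:Z * (2 * b%:Z + c%:Z)))%R)%Z.
  by move: h; congr (_ %| _)%Z; rewrite PoszD !PoszM; ring.
rewrite !Gauss_dvdzr // => /dvdzP[q eq].
have : (p%:Z %| (c%:Z * (3 * c%:Z))%R)%Z.
  apply/dvdzP; exists (4 - q * (2 * b%:Z + c%:Z))%R.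
  have -> : ((4 - q * (2 * b%:Z + c%:Z)) * p%:Z =
      4 * p%:Z - (q * p%:Z) * (2 * b%:Z + c%:Z))%R by ring.
  by rewrite -eq {1}epz; ring.
rewrite Gauss_dvdzr // (mulrC 3%R) Gauss_dvdzr //.
by move=> h3; have := ndvd 3 isT lt3; rewrite coprimezE /= prime_coprime // => /negP; apply.
Qed.

End TorusMeet.

(** * The constants over the prime field *)

Section L2Instance.
Variables (p b c : nat).
Hypotheses (p_pr : prime p) (p60 : p %% 60 = 1 \/ p %% 60 = 49).
Hypotheses (b0 : 0 < b) (c0 : 0 < c) (ep : p = b ^ 2 + b * c + c ^ 2).

Local Notation F := 'F_p.

Lemma Fp_int_eq0 (z : int) : (z%:~R == 0 :> F)%R = (p%:Z %| z)%Z.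
Proof.
have nat_eq0 (n : nat) : (n%:R == 0 :> F)%R = (p %| n).
  by rewrite -(dvdn_pcharf (pchar_Fp p_pr)).
by case: z => n; rewrite ?NegzE ?rmorphN ?oppr_eq0 /= nat_eq0 dvdzE // abszN.
Qed.

Lemma Fp_nat_neq0 (n : nat) : coprime p n -> (n%:R != 0 :> F)%R.
Proof.
move=> cop; rewrite -(dvdn_pcharf (pchar_Fp p_pr)); apply: contraTN cop => pn.
by rewrite prime_coprime // negbK.
Qed.

Lemma Fp_prime_field (x y : F) : (x != 0 -> exists n : nat, y = x *+ n)%R.
Proof.
move=> x0; exists (y / x : F)%R.
by rewrite -[(x *+ _)%R]mulr_natr natr_Zp mulrC divfK.
Qed.

Let p30 : coprime p 30.
Proof.
have h q : prime q -> q %| 60 -> coprime p q.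
  move=> q_pr q60; rewrite coprime_sym prime_coprime //; apply/negP=> qp.
  have : q %| p %% 60 by rewrite /dvdn modn_dvdm.
  have : q <= 60 by apply: dvdn_leq.
  have : 1 < q by apply: prime_gt1.
  case: p60 => ->.
    by move=> q1 _ /dvdn_leq - /(_ isT); lia.
  move=> _ _ q49; have : q %| 60 - 49 by rewrite dvdn_sub.
  rewrite /= => q11; have : q %| gcdn 49 11 by rewrite dvdn_gcd q49.
  by rewrite (_ : gcdn 49 11 = 1) // dvdn1 => /eqP q1; rewrite q1 in q_pr.
rewrite (_ : 30 = 2 * 3 * 5) // !coprimeMr.
by rewrite !h.
Qed.

Lemma L2_generators : exists (t : nat -> coset_of 'Z(SL2 p)),
  [/\ t 0%N = 1%g,
      [/\ (t 2%N * t 2%N = 1)%g, (t 3%N * t 3%N = 1)%g, ((t 1%N)^-1 * t 3%N = (t 3%N)^-1 * t 1%N)%g,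
          (t 1%N * (t 2%N)^-1 * t 1%N = t 2%N * (t 1%N)^-1 * t 2%N)%g
        & (t 2%N * (t 3%N)^-1 * t 2%N * (t 3%N)^-1 * t 2%N =
           t 3%N * (t 2%N)^-1 * t 3%N * (t 2%N)^-1 * t 3%N)%g],
      [/\ forall i, t i \in L2 p,
          forall K : {group coset_of 'Z(SL2 p)},
            t 1%N \in K -> t 2%N \in K -> t 3%N \in K -> L2 p \subset K
        & forall f : {morphism L2 p >-> coset_of 'Z(SL2 p)},
            f (t 1%N) = ((t 1%N)^-1)%g -> f (t 2%N) = ((t 2%N)^-1)%g -> False],
      [/\ forall N : {group coset_of 'Z(SL2 p)}, N \subset L2 p ->
            L2 p \subset 'N(N)%g -> N :=: 1%g \/ L2 p \subset N,
          'Z(L2 p)%g = 1%g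
        & 2 * #|L2 p| = p * (p ^ 2 - 1)]
    & forall w, all (letter_range 0 3) w ->
        walk (grp_r t) (1%g, false) w = (1%g, false) <->
        exists2 v, walk hex_r hex_base w = hex_shift v hex_base & torus_lattice b c v].
Proof.
have two : (2 != 0 :> F)%R by apply: Fp_nat_neq0; apply: coprime_dvdr p30.
have fifteen : (15 != 0 :> F)%R by apply: Fp_nat_neq0; apply: coprime_dvdr p30.
have cF : (c%:R != 0 :> F)%R.
  apply: Fp_nat_neq0; rewrite prime_coprime //; apply/negP=> /dvdn_leq - /(_ c0).
  by rewrite ep; nia.
have cardF := card_Fp p_pr.
have [i ei] : exists i : F, (i ^+ 2 = -1)%R.
  by apply: exists_sqrt_neg1; rewrite cardF; case: p60 => h; lia.
have cardS : #|SL2 p| = p * (p ^ 2 - 1) by rewrite -[in RHS]cardF; apply: card_SL2.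
pose S2p := @sl2mx F.
have H1 : forall a b c d : F, (a * d - b * c = 1)%R -> S2p a b c d \in SL2 p := @S2_in F.
have H2 := @S2_mul F.
have H3 := @S2_1 F.
have H4 := @S2_inj F.
have H5 : forall g, g \in SL2 p ->
    exists a b c d : F, (a * d - b * c = 1)%R /\ g = S2p a b c d := @S2P F.
have [l el] : exists l : F, (l ^+ 2 + l - 1 = 0)%R.
  apply: (@exists_golden F _ (SL2_group p) S2p H2 H3 H4 H5).
  rewrite /= cardS; apply: dvdn_mull.
  have : p %% 5 = 1 \/ p %% 5 = 4 by case: p60 => h; [left | right]; lia.
  have p_gt1 := prime_gt1 p_pr.
  rewrite -[X in _ %| _ - X](exp1n 2) subn_sqr => -[h|h].
    by apply: dvdn_mulr; lia.
  by apply: dvdn_mull; lia.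
(* The equation b^2 + bc + c^2 = 0 in the field makes [z] a root of z^2 - z + 1, with 1 - z =
   -b/c. *)
pose z : F := ((b%:R + c%:R) / c%:R)%R.
have pF : (b%:R ^+ 2 + b%:R * c%:R + c%:R ^+ 2 = 0 :> F)%R.
  by rewrite -!natrX -natrM -!natrD -ep pchar_Fp_0.
have ez : (z ^+ 2 = z - 1)%R.
  apply/eqP; rewrite -subr_eq0; apply/eqP.
  transitivity ((b%:R ^+ 2 + b%:R * c%:R + c%:R ^+ 2) / c%:R ^+ 2 : F)%R.
    by rewrite /z; field.
  by rewrite pF mul0r.
(* Since z^3 = -1, its square is -z^4 = z. Starting from [z] rather than its conjugate makes eta
   equal to -b/c, which ties the kernel to the lattice of (b, c). *)
pose a := (i * z ^+ 2)%R.
have ea2 : (a ^+ 2 = z)%R by rewrite /a; ring: ei ez.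
have Ha : (a ^+ 4 = a ^+ 2 - 1)%R by rewrite (exprM a 2 2) ea2 ez.
have Hl : (l ^+ 2 = 1 - l)%R.
  by apply/eqP; rewrite -subr_eq0; apply/eqP; rewrite -el; ring.
have eta : (b%:R + c%:R * (1 - a ^+ 2) = 0)%R by rewrite ea2 /z; field.
pose pf := Fp_prime_field.
exists (@tcl F _ (SL2_group p) S2p a l); split.
- exact: cl1.
- split.
  + exact: (@tcl22 F _ (SL2_group p) S2p H1 H2 H3 H4 H5 a l Ha).
  + exact: (@tcl33 F _ (SL2_group p) S2p H1 H2 H3 H4 H5 a l).
  + exact: (@tcl13 F _ (SL2_group p) S2p H1 H2 H3 H4 H5 a l Ha).
  + exact: (@tcl_braid12 F _ (SL2_group p) S2p H1 H2 H3 H4 H5 a l Ha Hl).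
  + exact: (@tcl_braid23 F _ (SL2_group p) S2p H1 H2 H3 a l Ha Hl).
- split.
  + exact: (@tcl_in F _ (SL2_group p) S2p H1 a l Ha).
  + exact: (@tcl_gen F _ (SL2_group p) S2p H1 H2 H3 H4 H5 pf a l Ha Hl).
  + move=> f f1 f2.
    exact: (@tcl_no_reflection F _ (SL2_group p) S2p H1 H2 H3 H4 H5 fifteen
      a l Ha Hl f b c f1 f2 eta cF).
- split.
  + exact: (@L2_simple F _ (SL2_group p) S2p H1 H2 H3 H4 H5 pf two fifteen).
  + exact: (@center_LG F _ (SL2_group p) S2p H1 H2 H3 H4 H5 pf two fifteen a l Ha Hl).
  + by rewrite -cardS; exact: (@card_L2 F _ (SL2_group p) S2p H1 H2 H3 H4 H5 two).
- move=> w Lw.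
  (* With eta = -b/c, multiplying [hex_val] by c gives the form c x - b y that detects the lattice
     modulo p. *)
  have hv v : (hex_val a v = 0)%R <-> torus_lattice b c v.
    rewrite (torus_lattice_dvd _ p_pr ep b0 c0) -Fp_int_eq0 rmorphB !rmorphM /=.
    have eb : (b%:R = - (c%:R * (1 - a ^+ 2)) :> F)%R by apply/eqP; rewrite -addr_eq0 eta.
    have -> : (c%:~R * v.1%:~R - b%:~R * v.2%:~R = c%:R * hex_val a v :> F)%R.
      by rewrite /hex_val [b%:~R%R]eb; ring.
    by rewrite mulf_eq0 (negPf cF); split=> [->|/eqP].
  have st := @hex_stab F _ (SL2_group p) S2p H1 H2 H3 H4 H5 two fifteen a l Ha Hl w Lw.
  by split=> [/st[v ev /hv lv]|[v ev /hv lv]]; [exists v | apply/st; exists v].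
Qed.

End L2Instance.

(** * Rotations of a regular polytope *)

Section GroupFlags.
Variables (gT : finGroupType) (tau : nat -> gT).

Lemma grp_rK i : involutive (grp_r tau i).
Proof. by case=> g [] /=; rewrite /grp_r /= ?mulKg ?mulKVg. Qed.

Lemma walk_grp_par x w : (walk (grp_r tau) x w).2 = x.2 (+) odd (size w).
Proof. by elim: w x => [|i w IHw] x /=; rewrite ?addbF // IHw /= addNb addbN. Qed.

Lemma walk_grpMr x w h :
  walk (grp_r tau) (x.1 * h, x.2)%g w =
  ((walk (grp_r tau) x w).1 * h, (walk (grp_r tau) x w).2)%g.
Proof.
elim: w x => [|i w IHw] x //=; rewrite -IHw /=; congr walk.
by rewrite /grp_r /=; case: (x.2); rewrite mulgA.
Qed.

(** Letters multiply on the left, so they commute with right multiplication; the words fixing a flag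
    depend only on its parity. *)
Lemma grp_stab x g w : walk (grp_r tau) x w = x ->
  walk (grp_r tau) (g, x.2) w = (g, x.2).
Proof.
move=> e; have := walk_grpMr x w (x.1^-1 * g)%g; rewrite e /=.
by rewrite mulgA mulgV mul1g.
Qed.

Lemma grp_comm i j : (tau i * (tau j)^-1 = tau j * (tau i)^-1)%g ->
  ((tau i)^-1 * tau j = (tau j)^-1 * tau i)%g ->
  forall x, grp_r tau i (grp_r tau j x) = grp_r tau j (grp_r tau i x).
Proof. by move=> e1 e2 [g []]; rewrite /grp_r /= !mulgA ?e1 ?e2. Qed.

End GroupFlags.

Lemma walk_grp_morph (gT hT : finGroupType) (tau : nat -> gT) (sg : nat -> hT)
    (f : gT -> hT) (I : pred nat) : {morph f : x y / (x * y)%g} ->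
  (forall i, I i -> f (tau i) = sg i) -> forall w x, all I w ->
  walk (grp_r sg) (f x.1, x.2) w =
  (f (walk (grp_r tau) x w).1, (walk (grp_r tau) x w).2).
Proof.
move=> fM f_tau; have f1 : f 1%g = 1%g by apply: (mulgI (f 1%g)); rewrite -fM !mulg1.
have fV x : f (x^-1)%g = ((f x)^-1)%g by apply: (mulgI (f x)); rewrite -fM !mulgV.
elim=> [|i w IHw] x //= /andP[Ii Iw]; rewrite -IHw //=; congr walk.
by rewrite /grp_r /=; case: (x.2); rewrite fM ?fV f_tau.
Qed.

Section RegularPolytope.
Variables (d : Order.disp_t) (Q : finTBPOrderType d) (Phi : {set Q}).
Hypotheses (pQ : polytope 4 Q) (regQ : regular Q) (fPhi : Phi \in flags Q).

Local Notation X := (pflag Q).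
Local Notation qr := (@pr _ Q).
Local Notation qfc := (@pfc _ Q).
Local Notation rr := (rank_range 0 4).
Local Notation lr := (letter_range 0 4).

Let flQ : flagged 0 4 qr qfc := polytope_flagged pQ.
Definition base_flag : X := exist _ Phi fPhi.
Local Notation x0 := base_flag.

Lemma flag_of_pflag (x : X) : flag_of 4 qfc x = val x.
Proof.
have [cQ _ _] := pQ; apply/eqP; rewrite eqEcard (card_flag_of flQ) (cQ _ (valP x)).
rewrite leqnn andbT; apply/subsetP=> F /flag_ofP[k Rk ->].
exact: (nth_faceP pQ (valP x) Rk).1.
Qed.

Lemma regular_move x y : exists2 s, s \in automorphisms Q
  & forall k, rr k -> s (qfc k x) = qfc k y.
Proof.
have [s As es] := atransP2 regQ (valP x) (valP y).
exists s => //; apply: (setact_flag_ofE flQ) => //.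
by rewrite !flag_of_pflag es.
Qed.

Lemma regular_stab x y w : all lr w -> walk qr x w = x -> walk qr y w = y.
Proof.
move=> Lw; have [s As es] := regular_move x y.
by move/(automorphism_stab flQ As es Lw).
Qed.

Lemma aut_letter s x y i : s \in automorphisms Q ->
  (forall k, rr k -> s (qfc k x) = qfc k y) -> lr i ->
  forall k, rr k -> s (qfc k (qr i x)) = qfc k (qr i y).
Proof.
move=> As es Li k Rk; have := automorphism_act flQ As es (w := [:: i]).
by rewrite /= Li => /(_ isT k Rk).
Qed.

Lemma rhoP i : lr i -> rho Phi i \in automorphisms Q /\
  forall k, rr k -> rho Phi i (qfc k x0) = qfc k (qr i x0).
Proof.
move=> Li; have ePhi : Phi = flag_of 4 qfc x0 by rewrite flag_of_pflag.
rewrite /rho; case: pickP => [s /= /andP[As adj]|no]; last first.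
  have [s As es] := regular_move x0 (qr i x0).
  have := no s; rewrite /= As /= => /negP[].
  have -> : [set s F | F in Phi] = flag_of 4 qfc (qr i x0).
    by rewrite -(setact_flag_of es) -ePhi.
  rewrite {1}ePhi /adjacent_at (adjacent_flag_of flQ) //=.
  rewrite (flag_of_diff flQ) //; apply/forall_inP=> F /set1P->.
  rewrite (face_rankE flQ); last by move: Li; rewrite /letter_range /rank_range; lia.
  by apply/eqP; lia.
split=> //; have [y ey] := automorphism_face flQ x0 As.
have es : [set s F | F in Phi] = flag_of 4 qfc y.
  by rewrite -(setact_flag_of ey) -ePhi.
move: adj; rewrite es /adjacent_at {1 2}ePhi => /andP[adj /forall_inP rk].
have [j Lj ej] := adjacent_flag_ofP flQ adj.
have : qfc j.+1 x0 \in flag_of 4 qfc x0 :\: flag_of 4 qfc y.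
  by rewrite ej (flag_of_diff flQ) // set11.
move/rk; rewrite (face_rankE flQ); last by move: Lj; rewrite /letter_range /rank_range; lia.
by move/eqP=> ji; have <- : j = i by [lia]; rewrite -ej.
Qed.

(** This is the product of sigma_1, ..., sigma_i, trivial for i = 0; it is the choice of generators
    that fits [grp_r]. *)
Definition rtau i : {perm Q} := (rho Phi 0 * rho Phi i)%g.

Lemma rho2 i : lr i -> (rho Phi i * rho Phi i)%g = 1%g.
Proof.
move=> Li; have [Ai ei] := rhoP Li; apply: (automorphism_free flQ (x := x0)).
- exact: groupM.
- exact: group1.
move=> k Rk; rewrite permM perm1 ei // (aut_letter Ai ei Li) //.
by rewrite (fl_inv flQ Li).
Qed.

Lemma rhoV i : lr i -> ((rho Phi i)^-1)%g = rho Phi i.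
Proof. by move=> Li; apply/eqP; rewrite eq_invg_mul rho2. Qed.

Let L0 : lr 0 := isT.

Lemma rtau0 : rtau 0 = 1%g.
Proof. by rewrite /rtau rho2. Qed.

Lemma rtau_aut i : lr i -> rtau i \in automorphisms Q.
Proof. by move=> Li; rewrite groupM // ?(rhoP L0).1 ?(rhoP Li).1. Qed.

Definition flag_rel (y : {perm Q} * bool) (z : X) : Prop :=
  y.1 \in automorphisms Q /\
  forall k, rr k -> y.1 (qfc k (if y.2 then qr 0 x0 else x0)) = qfc k z.

Lemma flag_rel_r i y z : lr i -> flag_rel y z -> flag_rel (grp_r rtau i y) (qr i z).
Proof.
move=> Li [Ay ey]; have [A0 e0] := rhoP L0; have [Ai ei] := rhoP Li.
have Ati := rtau_aut Li.
split; first by rewrite /grp_r /=; case: (y.2); rewrite groupM ?groupV.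
case: y Ay ey => y [] /= Ay ey k Rk.
  rewrite /grp_r /= /rtau invMg !rhoV // !permM ei //.
  by rewrite (aut_letter A0 e0 Li) // (aut_letter Ay ey Li).
rewrite /grp_r /= /rtau !permM.
rewrite (aut_letter A0 e0 L0) // (fl_inv flQ L0) ei //.
exact: (aut_letter Ay ey Li).
Qed.

Lemma flag_rel_walk w : all lr w ->
  flag_rel (walk (grp_r rtau) (1%g, false) w) (walk qr x0 w).
Proof.
move=> Lw; apply: walk_morph Lw _ => [i y z|]; first exact: flag_rel_r.
by split=> [|k Rk]; rewrite ?group1 // perm1.
Qed.

Lemma rtau_stab w : all lr w -> walk (grp_r rtau) (1%g, false) w = (1%g, false) ->
  walk qr x0 w = x0.
Proof.
move=> Lw e; have := flag_rel_walk Lw; rewrite e => -[_ /= h].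
by apply: (face_inj flQ) => k Rk; rewrite -h // perm1.
Qed.

(** Under regularity alone a flag might be coded with either parity; an even word must return to the
    even code. *)
Lemma rtau_stab_even w : all lr w -> ~~ odd (size w) -> walk qr x0 w = x0 ->
  walk (grp_r rtau) (1%g, false) w = (1%g, false).
Proof.
move=> Lw ev e; have := flag_rel_walk Lw; rewrite e.
have := walk_grp_par rtau (1%g, false) w; rewrite /= (negPf ev).
case: (walk _ _ w) => y b /= -> [/= Ay h]; congr (_, _).
by apply: (automorphism_free flQ (x := x0)) => // k Rk; rewrite perm1 h.
Qed.

Lemma rtau_rel i j : i.+1 < j -> j < 4 ->
  ((rtau j)^-1 * rtau i * (rtau j)^-1 * rtau i)%g = 1%g.
Proof.
move=> ij j4; have Li : lr i by rewrite /letter_range; lia.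
have Lj : lr j by rewrite /letter_range; lia.
have := @rtau_stab_even [:: i; j; i; j].
rewrite /= Li Lj /= => /(_ isT isT).
rewrite -(pr_comm pQ x0 ij j4) !(fl_inv flQ) // => /(_ erefl)[].
by rewrite mulg1 !mulgA.
Qed.

Lemma rotation_rtau i : lr i -> rtau i \in rotation_group 4 Phi.
Proof.
move=> Li; have sig j : 0 < j < 4 -> sigma Phi j \in rotation_group 4 Phi.
  move=> Rj; have lt_j : j < 4 by lia.
  apply: mem_gen; apply/imsetP; exists (Ordinal lt_j) => //.
  by rewrite inE /=; lia.
have step j : j < 3 -> rtau j \in rotation_group 4 Phi -> rtau j.+1 \in rotation_group 4 Phi.
  move=> lt_j tj; have -> : rtau j.+1 = (rtau j * sigma Phi j.+1)%g.
    rewrite /rtau /sigma /= mulgA -(mulgA (rho Phi 0)) rho2 ?mulg1 //.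
    by rewrite /letter_range; lia.
  by rewrite groupM // sig //; lia.
have t0 : rtau 0 \in rotation_group 4 Phi by rewrite rtau0 group1.
have t1 := step 0 isT t0; have t2 := step 1 isT t1; have t3 := step 2 isT t2.
by case: i Li => [|[|[|[|i]]]] // Li; exfalso; move: Li; rewrite /letter_range; lia.
Qed.

Lemma rtau_gen (K : {group {perm Q}}) :
  rtau 1 \in K -> rtau 2 \in K -> rtau 3 \in K -> rotation_group 4 Phi \subset K.
Proof.
move=> K1 K2 K3; rewrite gen_subG; apply/subsetP=> _ /imsetP[[j lt_j] j0 ->].
rewrite inE /= in j0; rewrite /=.
have -> : sigma Phi j = ((rtau j.-1)^-1 * rtau j)%g.
  rewrite /rtau /sigma invMg !rhoV //; last by rewrite /letter_range; lia.
  by rewrite mulgA -(mulgA (rho Phi j.-1)) rho2 // mulg1.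
have K0 : rtau 0 \in K by rewrite rtau0 group1.
by case: j lt_j j0 => [|[|[|[|j]]]] //= _ _; rewrite groupM ?groupV.
Qed.

Lemma rotation_sub : rotation_group 4 Phi \subset automorphisms Q.
Proof. by apply: rtau_gen; apply: rtau_aut. Qed.

(* Conjugation by [rho_0] inverts every [rtau i], so it intertwines the walks
   from the two base flags. *)
Lemma rtau_reflect w : all lr w -> forall y e,
  walk (grp_r rtau) (1%g, false) w = (y, e) ->
  walk (grp_r rtau) (1%g, true) w = (rho Phi 0 * y * rho Phi 0, ~~ e)%g.
Proof.
move=> Lw y e ew.
pose R (a b : {perm Q} * bool) := b = (rho Phi 0 * a.1 * rho Phi 0, ~~ a.2)%g.
have step i a b : lr i -> R a b -> R (grp_r rtau i a) (grp_r rtau i b).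
  move=> Li ->; rewrite /R /grp_r /=; congr (_, _).
  case: a.2 => /=; rewrite /rtau invMg !rhoV // !mulgA //.
  by rewrite rho2 // mul1g -(mulgA (rho Phi i)) rho2 // mulg1.
have := @walk_morph _ _ (grp_r rtau) (grp_r rtau) lr R step w (1%g, false) (1%g, true) Lw.
by rewrite /R ew /= mulg1 rho2 // => ->.
Qed.

End RegularPolytope.

Lemma sub_letters lo hi n w : hi <= n -> all (letter_range lo hi) w ->
  all (letter_range 0 n) w.
Proof.
move=> hn; apply: sub_all => i; rewrite /letter_range => /andP[_ ih].
exact: leq_trans ih hn.
Qed.

Lemma walk_val (X Y : Type) (r : nat -> X -> X) (s : nat -> Y -> Y) (v : Y -> X)
    (I : pred nat) : (forall i y, I i -> v (s i y) = r i (v y)) ->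
  forall w y, all I w -> v (walk s y w) = walk r (v y) w.
Proof.
by move=> e; elim=> [|i w IHw] y //= /andP[Ii Iw]; rewrite IHw // e.
Qed.

Section TorusModel.
Variables (m : nat) (d : Order.disp_t) (S : finPOrderType d) (X : finType).
Variables (r : nat -> X -> X) (fc : nat -> X -> S).
Hypotheses (m2 : 1 < m) (fl : flagged 0 3 r fc).
Hypothesis iso : poset_iso S (hexagonal_torus m 0).
Local Open Scope quotient_scope.
Local Notation T := (hexagonal_torus m 0).

(** This is where m at least 2 enters: a lattice vector with a component 1 or -1 could identify
    faces that a letter should distinguish. *)
Let no_unit (t : hex_point) : torus_lattice m 0 t ->
  (t.1 \in [:: 1; -1]%R) || (t.2 \in [:: 1; -1]%R) = false.
Proof.
case/torus_lattice_diag=> k [l ->] /=; rewrite !inE.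
have h (j : int) : ((m%:Z * j == 1) || (m%:Z * j == -1) = false)%R.
  by apply/negP=> /orP[]/eqP/(congr1 absz); rewrite abszM => /eqP /=; rewrite muln_eq1; lia.
by rewrite !h.
Qed.

Lemma torus_model_stab : exists x, forall w, all (letter_range 0 3) w ->
  walk r x w = x <-> torus_stab m 0 w.
Proof.
have [h [[g hK gK] h_le]] := iso.
have g_le : {mono g : x y / (x <= y)%O} by move=> x y; rewrite -h_le !gK.
have g_inj := can_inj gK.
pose gb k a := g (\pi_T (hex_face k a)).
have V0 : hex_valid hex_base by [].
have valid_r i b : letter_range 0 3 i -> hex_valid b -> hex_valid (hex_r i b).
  by move=> _; apply: hex_valid_r.
have lt' k b : hex_valid b -> 0 <= k <= 3 -> (gb k b < gb k.+1 b)%O.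
  move=> Vb /andP[_ Rk]; rewrite lt_neqAle g_le (inj_eq g_inj); apply/andP; split.
    apply/eqP=> /torus_piP[t _ /(congr1 hex_level)].
    by rewrite hex_level_translate !hex_level_face //; lia.
  by apply/torus_leP; eexists; eexists; split; first reflexivity; first reflexivity;
    apply: hex_face_mono => //; lia.
have fix' i k b : hex_valid b -> letter_range 0 3 i -> rank_range 0 3 k -> k != i.+1 ->
    gb k (hex_r i b) = gb k b.
  by move=> Vb Li Rk ki; rewrite /gb hex_face_fix.
have move' i b : hex_valid b -> letter_range 0 3 i -> gb i.+1 (hex_r i b) <> gb i.+1 b.
  case: b => [[v u] u'] Vb Li /g_inj/torus_piP[t lt].
  have := @hex_units_all (fun q => [&& vertex_kind q.1 (q.1 - q.2)%R != vertex_kind q.1 q.2,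
      edge_kind q.2 != edge_kind q.1
    & (q.1.1 \in [:: 1; -1]%R) || (q.1.2 \in [:: 1; -1]%R)]) ltac:(by vm_compute) v u u' Vb.
  case/and3P=> /= vk ek un.
  have [->|[->|->]] : i = 0 \/ i = 1 \/ i = 2 by move: Li; rewrite /letter_range; lia.
  - by case=> e _; rewrite e eqxx in vk.
  - by case=> e _; rewrite e eqxx in ek.
  - case=> e; have eu : u = (- t)%R by apply/eqP; rewrite -addr_eq0; apply/eqP;
      apply: (addrI v); rewrite addr0 addrA -e.
    by have := no_unit (torus_latticeN lt); rewrite -eu un.
have [x ex] := @model_flag _ _ _ _ _ _ _ fl _ gb hex_valid lt' hex_base V0.
exists x => w Lw.
have [Vw e] := @model_act _ _ _ _ _ _ _ fl _ hex_r gb hex_valid valid_r lt' fix' move'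
  hex_base x w V0 Lw ex.
split=> [ew|[t lt ew]]; last first.
  apply: (face_inj fl) => k Rk; rewrite e // ex // ew /gb hex_face_shift; congr g.
  apply/torus_piP; exists (- t)%R; first exact: torus_latticeN.
  by case: (hex_face _ _) => *; rewrite /= ?addrK.
have same k : rank_range 0 3 k -> exists2 t, torus_lattice m 0 t
    & hex_face k (walk hex_r hex_base w) = hex_translate t (hex_face k hex_base).
  move=> Rk; apply/torus_piP; apply: g_inj; rewrite -/(gb k hex_base).
  by rewrite -[RHS]/(gb k (walk hex_r hex_base w)) -e // ew ex.
rewrite /torus_stab; case: (walk hex_r hex_base w) Vw same {e} => [[v u] u'] Vw same.
have [t1 lt1 f1] := same 1 isT; have [t2 lt2 f2] := same 2 isT.
have [t3 lt3 f3] := same 3 isT.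
have e1 := congr1 (fun F => if F is HexVertex s _ then s else false) f1.
have e2 := congr1 (fun F => if F is HexEdge s _ then s else ord0) f2.
have e2' := congr1 (fun F => if F is HexEdge _ x then x else 0%R) f2.
have e3 := congr1 (fun F => if F is HexTile x then x else 0%R) f3.
rewrite /= add0r in e3; rewrite /= in e1 e2.
(* If the kinds of vertex and edge agree with those of the base flag, the flag is a translate of the
   base, or its edge offset has a component 1 or -1 and would be a lattice vector. *)
have := @hex_units_all (fun q => [&& vertex_kind q.1 q.2 == vertex_kind (1, 0)%R (0, 1)%R
    & edge_kind q.1 == edge_kind (1, 0)%R] ==> (q == ((1, 0), (0, 1))%R) ||
    ((edge_offset q.1).1 \in [:: 1; -1]%R) || ((edge_offset q.1).2 \in [:: 1; -1]%R))
  ltac:(by vm_compute) v u u' Vw.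
rewrite [_ ==> _]/= e1 e2 !eqxx [_ ==> _]/= -orbA => /orP[/eqP[-> ->]|un].
  by exists v; [rewrite e3 | rewrite /hex_shift /hex_base /= add0r].
have eo : edge_offset u = (t2 - v)%R.
  have e2'' : (edge_offset u + v = 0 + 0 + t2)%R := e2'.
  by apply/eqP; rewrite eq_sym subr_eq e2'' !add0r.
have := no_unit (torus_latticeD lt2 (torus_latticeN lt3)).
by rewrite -e3 -eo un.
Qed.

End TorusModel.

Section TypedPolytope.
Variables (m : nat) (d : Order.disp_t) (Q : finTBPOrderType d) (Phi : {set Q}).
Hypotheses (m2 : 1 < m) (pQ : polytope 4 Q) (regQ : regular Q) (fPhi : Phi \in flags Q).
Hypothesis typeQ : has_type 4 Q (hexagonal_torus m 0) icosahedron.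

Local Notation qr := (@pr _ Q).
Local Notation qfc := (@pfc _ Q).
Let flQ : flagged 0 4 qr qfc := polytope_flagged pQ.
Local Notation x0 := (base_flag fPhi).

Lemma facet_stab w : all (letter_range 0 3) w ->
  walk qr x0 w = x0 <-> torus_stab m 0 w.
Proof.
move=> Lw; have Lw4 := sub_letters (isT : 3 <= 4) Lw.
have [Y [rY [fY [v [y0 [flY v_inj _ vr _]]]]]] :=
  @section_flagged 4 0 3 _ _ _ _ _ x0 flQ isT.
have iso : poset_iso (section_of (qfc 0 x0) (qfc 4 x0)) (hexagonal_torus m 0).
  rewrite (flagged_bot flQ); apply: typeQ.1.
  by rewrite (face_rankE flQ).
have [y yP] := torus_model_stab m2 flY iso.
rewrite -(yP w Lw); have vw := walk_val vr y Lw.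
split=> e.
  by apply: v_inj; rewrite vw; apply: (regular_stab pQ regQ (v y) Lw4 e).
apply: (regular_stab pQ regQ x0 Lw4 (x := v y)).
by rewrite -vw e.
Qed.

Lemma vertex_figure_stab w : all (letter_range 1 4) w ->
  walk qr x0 w = x0 -> walk ico_r ico_base w = ico_base.
Proof.
move=> Lw; have Lw4 := sub_letters (isT : 4 <= 4) Lw.
have [Y [rY [fY [v [y0 [flY v_inj _ vr _]]]]]] :=
  @section_flagged 4 1 4 _ _ _ _ _ x0 flQ isT.
have iso : poset_iso (section_of (qfc 1 x0) (qfc 5 x0)) icosahedron.
  rewrite (flagged_top flQ); apply: typeQ.2.
  by rewrite (face_rankE flQ).
have [y yP] := ico_stab flY iso => e; apply: yP => //.
apply: v_inj; rewrite (walk_val vr) //.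
exact: (regular_stab pQ regQ (v y) Lw4 e).
Qed.

End TypedPolytope.

(** * The chiral cover *)

(* The linear part of the reflection [hex_r 0] of the base flag. *)
Definition hex_flip (v : hex_point) : hex_point := (v.1 + v.2, - v.2)%R.

Fact hex_flip_is_additive : {morph hex_flip : u v / (u - v)%R}.
Proof.
by case=> x y [x' y']; congr (_, _); rewrite /= ?opprD // addrACA.
Qed.

HB.instance Definition _ :=
  GRing.isZmodMorphism.Build hex_point hex_point hex_flip hex_flip_is_additive.

Lemma hex_flipK : involutive hex_flip.
Proof. by case=> x y; rewrite /hex_flip /= addrK opprK. Qed.

Lemma hex_turn_flipK : involutive (hex_turn hex_flip).
Proof. by case=> [[v u] u'] /=; rewrite !hex_flipK. Qed.

Lemma hex_flip_walk w v :
  walk hex_r (hex_r 0 hex_base) w = hex_shift v (hex_r 0 hex_base) <->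
  walk hex_r hex_base w = hex_shift (hex_flip v) hex_base.
Proof.
have -> : hex_r 0 hex_base = hex_turn hex_flip hex_base by [].
have turn u a : hex_turn hex_flip (hex_shift u a) = hex_shift (hex_flip u) (hex_turn hex_flip a).
  by case: a => [[v' u1] u2] /=; rewrite raddfD.
rewrite walk_hex_turn; split=> [/(congr1 (hex_turn hex_flip))|->].
  by rewrite turn !hex_turn_flipK.
by rewrite turn hex_flipK.
Qed.

Lemma torus_lattice_flip m v : torus_lattice m 0 v -> torus_lattice m 0 (hex_flip v).
Proof.
move=> /torus_lattice_diag[k [l ->]]; apply/torus_lattice_diag.
by exists (k + l)%R, (- l)%R; rewrite /hex_flip /= mulrDr mulrN.
Qed.

Section Cover.
Variables (b c m : nat) (d : Order.disp_t) (Q : finTBPOrderType d) (Phi : {set Q}).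
Hypotheses (m2 : 1 < m) (pQ : polytope 4 Q) (regQ : regular Q) (fPhi : Phi \in flags Q).
Hypothesis typeQ : has_type 4 Q (hexagonal_torus m 0) icosahedron.
Variables (lT : finGroupType) (L : {group lT}) (t : nat -> lT).
Hypothesis t0 : t 0 = 1%g.
Hypothesis t22 : (t 2%N * t 2%N)%g = 1%g.
Hypothesis t33 : (t 3%N * t 3%N)%g = 1%g.
Hypothesis t13 : ((t 1%N)^-1 * t 3%N = (t 3%N)^-1 * t 1%N)%g.
Hypothesis tb12 : (t 1%N * (t 2%N)^-1 * t 1%N = t 2%N * (t 1%N)^-1 * t 2%N)%g.
Hypothesis tb23 : (t 2%N * (t 3%N)^-1 * t 2%N * (t 3%N)^-1 * t 2%N =
                   t 3%N * (t 2%N)^-1 * t 3%N * (t 2%N)^-1 * t 3%N)%g.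
Hypothesis t_in : forall i, t i \in L.
Hypothesis no_refl : forall f : {morphism L >-> lT},
  f (t 1%N) = ((t 1%N)^-1)%g -> f (t 2%N) = ((t 2%N)^-1)%g -> False.
Hypothesis centerL : 'Z(L)%g = 1%g.
Hypothesis hexL : forall w, all (letter_range 0 3) w ->
  walk (grp_r t) (1%g, false) w = (1%g, false) <->
  exists2 v, walk hex_r hex_base w = hex_shift v hex_base & torus_lattice b c v.
(** The product group enters only through its two projections, which keeps concrete quotient and
    subgroup types out of the proofs. *)
Variables (hT : finGroupType) (tau : nat -> hT) (f1 : hT -> lT) (f2 : hT -> {perm Q}).
Hypothesis f1M : {morph f1 : x y / (x * y)%g}.
Hypothesis f2M : {morph f2 : x y / (x * y)%g}.
Hypothesis f12_inj : forall g h, f1 g = f1 h -> f2 g = f2 h -> g = h.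
Hypothesis f1_in : forall h, f1 h \in L.
Hypothesis f2_in : forall h, f2 h \in rotation_group 4 Phi.
Hypothesis f12_surj : forall l y, l \in L -> y \in rotation_group 4 Phi ->
  exists h, f1 h = l /\ f2 h = y.
Hypothesis f1_tau : forall i, letter_range 0 4 i -> f1 (tau i) = t i.
Hypothesis f2_tau : forall i, letter_range 0 4 i -> f2 (tau i) = rtau Phi i.
Hypothesis tau_gen : forall K : {group hT}, tau 1 \in K -> tau 2 \in K -> tau 3 \in K ->
  forall h, h \in K.

Local Notation qr := (@pr _ Q).
Local Notation qfc := (@pfc _ Q).
Local Notation rr := (rank_range 0 4).
Local Notation lr := (letter_range 0 4).
Let flQ : flagged 0 4 qr qfc := polytope_flagged pQ.
Local Notation x0 := (base_flag fPhi).
Local Notation X := (hT * bool)%type.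
Local Notation r := (grp_r tau).
Local Notation o0 := ((1%g, false) : X).
Local Notation o1 := ((1%g, true) : X).

Let f11 : f1 1%g = 1%g.
Proof. by apply: (mulgI (f1 1%g)); rewrite -f1M !mulg1. Qed.
Let f21 : f2 1%g = 1%g.
Proof. by apply: (mulgI (f2 1%g)); rewrite -f2M !mulg1. Qed.
Let f1V x : f1 (x^-1)%g = ((f1 x)^-1)%g.
Proof. by apply: (mulgI (f1 x)); rewrite -f1M !mulgV. Qed.
Let f2V x : f2 (x^-1)%g = ((f2 x)^-1)%g.
Proof. by apply: (mulgI (f2 x)); rewrite -f2M !mulgV. Qed.

Let L0 : lr 0 := isT.

Lemma cover_tau0 : tau 0 = 1%g.
Proof.
apply: f12_inj; first by rewrite f1_tau // t0 f11.
by rewrite f2_tau // f21 (rtau0 pQ regQ fPhi).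
Qed.

Lemma cover_rel i j : i.+1 < j -> j < 4 ->
  ((tau j)^-1 * tau i * (tau j)^-1 * tau i)%g = 1%g.
Proof.
move=> ij j4; have Li : lr i by rewrite /letter_range; lia.
have Lj : lr j by rewrite /letter_range; lia.
apply: f12_inj; last first.
  by rewrite !f2M !f2V !f2_tau // f21 (rtau_rel pQ regQ fPhi ij j4).
rewrite !f1M !f1V !f1_tau // f11.
have V2 u : (u * u = 1 -> u^-1 * 1 * u^-1 * 1 = 1 :> lT)%g.
  by move=> uu; rewrite !mulg1 -invMg uu invg1.
have [[-> ->]|[[-> ->]|[-> ->]]] : (i = 0 /\ j = 2) \/ (i = 0 /\ j = 3) \/ (i = 1 /\ j = 3) by lia.
- by rewrite t0 V2.
- by rewrite t0 V2.
- by rewrite -mulgA -{1}t13 mulgA mulgK mulVg.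
Qed.

Lemma cover_comm i j x : i.+1 < j -> j < 4 -> r i (r j x) = r j (r i x).
Proof.
move=> ij j4; have rel := cover_rel ij j4.
have e2 : ((tau j)^-1 * tau i = (tau i)^-1 * tau j)%g.
  have /eqP : (((tau j)^-1 * tau i) * ((tau j)^-1 * tau i) = 1)%g by rewrite mulgA.
  by rewrite -eq_invg_mul invMg invgK => /eqP.
apply: grp_comm; last by [].
have -> : (tau i * (tau j)^-1 = tau j * ((tau j)^-1 * tau i) * (tau j)^-1)%g.
  by rewrite mulKVg.
by rewrite e2 mulgA mulgK.
Qed.

Lemma cover_walk1 w x : all lr w ->
  walk (grp_r t) (f1 x.1, x.2) w = (f1 (walk r x w).1, (walk r x w).2).
Proof. by move=> Lw; apply: (walk_grp_morph f1M f1_tau). Qed.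

Lemma cover_walk2 w x : all lr w ->
  walk (grp_r (rtau Phi)) (f2 x.1, x.2) w = (f2 (walk r x w).1, (walk r x w).2).
Proof. by move=> Lw; apply: (walk_grp_morph f2M f2_tau). Qed.

Lemma cover_stab_split w : all lr w -> walk r o0 w = o0 <->
  walk (grp_r t) (1%g, false) w = (1%g, false) /\
  walk (grp_r (rtau Phi)) (1%g, false) w = (1%g, false).
Proof.
move=> Lw; have := cover_walk1 o0 Lw; have := cover_walk2 o0 Lw.
rewrite /= f11 f21 => -> ->; case: (walk r o0 w) => h e /=.
split=> [[-> ->]|[[e1 ->] [e2]]]; first by rewrite f11 f21.
by congr (_, _); apply: f12_inj; rewrite ?f11 ?f21.
Qed.

Lemma cover_stabE x y w : x.2 = y.2 -> walk r x w = x -> walk r y w = y.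
Proof.
move=> exy e; have := grp_stab y.1 e; rewrite exy.
by case: y {exy}.
Qed.

Lemma cover_pi_exists (x : X) : exists z, flag_rel fPhi (f2 x.1, x.2) z.
Proof.
have Af : f2 x.1 \in automorphisms Q by apply: (subsetP (rotation_sub pQ regQ fPhi)).
have [z ez] := automorphism_face flQ (if x.2 then qr 0 x0 else x0) Af.
by exists z.
Qed.

(** The covering map on flags, which forgets the component in [L]. *)
Definition cover_pi x := projT1 (cid (cover_pi_exists x)).

Lemma cover_piP x : flag_rel fPhi (f2 x.1, x.2) (cover_pi x).
Proof. exact: projT2 (cid (cover_pi_exists x)). Qed.

Lemma cover_pi_r i x : lr i -> cover_pi (r i x) = qr i (cover_pi x).
Proof.
move=> Li; have [_ e1] := flag_rel_r pQ regQ Li (cover_piP x).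
have [_ e2] := cover_piP (r i x).
have e := cover_walk2 x (w := [:: i]).
rewrite /= Li in e; have {}e := e isT.
by apply: (face_inj flQ) => k Rk; rewrite -e1 // -e2 // e.
Qed.

Lemma cover_pi_walk w x : all lr w -> cover_pi (walk r x w) = walk qr (cover_pi x) w.
Proof. by move=> Lw; apply: (walk_val cover_pi_r). Qed.

(** Such a word is trivial on the icosahedron, hence under all involutions satisfying the same braid
    relations, in particular those given by [t]. This also shows that its length is even, which
    settles the component in the rotation group. *)
Lemma vertex_word_stab w : all (letter_range 1 4) w -> walk qr x0 w = x0 ->
  walk r o0 w = o0.
Proof.
move=> Lw ew; have Lw4 := sub_letters (isT : 4 <= 4) Lw.
have ico := vertex_figure_stab pQ regQ typeQ Lw ew.
have e1 : walk (grp_r t) (1%g, false) w = (1%g, false).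
  apply: ico_braid_walk Lw ico => [i _||x|].
  - exact: grp_rK.
  - have tb12' : ((t 1%N)^-1 * t 2%N * (t 1%N)^-1 = (t 2%N)^-1 * t 1%N * (t 2%N)^-1)%g.
      by apply: invg_inj; rewrite !invMg !invgK !mulgA.
    by case=> g []; rewrite /grp_r /= !mulgA ?tb12 ?tb12'.
  - apply: grp_comm x; last by [].
    have -> : (t 1%N * (t 3%N)^-1 = t 3%N * ((t 3%N)^-1 * t 1%N) * (t 3%N)^-1)%g by rewrite mulKVg.
    by rewrite -t13 mulgA mulgK.
  - have tb23' : ((t 2%N)^-1 * t 3%N * (t 2%N)^-1 * t 3%N * (t 2%N)^-1 =
      (t 3%N)^-1 * t 2%N * (t 3%N)^-1 * t 2%N * (t 3%N)^-1)%g.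
      by apply: invg_inj; rewrite !invMg !invgK !mulgA.
    by case=> g []; rewrite /grp_r /= !mulgA ?tb23 ?tb23'.
apply/cover_stab_split => //; split=> //.
apply: (rtau_stab_even pQ regQ Lw4 _ ew).
by have := walk_grp_par t (1%g, false) w; rewrite e1 /= => <-.
Qed.

Lemma cover_pi_stab x w : all (letter_range 1 4) w ->
  walk qr (cover_pi x) w = cover_pi x -> walk r x w = x.
Proof.
have even y u : y.2 = false -> all (letter_range 1 4) u ->
    walk qr (cover_pi y) u = cover_pi y -> walk r y u = y.
  move=> y2 Lu e; have Lu4 := sub_letters (isT : 4 <= 4) Lu.
  apply: (@cover_stabE o0) => //; apply: vertex_word_stab => //.
  exact: (regular_stab pQ regQ x0 Lu4 e).
move=> Lw e; case x2 : x.2; last exact: even.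
(* Odd flags are brought to even ones by letter 1, as letter 0 lies outside the range. *)
have L1 : letter_range 1 4 1 by [].
have rK := fl_inv flQ (isT : lr 1).
have p1 : (r 1 x).2 = false by rewrite /= x2.
have Lw1 : all (letter_range 1 4) (1 :: w ++ [:: 1]) by rewrite /= all_cat Lw.
have e1 z : walk r z (1 :: w ++ [:: 1]) = r 1 (walk r (r 1 z) w) by rewrite -cat1s !walk_cat.
have := even (r 1 x) _ p1 Lw1; rewrite e1 grp_rK -cat1s !walk_cat cover_pi_r //.
rewrite [walk qr _ [:: 1]]/= rK e /= => /(_ erefl).
by move/(congr1 (r 1)); rewrite !grp_rK.
Qed.

Lemma cover_pi_inj x y : conn r (letter_range 1 4) x y -> cover_pi x = cover_pi y -> x = y.
Proof.
case=> w Lw -> e; apply/esym/cover_pi_stab => //.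
by rewrite -cover_pi_walk ?(sub_letters (isT : 4 <= 4) Lw).
Qed.

(** The even flags reachable from the base form a subgroup, which contains [tau i] through the word
    i, 0; one more letter 0 reaches the odd flags. *)
Lemma cover_conn x y : conn r lr x y.
Proof.
have inv i : lr i -> involutive (r i) by move=> _; apply: grp_rK.
pose K := [set h : hT | `[< conn r lr o0 (h, false) >]].
have KP h : reflect (conn r lr o0 (h, false)) (h \in K) by rewrite inE; apply: asboolP.
have gK : group_set K.
  apply/group_setP; split=> [|g h /KP Kg /KP [w Lw ew]]; first by apply/KP; apply: conn_refl.
  apply/KP; have [w' Lw' ew'] := Kg; exists (w ++ w'); first by rewrite all_cat Lw.
  rewrite walk_cat -ew; have := walk_grpMr tau o0 w' h; rewrite /= mul1g => ->.
  by rewrite -ew'.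
have tK i : lr i -> tau i \in Group gK.
  move=> Li; apply/KP; exists [:: i; 0%N]; first by rewrite /= Li.
  by rewrite /= /grp_r /= cover_tau0 invg1 mul1g mulg1.
have all_h h : h \in K by apply: (tau_gen (K := Group gK)); apply: tK.
have fromo z : conn r lr o0 z.
  case: z => h []; last exact/KP.
  have /KP[w Lw ew] := all_h h; exists (rcons w 0); first by rewrite all_rcons Lw.
  by rewrite walk_rcons -ew /grp_r /= cover_tau0 mul1g.
exact: conn_trans (conn_sym inv (fromo x)) (fromo y).
Qed.

(** * Lifting the intersection property *)

Lemma cover_face k x y : rr k -> conn r (avoiding 4 k) x y ->
  qfc k (cover_pi x) = qfc k (cover_pi y).
Proof.
move=> Rk [w Lw ->]; rewrite cover_pi_walk; last by apply: sub_all Lw => i /andP[].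
by rewrite (face_walk flQ).
Qed.

(** Words keeping the vertex avoid letter 0, and [cover_pi] is injective along them; so the word
    that the intersection property provides in [Q] already connects [x] to [y]. *)
Lemma cover_meet1 (S : pred nat) x y : S 1 ->
  (forall k, rr k -> S k -> conn r (avoiding 4 k) x y) ->
  conn r [pred i | lr i & ~~ S i.+1] x y.
Proof.
move=> S1 h; have inv i : letter_range 1 4 i -> involutive (r i) by move=> _; apply: grp_rK.
have [|w Lw ew] := @fl_conn _ _ _ _ _ _ _ flQ S (cover_pi x) (cover_pi y).
  by move=> k Rk Sk; apply: cover_face => //; apply: h.
exists w => //; apply: cover_pi_inj; last first.
  by rewrite ew cover_pi_walk //; apply: sub_all Lw => i /andP[].
have c1 : conn r (letter_range 1 4) x y.
  apply: sub_conn (h 1 isT S1) => i /andP[]; rewrite /letter_range; lia.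
apply: conn_trans (conn_sym inv c1) _; exists w => //.
apply: sub_all Lw => i /andP[Li nS]; rewrite /letter_range.
case: i Li nS => [|i]; first by rewrite S1.
by rewrite /letter_range.
Qed.

(** Occurrences of [j] can be moved to the end, where they cancel in pairs. *)
Lemma cover_split (I : pred nat) j x y : (forall i, I i -> lr i) -> lr j ->
  (forall i z, I i -> i != j -> r i (r j z) = r j (r i z)) ->
  conn r I x y -> exists2 z, conn r [pred i | I i & i != j] x z & y = z \/ y = r j z.
Proof.
move=> IL Lj comm [w Iw ->]; elim/last_ind: w Iw => [|w i IHw].
  by move=> _; exists x; [apply: conn_refl | left].
rewrite all_rcons => /andP[Ii Iw]; have [z xz e] := IHw Iw; rewrite walk_rcons.
have [->|nij] := eqVneq i j.
  by exists z => //; case: e => ->; [right | left; rewrite grp_rK].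
exists (r i z); last by case: e => ->; [left | right; rewrite comm].
by apply: conn_trans xz _; exists [:: i] => //=; rewrite Ii nij.
Qed.

(** If [S] contains 2 but not 1, letter 0 commutes with the remaining letters and is split off,
    which adds index 1 to [S] and reduces to [cover_meet1]. Without 1 and 2, only the indices 3 and
    4 impose a condition. *)
Lemma cover_meet (S : pred nat) x y :
  (forall k, rr k -> S k -> conn r (avoiding 4 k) x y) ->
  conn r [pred i | lr i & ~~ S i.+1] x y.
Proof.
move=> h; case S1 : (S 1); first exact: cover_meet1.
have avL k i : avoiding 4 k i -> lr i by case/andP.
case S2 : (S 2).
  have [||||z xz e] := @cover_split (avoiding 4 2) 0 x y.
  - exact: avL.
  - by [].
  - move=> i z /andP[Li i2] i0; apply/esym/cover_comm; last by case/andP: Li.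
    by move: i2 i0; clear; lia.
  - exact: h.
  have zy : conn r [pred i | lr i & ~~ S i.+1] z y.
    by case: e => ->; [apply: conn_refl | exists [:: 0%N]; rewrite //= S1].
  apply: conn_trans zy.
  have := @cover_meet1 [pred k | (k == 1) || S k] x z.
  rewrite /= => /(_ isT) hz; apply: sub_conn (hz _) => [i /andP[Li]|k Rk /predU1P[->|Sk]].
  - by rewrite /= negb_or => /andP[_ ->]; rewrite Li.
  - apply: sub_conn xz => i /= /andP[/andP[Li _] i0]; rewrite /avoiding /= Li.
    by rewrite eqSS.
  - apply: conn_trans (h k Rk Sk) _.
    have k1 : k != 1 by apply: contraTneq Sk => ->; rewrite S1.
    case: e => ->; first exact: conn_refl.
    by exists [:: 0%N]; [rewrite /= /avoiding /= eq_sym k1 | rewrite /= grp_rK].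
case S3 : (S 3); last first.
  case S4 : (S 4); last first.
    apply: sub_conn (cover_conn x y) => i Li; rewrite /= Li /=.
    have : i < 4 by case/andP: Li.
    by case: i {Li} => [|[|[|[|i]]]] //= _; rewrite ?S1 ?S2 ?S3 ?S4.
  apply: sub_conn (h 4 isT S4) => i /andP[Li i4]; rewrite /= Li /=.
  have : i < 4 by case/andP: Li.
  by case: i i4 {Li} => [|[|[|[|i]]]] //= _; rewrite ?S1 ?S2 ?S3.
case S4 : (S 4); last first.
  apply: sub_conn (h 3 isT S3) => i /andP[Li i4]; rewrite /= Li /=.
  have : i < 4 by case/andP: Li.
  by case: i i4 {Li} => [|[|[|[|i]]]] //= _; rewrite ?S1 ?S2 ?S4.
(* Both 3 and 4 lie in [S]: if letter 3 survived the splitting, the images of [x] and [y] in [Q]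
   would have different faces of index 4. *)
have [||||z xz e] := @cover_split (avoiding 4 3) 3 x y.
- exact: avL.
- by [].
- move=> i z /andP[Li i2] i0; apply: cover_comm; last by [].
  have : i < 4 by case/andP: Li.
  by move: i2 i0; clear; lia.
- exact: h.
have xz' : conn r [pred i | lr i & ~~ S i.+1] x z.
  apply: sub_conn xz => i /= /andP[/andP[Li i4] i3]; rewrite Li /=.
  have : i < 4 by case/andP: Li.
  by case: i i3 i4 {Li} => [|[|[|[|i]]]] //= _ _ _; rewrite ?S1 ?S2.
case: e => ey; first by rewrite ey.
have x4z : conn r (avoiding 4 4) x z.
  by apply: sub_conn xz => i /= /andP[/andP[Li i4] i3]; rewrite /avoiding /= Li eqSS.
have := cover_face (isT : rr 4) (h 4 isT S4).
rewrite (cover_face (isT : rr 4) x4z) ey cover_pi_r // => /esym.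
by move/(fl_move flQ (isT : lr 3)).
Qed.

Lemma cover_free i x : lr i -> r i x <> x.
Proof. by move=> _ /(congr1 snd) /=; case: (x.2). Qed.

Definition cover_fs : flag_system :=
  @FlagSystem 4 (hT * bool)%type r o0 (fun i _ => grp_rK tau i) cover_comm
    cover_free cover_meet.

(** * Absence of reflections *)

Lemma cover_no_reflection :
  ~ (forall w, all lr w -> walk r o0 w = o0 -> walk r o1 w = o1).
Proof.
move=> H; have inv i : lr i -> involutive (r i) by move=> _; apply: grp_rK.
have wd_ex h : exists w, all lr w /\ walk r o0 w = (h, false).
  by have [w Lw ->] := cover_conn o0 (h, false); exists w.
pose wd h := projT1 (cid (wd_ex h)).
have wdP h : all lr (wd h) /\ walk r o0 (wd h) = (h, false) := projT2 (cid (wd_ex h)).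
(* Under the assumption, sending the end of a walk from [o0] to the end of the same walk from [o1]
   is well defined. This map inverts each [tau i] and acts on the component in [Q] as conjugation by
   rho_0. *)
pose alpha h := (walk r o1 (wd h)).1.
have alphaP w h : all lr w -> walk r o0 w = (h, false) -> walk r o1 w = (alpha h, true).
  move=> Lw ew; have [Lh eh] := wdP h.
  have e1 : walk r o1 (w ++ rev (wd h)) = o1.
    by apply: H; rewrite ?all_cat ?Lw ?all_rev // walk_cat ew -eh (walkK inv).
  have -> : walk r o1 w = walk r o1 (wd h).
    apply: (@walk_inj _ r lr inv _ _ (rev (wd h))); first by rewrite all_rev.
    by rewrite -walk_cat e1 (walkK inv).
  have := walk_grp_par tau o1 (wd h); have := walk_grp_par tau o0 (wd h).
  by rewrite /alpha eh; case: (walk r o1 (wd h)) => g e /= <- ->.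
have alphaM g h : alpha (g * h)%g = (alpha g * alpha h)%g.
  have [Lg eg] := wdP g; have [Lh eh] := wdP h.
  have : walk r o1 (wd h ++ wd g) = (alpha (g * h)%g, true).
    apply: alphaP; rewrite ?all_cat ?Lh // walk_cat eh.
    by have := walk_grpMr tau o0 (wd g) h; rewrite /= mul1g eg.
  rewrite walk_cat (alphaP _ _ Lh eh).
  by have := walk_grpMr tau o1 (wd g) (alpha h); rewrite /= mul1g (alphaP _ _ Lg eg) /= => -> [].
have alpha_tau i : lr i -> alpha (tau i) = ((tau i)^-1)%g.
  move=> Li; have := alphaP [:: i; 0%N] (tau i).
  rewrite /= Li /grp_r /= cover_tau0 invg1 !mul1g !mulg1 => /(_ isT erefl).
  by case.
have alpha2 h : f2 (alpha h) = (rho Phi 0 * f2 h * rho Phi 0)%g.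
  have [Lh eh] := wdP h.
  have e0 := cover_walk2 o0 Lh; rewrite eh /= f21 in e0.
  have := cover_walk2 o1 Lh; rewrite (alphaP _ _ Lh eh) /= f21.
  by rewrite (rtau_reflect pQ regQ fPhi Lh e0) => -[].
have alpha_surj h' : exists h, alpha h = h'.
  have [w Lw ew] := cover_conn o1 (h', true).
  have e0 : walk r o0 w = ((walk r o0 w).1, false).
    have ev : odd (size w) = false.
      by have := walk_grp_par tau o1 w; rewrite -ew /=; case: odd.
    have := walk_grp_par tau o0 w; rewrite /= ev.
    by case: (walk r o0 w) => g e /= ->.
  exists (walk r o0 w).1; have := alphaP _ _ Lw e0; rewrite -ew.
  by case.
have rho00 := rho2 pQ regQ fPhi (isT : lr 0).
pose lft l := odflt 1%g [pick h | (f1 h == l) && (f2 h == 1%g)].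
have lftP l : l \in L -> f1 (lft l) = l /\ f2 (lft l) = 1%g.
  move=> Ll; rewrite /lft; case: pickP => [h /andP[/eqP-> /eqP->] //|no].
  have [h [e1 e2]] := f12_surj Ll (group1 _).
  by have := no h; rewrite e1 e2 !eqxx.
pose beta l := f1 (alpha (lft l)).
have betaM : {in L &, {morph beta : x y / (x * y)%g}}.
  move=> x y Lx Ly; have [x1 x2] := lftP x Lx; have [y1 y2] := lftP y Ly.
  have [z1 z2] := lftP _ (groupM Lx Ly).
  rewrite /beta -f1M -alphaM; congr (f1 (alpha _)).
  by apply: f12_inj; rewrite ?f1M ?f2M ?z1 ?z2 ?x1 ?x2 ?y1 ?y2 ?mulg1.
(* The factor 1 x Gamma^+ commutes with L x 1, and every element of L x 1 is the image under [alpha]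
   of an element of L x 1; so [f1 (alpha h)] centralizes [L]. *)
have central h : f1 h = 1%g -> f1 (alpha h) = 1%g.
  move=> h1; suff : f1 (alpha h) \in 'Z(L)%g by rewrite centerL => /set1gP.
  apply/centerP; split=> [|l Ll]; first exact: f1_in.
  have [h' [e1 e2]] := f12_surj Ll (group1 _); have [k ek] := alpha_surj h'.
  have k2 : f2 k = 1%g.
    have := alpha2 k; rewrite ek e2 => e.
    by apply: (mulgI (rho Phi 0)); apply: (mulIg (rho Phi 0)); rewrite -e mulg1 rho00.
  have kh : (k * h = h * k)%g.
    by apply: f12_inj; rewrite ?f1M ?f2M ?h1 ?k2 ?mulg1 ?mul1g.
  by rewrite /commute -e1 -f1M -ek -alphaM -kh alphaM ek f1M e1.
have beta_t i : lr i -> beta (t i) = ((t i)^-1)%g.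
  move=> Li; have [x1 x2] := lftP _ (t_in i).
  have et : tau i = (lft (t i) * ((lft (t i))^-1 * tau i))%g by rewrite mulKVg.
  have := alpha_tau i Li; rewrite {1}et alphaM => /(congr1 f1).
  rewrite f1M f1V f1_tau // [X in (_ * X)%g]central ?mulg1 //.
  by rewrite f1M f1V x1 f1_tau // mulVg.
by apply: (no_refl (f := Morphism betaM)); apply: beta_t.
Qed.

Lemma cover_parity_stab x y : x.2 != y.2 ->
  ~ (forall w, all lr w -> walk r x w = x <-> walk r y w = y).
Proof.
move=> nxy St; apply: cover_no_reflection => w Lw e0; have [h1 h2] := St w Lw.
case ex : x.2; case ey : y.2; rewrite ex ey // in nxy.
  by apply: (@cover_stabE x) => //; apply: h2; apply: (@cover_stabE o0).
by apply: (@cover_stabE y) => //; apply: h1; apply: (@cover_stabE o0).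
Qed.

(** * Automorphisms and sections of the covering polytope *)

Section CoverPolytope.
Variables (dP : Order.disp_t) (P : finTBPOrderType dP) (fc : nat -> X -> P).
Hypothesis flP : flagged 0 4 r fc.

Lemma cover_chiral : chiral P.
Proof.
apply: (chiral_flagged flP (parity := snd)) => // [x y w exy _|x y s As nxy e].
  exact: cover_stabE.
apply: (cover_parity_stab nxy) => w Lw.
exact: (automorphism_stab flP As (setact_flag_ofE flP As e) Lw).
Qed.

(** Right multiplications commute with the letters and give automorphisms; by freeness there are no
    others, as none maps the base flag to an odd one. *)
Lemma cover_aut_isog : automorphisms P \isog [set: hT].
Proof.
have act_ex g : exists s, s \in automorphisms P /\
    forall k x, rr k -> s (fc k x) = fc k (x.1 * g, x.2)%g.
  have [|s As es] := automorphism_exists flP (x := o0) (y := (g, false)).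
    by move=> w _; split; apply: cover_stabE.
  exists s; split=> // k x Rk; have [w Lw ->] := cover_conn o0 x.
  rewrite es //; congr fc.
  by have := walk_grpMr tau o0 w g; rewrite /= mul1g.
pose F g := projT1 (cid (act_ex g)).
have FP g : F g \in automorphisms P /\
    forall k x, rr k -> F g (fc k x) = fc k (x.1 * g, x.2)%g := projT2 (cid (act_ex g)).
have FM : {in [set: hT] &, {morph F : x y / (x * y)%g}}.
  move=> g h _ _; have [Ag eg] := FP g; have [Ah eh] := FP h; have [Agh egh] := FP (g * h)%g.
  apply: (automorphism_free flP (x := o0)) => [//||k Rk]; first exact: groupM.
  by rewrite permM egh // eg // eh //= mulgA.
rewrite isog_sym; apply/isogP; exists (Morphism FM).
  apply/injmP=> g h _ _ /= e; have [_ eg] := FP g; have [_ eh] := FP h.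
  have : (1 * g, false)%g = (1 * h, false)%g.
    by apply: (face_inj flP) => k Rk; rewrite -(eg k o0) // -(eh k o0) // e.
  by rewrite !mul1g => -[].
apply/setP=> s; rewrite morphimEdom; apply/imsetP/idP => [[g _ ->]|As].
  exact: (FP g).1.
have [y ey] := automorphism_face flP o0 As.
have y2 : y.2 = false.
  apply/negbTE/negP=> y2; apply: (@cover_parity_stab o0 y); first by rewrite y2.
  by move=> w Lw; apply: (automorphism_stab flP As ey Lw).
exists y.1; rewrite ?inE //=; have [Ag eg] := FP y.1.
apply: (automorphism_free flP (x := o0)) => // k Rk.
by rewrite ey // eg //= mul1g; case: y {ey Ag eg} y2 => y1 y2 /= ->.
Qed.

Lemma cover_even_face k (F : P) : k != 1 -> face_rank F = (k%:Z - 1)%R ->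
  exists x, F = fc k x /\ x.2 = false.
Proof.
move=> k1 /(face_of_rank flP)[Rk [x ->]]; case x2 : x.2; last by exists x.
by exists (r 0 x); rewrite /= x2 (fl_fix flP).
Qed.

(** [cover_pi] is injective along the letters 1, 2, 3, so the same words fix flags of this
    vertex-figure and of one in [Q]. *)
Lemma cover_vertex_figure (F : P) : face_rank F = 0%R ->
  poset_iso (vertex_figure F) icosahedron.
Proof.
move=> rkF; have [_ [x eF]] := face_of_rank flP (k := 1) rkF.
have [Y [rY [fY [v [y0 [flY v_inj vy vr _]]]]]] :=
  @section_flagged 4 1 4 _ _ _ _ _ x flP isT.
have [Z [rZ [fZ [u [z0 [flZ u_inj uz ur _]]]]]] :=
  @section_flagged 4 1 4 _ _ _ _ _ (cover_pi x) flQ isT.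
have isoQ : poset_iso (section_of (qfc 1 (cover_pi x)) (qfc 5 (cover_pi x))) icosahedron.
  rewrite (flagged_top flQ); apply: typeQ.2.
  by rewrite (face_rankE flQ).
have [|f [f_bij f_le] _] :=
  presented_iso (flagged_presented y0 flY) (flagged_presented z0 flZ).
  move=> w Lw; have Lw4 := sub_letters (isT : 4 <= 4) Lw.
  have ev := walk_val vr y0 Lw; have eu := walk_val ur z0 Lw.
  rewrite vy in ev; rewrite uz in eu.
  split=> e.
    by apply: u_inj; rewrite eu uz -cover_pi_walk // -ev e vy.
  by apply: v_inj; rewrite ev vy; apply: cover_pi_stab => //; rewrite -eu e.
have [g [g_bij g_le]] := isoQ.
rewrite eF -(flagged_top flP x); exists (g \o f); split; first exact: bij_comp.
by move=> a1 a2; rewrite /= g_le f_le.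
Qed.

(** Each component of the product sees the same translation of the tessellation, modulo its own
    lattice. *)
Lemma cover_facet_stab w : all (letter_range 0 3) w -> walk r o0 w = o0 <->
  exists2 v, torus_lattice b c v /\ torus_lattice m 0 v
    & walk hex_r hex_base w = hex_shift v hex_base.
Proof.
move=> Lw; have Lw4 := sub_letters (isT : 3 <= 4) Lw.
have := facet_stab m2 pQ regQ fPhi typeQ Lw; rewrite /torus_stab => fs.
split=> [/(cover_stab_split Lw4)[/(hexL Lw)[v ev lv] /(rtau_stab pQ regQ fPhi Lw4)/fs[u lu]]|].
  move=> eu; have e : v = u by move: eu; rewrite ev /= !add0r; case.
  by exists v => //; rewrite [X in torus_lattice m 0 X]e.
move=> [v [lv lv'] ev]; apply/(cover_stab_split Lw4).
have e1 : walk (grp_r t) (1%g, false) w = (1%g, false) by apply/hexL => //; exists v.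
split=> //; apply: (rtau_stab_even pQ regQ Lw4).
  by have := walk_grp_par t (1%g, false) w; rewrite e1 /= => <-.
by apply/fs; exists v.
Qed.

Section Facets.
Variables B C : nat.
Hypothesis meet : forall v,
  (torus_lattice b c v /\ torus_lattice m 0 v) <-> torus_lattice B C v.

Lemma cover_torus_stab w : all (letter_range 0 3) w ->
  walk r o0 w = o0 <-> torus_stab B C w.
Proof.
move=> Lw; rewrite (cover_facet_stab Lw).
by split=> -[v lv ev]; exists v => //; apply/meet.
Qed.

Lemma cover_facet (F : P) : face_rank F = (4%:Z - 1)%R ->
  poset_iso (facet F) (hexagonal_torus B C).
Proof.
case/(cover_even_face (isT : 4 != 1)) => x [-> x2]; rewrite -(flagged_bot flP x).
have [Y [rY [fY [v [y0 [flY v_inj vy vr _]]]]]] :=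
  @section_flagged 4 0 3 _ _ _ _ _ x flP isT.
have [|f f_iso _] := presented_iso (flagged_presented y0 flY) (torus_presented B C).
  move=> w Lw; rewrite -(cover_torus_stab Lw).
  have ev := walk_val vr y0 Lw; rewrite vy in ev.
  split=> e; first by apply: (@cover_stabE x) => //; rewrite -ev e.
  by apply: v_inj; rewrite ev vy; apply: (@cover_stabE o0).
by exists f.
Qed.

Lemma cover_type : has_type 4 P (hexagonal_torus B C) icosahedron.
Proof. by split=> F; [apply: cover_facet | apply: cover_vertex_figure]. Qed.

(** Letter 0 exchanges the even and the odd base flag, and conjugation by it replaces a translation
    by its mirror image. *)
Lemma cover_odd_stab w : all (letter_range 0 3) w -> walk r o1 w = o1 <->
  exists2 v, torus_lattice B C (hex_flip v)
    & walk hex_r hex_base w = hex_shift v hex_base.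
Proof.
move=> Lw; have Lw' : all (letter_range 0 3) (0 :: w ++ [:: 0]) by rewrite /= all_cat Lw.
have eo : r 0 o0 = o1 by rewrite /grp_r /= cover_tau0 mul1g.
have e0 : walk r o0 (0 :: w ++ [:: 0]) = r 0 (walk r o1 w) by rewrite /= walk_cat -/(r 0 o0) eo.
have -> : walk r o1 w = o1 <-> walk r o0 (0 :: w ++ [:: 0]) = o0.
  by rewrite e0; split=> [->|/(congr1 (r 0))]; rewrite ?grp_rK -eo ?grp_rK.
rewrite (cover_torus_stab Lw') /torus_stab.
have -> : walk hex_r hex_base (0 :: w ++ [:: 0]) =
    hex_r 0 (walk hex_r (hex_r 0 hex_base) w) by rewrite /= walk_cat.
split=> -[v lv e].
  exists (hex_flip v); first by rewrite hex_flipK.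
  by apply/hex_flip_walk; rewrite -hex_r_shift -e hex_rK.
exists (hex_flip v) => //; apply: (can_inj (hex_rK 0)); rewrite hex_rK hex_r_shift.
by apply/hex_flip_walk; rewrite hex_flipK.
Qed.

End Facets.

(** The word that translates the base by (mb, mc) fixes the even flags, but not the odd ones, since
    the mirror image of this vector lies outside the lattice; it therefore detects the parity. *)
Lemma cover_facet_chiral (F : P) :
  (forall v, (torus_lattice b c v /\ torus_lattice m 0 v) <->
     torus_lattice (m * b) (m * c) v) ->
  ~ torus_lattice (m * b) (m * c) ((m * b + m * c)%:Z, - (m * c)%:Z)%R ->
  face_rank F = (4%:Z - 1)%R -> chiral (facet F).
Proof.
move=> meet norefl /(face_of_rank flP)[_ [x ->]]; rewrite -(flagged_bot flP x).
have [Y [rY [fY [v [y0 [flY v_inj vy vr _]]]]]] :=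
  @section_flagged 4 0 3 _ _ _ _ _ x flP isT.
pose w := hex_trans (m * b) (m * c).
have Lw : all (letter_range 0 3) w := hex_trans_letters _ _.
have ew : walk hex_r hex_base w = hex_shift ((m * b)%:Z, (m * c)%:Z)%R hex_base.
  rewrite /w /hex_base walk_hex_trans /= !add0r; congr (_, _, _).
  by rewrite !pairMnE /=; congr (_, _); rewrite /= ?mul0rn ?addr0 ?add0r natz.
have e0 : walk r o0 w = o0.
  apply/(cover_torus_stab meet Lw); exists ((m * b)%:Z, (m * c)%:Z)%R => //.
  by exists 1%R, 0%R; rewrite mulr1z mulr0z addr0.
have e1 : walk r o1 w <> o1.
  move/(cover_odd_stab meet Lw)=> [u lu]; rewrite ew /= !add0r => -[eu].
  by apply: norefl; rewrite -eu in lu; rewrite PoszD.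
have par y : walk rY y w = y <-> (v y).2 = false.
  have ev := walk_val vr y Lw; split=> [e|y2].
    apply/negbTE/negP=> y2; apply: e1; apply: (@cover_stabE (v y)) => //.
    by rewrite -ev e.
  by apply: v_inj; rewrite ev; apply: (@cover_stabE o0).
apply: (chiral_flagged flY (parity := fun y => (v y).2)) => //
  [i y Li|y z u eyz Lu e|y z s As nyz e].
- by rewrite vr.
- have eu a := walk_val vr a Lu.
  by apply: v_inj; rewrite eu; apply: (cover_stabE eyz); rewrite -eu e.
have := automorphism_stab flY As (setact_flag_ofE flY As e) Lw.
move: nyz; have := par y; have := par z.
by case: (v y).2; case: (v z).2 => // -[h1 h2] [h3 h4] _ [h5 h6];
  [have := h3 (h6 (h2 erefl)) | have := h1 (h5 (h4 erefl))].
Qed.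

(** The lattice of (m, 0) is invariant under [hex_flip], so even and odd flags of the facet are
    fixed by the same words. *)
Lemma cover_facet_regular (F : P) :
  (forall v, (torus_lattice b c v /\ torus_lattice m 0 v) <-> torus_lattice m 0 v) ->
  face_rank F = (4%:Z - 1)%R -> regular (facet F).
Proof.
move=> meet /(face_of_rank flP)[_ [x ->]]; rewrite -(flagged_bot flP x).
have [Y [rY [fY [v [y0 [flY v_inj vy vr _]]]]]] :=
  @section_flagged 4 0 3 _ _ _ _ _ x flP isT.
have flip01 w : all (letter_range 0 3) w -> walk r o0 w = o0 <-> walk r o1 w = o1.
  move=> Lw; rewrite (cover_torus_stab meet Lw) (cover_odd_stab meet Lw).
  split=> -[u lu eu]; exists u => //; first exact: torus_lattice_flip.
  by rewrite -[u]hex_flipK; apply: torus_lattice_flip.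
apply: (regular_flagged flY) => y z w Lw e.
have ev a := walk_val vr a Lw; apply: v_inj; rewrite ev.
have {}e : walk r (v y) w = v y by rewrite -ev e.
have to0 : walk r o0 w = o0.
  case y2 : (v y).2; last exact: (cover_stabE (y := o0) y2 e).
  by apply/flip01 => //; apply: (cover_stabE (y := o1) y2 e).
case z2 : (v z).2; last by apply: (@cover_stabE o0).
by apply: (@cover_stabE o1) => //; apply/flip01.
Qed.

End CoverPolytope.

Lemma cover_polytope : exists (d' : Order.disp_t) (P : finTBPOrderType d'),
  [/\ polytope 4 P, chiral P, automorphisms P \isog [set: hT],
      (forall v, (torus_lattice b c v /\ torus_lattice m 0 v) <->
         torus_lattice m 0 v) ->
      has_type 4 P (hexagonal_torus m 0) icosahedron /\
      (forall F : P, face_rank F = Posz 3 -> regular (facet F))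
    & (forall v, (torus_lattice b c v /\ torus_lattice m 0 v) <->
         torus_lattice (m * b) (m * c) v) ->
      ~ torus_lattice (m * b) (m * c) ((m * b + m * c)%:Z, - (m * c)%:Z)%R ->
      has_type 4 P (hexagonal_torus (m * b) (m * c)) icosahedron /\
      (forall F : P, face_rank F = Posz 3 -> chiral (facet F))].
Proof.
have flP := fs_flagged cover_fs.
exists _, (fs_face cover_fs : finTBPOrderType _); split.
- exact: (fs_polytope cover_fs).
- exact: (cover_chiral flP).
- exact: (cover_aut_isog flP).
- move=> meet; split; first exact: (cover_type flP meet).
  by move=> F; apply: (cover_facet_regular flP meet).
- move=> meet norefl; split; first exact: (cover_type flP meet).
  by move=> F; apply: (cover_facet_chiral flP meet norefl).
Qed.

End Cover.

(* By simplicity, the elements [(l, 1)] of [D] form the trivial group or all of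
   [L]; in the first case [D] is isomorphic to [R] and maps onto [L]. *)
Lemma goursat_simple (aT bT : finGroupType) (L : {group aT}) (R : {group bT})
    (D : {group aT * bT}) :
  (forall N : {group aT}, N \subset L -> L \subset 'N(N)%g ->
     N :=: 1%g \/ L \subset N) ->
  ~~ (#|L| %| #|R|) -> D \subset setX L R ->
  (forall K : {group aT}, (forall x, x \in D -> x.1 \in K) -> L \subset K) ->
  (forall K : {group bT}, (forall x, x \in D -> x.2 \in K) -> R \subset K) ->
  setX L R \subset D.
Proof.
move=> simL ndvd /subsetP sD genL genR.
have ontoL l : l \in L -> exists y, (l, y) \in D.
  have /subsetP sLD : L \subset (fst @* D)%G.
    by apply: genL => x Dx; apply: mem_morphim.
  by move=> /sLD/morphimP[[a y] _ Da ->]; exists y.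
have ontoR y : y \in R -> exists l, (l, y) \in D.
  have /subsetP sRD : R \subset (snd @* D)%G.
    by apply: genR => x Dx; apply: mem_morphim.
  by move=> /sRD/morphimP[[a z] _ Da ->]; exists a.
have prodM (a a' : aT) (y y' : bT) : ((a, y) * (a', y') = (a * a', y * y'))%g by [].
have prodV (a : aT) (y : bT) : ((a, y)^-1 = (a^-1, y^-1))%g by [].
pose N := [set l : aT | (l, 1%g : bT) \in D].
have gN : group_set N.
  apply/group_setP; split=> [|x y]; rewrite !inE; first exact: (group1 D).
  by move=> Dx Dy; have := groupM Dx Dy; rewrite prodM mulg1.
have sNL : N \subset L.
  by apply/subsetP=> l; rewrite inE => /sD; rewrite inE => /andP[].
have nNL : L \subset 'N(N)%g.
  apply/subsetP=> l Ll; rewrite inE; apply/subsetP=> _ /imsetP[n Nn ->].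
  have [y Dy] := ontoL l Ll; rewrite inE in Nn; rewrite inE.
  have := groupJ Nn Dy.
  have -> : ((n, 1) ^ (l, y) = (n ^ l, 1 ^ y) :> aT * bT)%g by [].
  by rewrite conj1g.
have [N1|sLN] := simL (Group gN) sNL nNL.
  case/negP: ndvd.
  have fD : (fst @* D)%g = L.
    apply/setP=> l; apply/morphimP/idP => [[[a y] _ /sD]|Ll].
      by rewrite inE => /andP[La _] ->.
    by have [y Dy] := ontoL l Ll; exists (l, y); rewrite ?inE.
  have sndD : (snd @* D)%g = R.
    apply/setP=> y; apply/morphimP/idP => [[[a z] _ /sD]|Ry].
      by rewrite inE => /andP[_ Rz] ->.
    by have [l Dl] := ontoR y Ry; exists (l, y); rewrite ?inE.
  have inj : {in D &, injective snd}.
    move=> [a y] [a' y'] Da Da' /= e; rewrite -e in Da' *.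
    have : (a * a'^-1)%g \in Group gN.
      by rewrite inE; have := groupM Da (groupVr Da'); rewrite prodV prodM mulgV.
    by rewrite N1 => /set1gP e1; rewrite -[a](mulgKV a') e1 mul1g.
  have -> : #|R| = #|D|.
    by rewrite -sndD morphimEsub ?subsetT // card_in_imset.
  by rewrite -{1}fD dvdn_morphim.
apply/subsetP=> -[l y]; rewrite inE => /andP[/= Ll Ry].
have [l' Dl'] := ontoR y Ry.
have Ll' : l' \in L by have := sD _ Dl'; rewrite inE => /andP[].
have : (l * l'^-1)%g \in N by apply: (subsetP sLN); rewrite groupM ?groupV.
rewrite inE => h; have := groupM h Dl'.
by rewrite prodM mul1g mulgKV.
Qed.

Theorem theorem7p7 (p b c m : nat) (d : Order.disp_t) (Q : finTBPOrderType d)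
    (Phi : {set Q}) :
  prime p ->
  p %% 60 = 1 \/ p %% 60 = 49 ->
  0 < b -> 0 < c -> p = b ^ 2 + b * c + c ^ 2 ->
  2 <= m ->
  polytope 4 Q -> directly_regular 4 Q ->
  has_type 4 Q (hexagonal_torus m 0) icosahedron ->
  ~~ (p * (p ^ 2 - 1) %| #|automorphisms Q|) ->
  Phi \in flags Q ->
  exists (d' : Order.disp_t) (P : finTBPOrderType d'),
    [/\ polytope 4 P,
        chiral P,
        automorphisms P \isog setX (L2 p) (rotation_group 4 Phi),
        p %| m ->
          has_type 4 P (hexagonal_torus m 0) icosahedron /\
          (forall F : P, face_rank F = Posz 3 -> regular (facet F))
      & ~~ (p %| m) ->
          has_type 4 P (hexagonal_torus (m * b) (m * c)) icosahedron /\
          (forall F : P, face_rank F = Posz 3 -> chiral (facet F))].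
Proof.
move=> p_pr p60 b0 c0 ep m2 pQ [regQ ind2] typeQ ndvd fPhi.
have [t [t0 [t22 t33 t13 tb12 tb23] [t_in t_gen no_refl] [simL cenL cardL] hexL]] :=
  L2_generators p_pr p60 b0 c0 ep.
have rt_in := rotation_rtau pQ regQ fPhi.
pose g i := (t i, rtau Phi i).
pose G := setX_group (L2 p) (rotation_group 4 Phi).
have gG i : letter_range 0 4 i -> g i \in G.
  by move=> Li; rewrite inE /= t_in rt_in.
have fullG (D : {group _}) : g 1 \in D -> g 2 \in D -> g 3 \in D -> G \subset D.
  move=> D1 D2 D3; pose E := (D :&: G)%G.
  have E1 : g 1 \in E by rewrite inE D1 gG.
  have E2 : g 2 \in E by rewrite inE D2 gG.
  have E3 : g 3 \in E by rewrite inE D3 gG.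
  suff : G \subset E by rewrite subsetI => /andP[].
  apply: goursat_simple => //.
  (* Doubling both orders turns a divisibility of the order of Gamma^+(Q) by that of L_2(p) into the
     excluded one. *)
  - apply: contra ndvd => dv; rewrite -cardL -(Lagrange (rotation_sub pQ regQ fPhi)).
    by rewrite (ind2 _ fPhi) mulnC dvdn_mul.
  - exact: subsetIr.
  - by move=> K sK; apply: t_gen; [apply: sK E1 | apply: sK E2 | apply: sK E3].
  - move=> K sK; apply: (rtau_gen pQ regQ fPhi).
    + exact: sK E1.
    + exact: sK E2.
    + exact: sK E3.
pose tau i := subg G (g i).
have tauE i : letter_range 0 4 i -> sgval (tau i) = g i.
  by move=> Li; rewrite subgK ?gG.
have hP (h : subg_of G) : (sgval h).1 \in L2 p /\ (sgval h).2 \in rotation_group 4 Phi.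
  by have := subgP h; rewrite inE => /andP[].
have [|||||||||d' [P [pP chP isoP reg chi]]] := @cover_polytope b c m d Q Phi m2 pQ regQ fPhi typeQ
  _ (L2 p) t t0 t22 t33 t13 tb12 tb23 t_in no_refl cenL hexL (subg_of G) tau
  (fun h => (sgval h).1) (fun h => (sgval h).2).
- by [].
- by [].
- by move=> x y e1 e2; apply: val_inj; rewrite /=; apply: injective_projections.
- by move=> h; apply: (hP h).1.
- by move=> h; apply: (hP h).2.
- move=> l y Ll Ry; exists (subg G (l, y)); rewrite subgK //.
  by rewrite inE /= Ll.
- by move=> i Li; rewrite tauE.
- by move=> i Li; rewrite tauE.
- move=> K K1 K2 K3 h.
  have im i : letter_range 0 4 i -> tau i \in K -> g i \in (sgval @* K)%G.
    by move=> Li Ki; rewrite -tauE //; apply: mem_morphim.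
  have /subsetP/(_ _ (subgP h))/morphimP[k _ Kk /val_inj-> //] :=
    fullG _ (im 1 isT K1) (im 2 isT K2) (im 3 isT K3).
exists d', P; split=> //.
- apply: isog_trans isoP _; rewrite isog_sym.
  exact: (isog_subg G).
- by move=> pm; apply: reg => v; apply: (torus_meet_dvd p_pr ep b0 c0 v pm).
- move=> pm; apply: chi => [v|]; first exact: (torus_meet_coprime p_pr ep b0 c0 v pm).
  apply: (torus_not_reflexible p_pr ep b0 c0) => //.
  (* The residues 1 and 49 modulo 60 leave no prime below 49. *)
  rewrite ltnNge; apply/negP=> p3; have := prime_gt1 p_pr.
  by case: p60 p3; clear; lia.
Qed.
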